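(* Let $n\ge2$, $T=\mathbb{R}^{2n+1}$, and let $E_0\subsetneq\dots\subsetneq E_{2n+1}=T$ be the flag \[E_k=\operatorname{Span}\{\theta_1,\theta_3,\dots,\theta_{2k-1}\}\ (0\le k\le n),\quad E_{n+k}=E_n\oplus\operatorname{Span}\{\theta_2,\theta_4,\dots,\theta_{2k}\}\ (1\le k<n),\] \[E_{2n}=E_{2n-1}\oplus\operatorname{Span}\{\theta_{2n+1}\},\quad E_{2n+1}=T.\] Then this flag is $\mathcal{I}^{\mathrm{SU}(n)}$-ordinary, and the group $\mathrm{SU}(n)\subset\mathrm{O}(2n+1)$ is strongly admissible. In particular, given an $\mathrm{SU}(n)$-structure $(\alpha,F,\Omega)$ on a manifold $M^{2n+1}$, its intrinsic torsion is entirely determined by $d\alpha$, $dF$, $d\Omega$.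
   Context: $\theta_1,\dots,\theta_{2n+1}$ is the standard orthonormal basis of $T$, identified with its dual. $\mathrm{SU}(n)\subset\mathrm{O}(2n+1)$ is the subgroup acting in the standard way on $\mathbb{R}^{2n}=\mathbb{C}^n$ and trivially on $\theta_{2n+1}$; its invariant forms $A=(\Lambda^*T)^{\mathrm{SU}(n)}$ are generated by $\alpha=\theta_{2n+1}$, $F=\theta_1\wedge\theta_2+\dots+\theta_{2n-1}\wedge\theta_{2n}$ and the real and imaginary parts of $\Omega=(\theta_1+i\theta_2)\wedge\dots\wedge(\theta_{2n-1}+i\theta_{2n})$. An $\mathrm{SU}(n)$-structure on $M^{2n+1}$ is a reduction of the frame bundle to $\mathrm{SU}(n)$, equivalently described by the corresponding forms $(\alpha,F,\Omega)$ on $M$. For $\zeta\in\mathfrak{gl}(T)$ let $D_\zeta$ be the degree-zero derivation of $\Lambda^*T$ extending $\zeta\colon T\to T$. For $W\subset T$, $c(W)$ is the dimension of the subspace of $\mathfrak{gl}(T)^*$ spanned by the functionals $\zeta\mapsto(D_\zeta\beta)(w_1,\dots,w_p)$, with $p\ge1$, $\beta\in A\cap\Lambda^pT$, $w_1,\dots,w_p\in W$. For $\eta=(\eta_{ijk})\in\mathfrak{gl}(T)\otimes T$ let $d_\eta$ be the degree-one derivation of $\Lambda^*T$ with $d_\eta(\theta_i)=-\sum_{j,k}\eta_{ijk}\,\theta_k\wedge\theta_j$, and let $Z_0=\{\eta: d_\eta|_A=0\}$. A flag $W_0\subsetneq\dots\subsetneq W_N=T$, $N=\dim T$, is $\mathcal{I}^{\mathrm{SU}(n)}$-ordinary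 if $c(W_0)+\dots+c(W_{N-1})=\dim\bigl(\mathfrak{gl}(T)\otimes T/Z_0\bigr)$. A compact group $G\subset\mathrm{O}(T)$ with Lie algebra $\mathfrak{g}$ is strongly admissible if, with $A=(\Lambda^*T)^G$, $Z_0=(\mathfrak{g}\otimes T)\oplus(T\otimes S^2T)$, where $\mathfrak{g}\otimes T$ consists of $\eta$ with $(\eta_{ijk})_{ij}\in\mathfrak{g}$ for every $k$, and $T\otimes S^2T$ of $\eta$ symmetric in $j,k$. The intrinsic torsion of a $G$-structure $P$ is the map $P\to (T\otimes\Lambda^2T)/(\mathfrak{g}\otimes T)$ given by the class of the torsion of any connection on $P$, where $\mathfrak{g}\otimes T$ is mapped to $T\otimes\Lambda^2T$ by skew-symmetrization in the last two indices. ''Entirely determined'' means that the intrinsic torsion at a point $u\in P$ is determined by the values at that point of $d\alpha,dF,d\Omega$. *)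

(* Defs.v *)
From HB Require Import structures.
From mathcomp Require Import all_boot all_order all_algebra.
From mathcomp Require Import spectral complex.
From mathcomp Require Import all_classical all_reals all_analysis.

Set Implicit Arguments.
Unset Strict Implicit.
Unset Printing Implicit Defensive.

Import Order.TTheory GRing.Theory Num.Theory.
Import numFieldNormedType.Exports.

Local Open Scope classical_set_scope.
Local Open Scope ring_scope.

(* Throughout, T = R^N is 'cV[R]_N, identified with its dual by the standard
   inner product, and gl(T) is 'M[R]_N acting on columns by z *m v. *)

Section Dimension.
Variables (K : fieldType) (vT : vectType K).

(* The dimension of a linear subspace V given as a set; it is meaningful
   because of [linear_set_vspace] below. *)
Definition dim_set (V : set vT) : nat :=
  \dim (xget 0%VS [set U : {vspace vT} | forall x, x \in U <-> V x]).

Definition codim_set (V : set vT) : nat := (\dim {:vT} - dim_set V)%N.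

Definition span_set (S : set vT) : set vT :=
  [set x | exists2 s : seq vT, (forall y, y \in s -> S y) & x \in span s].

Lemma linear_set_vspace (V : set vT) :
    V 0 -> (forall a x y, V x -> V y -> V (a *: x + y)) ->
  exists U : {vspace vT}, forall x, x \in U <-> V x.
Proof.
move=> V0 VZD.
pose Q k := `[< exists s : seq vT, [/\ forall y, y \in s -> V y, free s
                                     & size s = k] >].
have Q0 : exists k, Q k by exists 0; apply/asboolP; exists [::]; rewrite nil_free.
have Qmax k : Q k -> (k <= \dim {:vT})%N.
  move=> /asboolP[s [_ fs <-]].
  by move: fs; rewrite /free => /eqP <-; rewrite dimvS ?subvf.
case: (ex_maxnP Q0 Qmax) => k /asboolP[s [sV fs sk]] kmax.
have sumV (X : seq vT) x : (forall y, y \in X -> V y) -> x \in span X -> V x.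
  elim: X x => [|y X IH] x XV; first by rewrite span_nil memv0 => /eqP ->.
  rewrite span_cons => /memv_addP[a /vlineP[c ->]] [b bX ->].
  apply: VZD; first by apply: XV; rewrite mem_head.
  by apply: IH bX => z zX; apply: XV; rewrite in_cons zX orbT.
exists (span s) => x; split; first exact: sumV.
move=> Vx; apply/negPn/negP => xs.
suff /kmax : Q k.+1 by rewrite ltnn.
apply/asboolP; exists (x :: s); split; last by rewrite /= sk.
- by move=> y; rewrite in_cons => /predU1P[->//|]; exact: sV.
- by rewrite free_cons xs fs.
Qed.

End Dimension.

(* An element of the exterior algebra is the family of its coefficients on the
   basis e_S = e_(i_1) ^ ... ^ e_(i_p), where S = {i_1 < ... < i_p}. *)
Notation ext K N := {ffun {set 'I_N} -> K^o}.

(* gl(T) (x) T, encoded with eta_ijk = eta k i j. *)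
Notation glT K N := {ffun 'I_N -> 'M[K]_N}.

Section Exterior.
Variables (K : comNzRingType) (N : nat).
Local Notation Lambda := (ext K N).

(* The standard basis, numbered from 1 (theta j is 0 when j = 0 or j > N);
   hence the basis vector with index i : 'I_N is theta i.+1. *)
Definition theta (j : nat) : 'cV[K]_N := \col_i (i.+1 == j)%:R.

Definition ext1 : Lambda := [ffun S => (S == finset.set0)%:R].

(* The degree one element given by a (co)vector. *)
Definition ext_vec (v : 'cV[K]_N) : Lambda :=
  [ffun S => \sum_(i | S == finset.set1 i) v i 0].

Definition inversions (A B : {set 'I_N}) : nat :=
  #|[set p : 'I_N * 'I_N | (p.1 \in A) && (p.2 \in B) && (p.2 < p.1)%N]%SET|.

(* For disjoint A and B, e_A ^ e_B = (-1)^(inversions A B) e_(A u B). *)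
Definition wedge (a b : Lambda) : Lambda :=
  [ffun S : {set 'I_N} => \sum_(A in powerset S)
     (-1) ^+ inversions A (S :\: A)%SET * a A * b (S :\: A)%SET].

Definition wedges (s : seq Lambda) : Lambda := foldr wedge ext1 s.

Definition homogeneous (p : nat) (b : Lambda) : Prop :=
  forall S, b S != 0 -> #|S| = p.

(* Linear extension of a map given on the basis; enum S is increasing. *)
Definition ext_lift (f : seq 'I_N -> Lambda) (b : Lambda) : Lambda :=
  \sum_(S : {set 'I_N}) b S *: f (enum S).

(* The algebra endomorphism extending v |-> g *m v. *)
Definition ext_act (g : 'M[K]_N) : Lambda -> Lambda :=
  ext_lift (fun s => wedges [seq ext_vec (col i g) | i <- s]).

(* The Leibniz rule on e_(i_1) ^ ... ^ e_(i_p), with sign e = 1 for derivations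
   of even degree and e = -1 for those of odd degree; D1 i is the value on
   e_i. *)
Fixpoint leibniz (e : K) (D1 : 'I_N -> Lambda) (s : seq 'I_N) : Lambda :=
  if s is i :: s' then
    wedge (D1 i) (wedges [seq ext_vec (theta j.+1) | j : 'I_N <- s'])
      + e *: wedge (ext_vec (theta i.+1)) (leibniz e D1 s')
  else 0.

(* D_zeta: the degree zero derivation extending zeta. *)
Definition der0 (z : 'M[K]_N) : Lambda -> Lambda :=
  ext_lift (leibniz 1 (fun i => ext_vec (z *m theta i.+1))).

(* d_eta: the degree one derivation with
   d_eta theta_i = - sum_(j,k) eta_ijk theta_k ^ theta_j. *)
Definition der1 (eta : glT K N) : Lambda -> Lambda :=
  ext_lift (leibniz (-1) (fun i => - \sum_j \sum_k
    (eta k i j *: wedge (ext_vec (theta k.+1)) (ext_vec (theta j.+1))))).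

(* b(w_1, ..., w_p), where e_S(w_1, ..., w_p) is the determinant of the
   coordinates in S of the w's. *)
Definition ext_eval (b : Lambda) (p : nat) (w : p.-tuple 'cV[K]_N) : K :=
  \sum_(S : {set 'I_N} | #|S| == p)
     b S * \det (\matrix_(r < p, c < p) [seq tnth w c i 0 | i <- enum S]`_r).

End Exterior.

Arguments theta {K N} j.

Section Admissible.
Variables (R : realType) (N : nat).
Local Notation T := 'cV[R]_N.
Local Notation Lambda := (ext R N).

Definition invariants (G : set 'M[R]_N) : set Lambda :=
  [set b | forall g, G g -> ext_act g b = b].

Definition Z0 (A : set Lambda) : set (glT R N) :=
  [set eta | forall b, A b -> der1 eta b = 0].

Definition polar_functionals (A : set Lambda) (W : {vspace T}) :
    set 'Hom('M[R]_N, R^o) :=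
  [set f | exists p (b : Lambda) (w : p.-tuple T),
    [/\ (0 < p)%N, A b, homogeneous p b, (forall r, tnth w r \in W)
      & forall z, f z = ext_eval (der0 z b) w]].

Definition polar_dim (A : set Lambda) (W : {vspace T}) : nat :=
  dim_set (span_set (polar_functionals A W)).

Definition complete_flag (W : nat -> {vspace T}) : Prop :=
  (forall k, (k < N)%N -> (W k <= W k.+1)%VS /\ W k != W k.+1)
  /\ W N = fullv.

Definition ordinary (A : set Lambda) (W : nat -> {vspace T}) : Prop :=
  complete_flag W /\ (\sum_(k < N) polar_dim A (W k))%N = codim_set (Z0 A).

(* The tangent space at the identity: the initial velocities of differentiable
   curves in G through 1. *)
Definition lie_algebra (G : set 'M[R]_N) : set 'M[R]_N :=
  [set X | exists c : R -> 'M[R]_N,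
    [/\ c 0 = 1%:M, forall t, G (c t), forall t, derivable c t 1
      & 'D_1 c 0 = X]].

Definition orthogonal_subgroup (G : set 'M[R]_N) : Prop :=
  [/\ G 1%:M, forall g h, G g -> G h -> G (g *m h),
      forall g, G g -> G (invmx g) & forall g, G g -> g *m g^T = 1%:M].

Definition gT (G : set 'M[R]_N) : set (glT R N) :=
  [set eta | forall k, lie_algebra G (eta k)].

Definition TS2T : set (glT R N) :=
  [set eta : glT R N | forall i j k, eta k i j = eta j i k].

Definition strongly_admissible (G : set 'M[R]_N) : Prop :=
  [/\ orthogonal_subgroup G, compact G,
      Z0 (invariants G) = [set x + y | x in gT G & y in TS2T]
    & gT G `&` TS2T = [set 0]].

End Admissible.

Section Manifold.
Variables (R : realType) (N : nat).
Local Notation T := 'cV[R]_N.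
Local Notation Lambda := (ext R N).

Definition partial (V : normedModType R) (k : 'I_N) (f : T -> V) : T -> V :=
  fun x => 'D_(theta k.+1) f x.

(* All iterated partial derivatives exist and are differentiable on U. *)
Definition smooth_on (U : set T) (f : T -> R^o) : Prop :=
  forall (s : seq 'I_N) x, U x -> differentiable (foldr (@partial R^o) f s) x.

Definition smooth_mx_on (U : set T) (f : T -> 'M[R]_N) : Prop :=
  forall i j, smooth_on U (fun y => f y i j).

Definition partial_mx (k : 'I_N) (f : T -> 'M[R]_N) (x : T) : 'M[R]_N :=
  \matrix_(i, j) partial (V := R^o) k (fun y => f y i j) x.

Record manifold := Manifold {
  mpoints :> topologicalType;
  chart : Type;
  cdom : chart -> set mpoints;
  cmap : chart -> mpoints -> T;
  cinv : chart -> T -> mpoints;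
  mhausdorff : hausdorff_space mpoints;
  msecond_countable : @second_countable mpoints;
  cdom_open : forall a, open (cdom a);
  cimage_open : forall a, open (cmap a @` cdom a);
  cmapK : forall a x, cdom a x -> cinv a (cmap a x) = x;
  cmap_continuous : forall a x, cdom a x -> {for x, continuous (cmap a)};
  cinv_continuous :
    forall a x, cdom a x -> {for cmap a x, continuous (cinv a)};
  ccover : forall x, exists a, cdom a x;
  ctransition : forall a b i, smooth_on (cmap a @` (cdom a `&` cdom b))
    (fun y => cmap b (cinv a y) i 0)
}.

Definition jacobian_at (M : manifold) (a b : chart M) (y : T) : 'M[R]_N :=
  \matrix_(i, j) partial (V := R^o) j (fun z => cmap b (cinv a z) i 0) y.

(* A reduction of the frame bundle to G. A frame at x, i.e. an isomorphism
   u : T -> T_x M, is given by its matrix with respect to the coordinate basis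
   of a chart; frames a x is only relevant when x is in the domain of a. *)
Record gstructure (G : set 'M[R]_N) (M : manifold) := GStructure {
  frames : chart M -> M -> set 'M[R]_N;
  frames_unit : forall a x u, cdom a x -> frames a x u -> u \in unitmx;
  frames_orbit : forall a x u v, cdom a x -> frames a x u ->
    (frames a x v <-> exists2 g, G g & v = u *m g);
  frames_change : forall a b x u, cdom a x -> cdom b x ->
    (frames a x u <-> frames b x (jacobian_at a b (cmap a x) *m u));
  frames_section : forall a x, cdom a x -> exists U (s : T -> 'M[R]_N),
    [/\ open U, U (cmap a x), U `<=` cmap a @` cdom a, smooth_mx_on U s
      & forall y, U y -> frames a (cinv a y) (s y)]
}.

(* A local section of P in the chart a, over the coordinate open set U. *)
Definition local_section (G : set 'M[R]_N) (M : manifold)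
    (P : gstructure G M) (a : chart M) (U : set T) (s : T -> 'M[R]_N) : Prop :=
  [/\ open U, U `<=` cmap a @` cdom a, smooth_mx_on U s
    & forall y, U y -> frames P a (cinv a y) (s y)].

(* A connection on P is given by the induced covariant derivative on vector
   fields, nabla_k v = d_k v + Gamma_k v in coordinates. The last condition
   says that its connection form along any local section of P takes values in
   the Lie algebra of G. *)
Record connection (G : set 'M[R]_N) (M : manifold) (P : gstructure G M) :=
Connection {
  christoffel : chart M -> T -> 'I_N -> 'M[R]_N;
  christoffel_smooth : forall a k,
    smooth_mx_on (cmap a @` cdom a) (fun y => christoffel a y k);
  christoffel_change : forall a b x k, cdom a x -> cdom b x ->
    let J := jacobian_at a b in let y := cmap a x in
    J y *m christoffel a y k = partial_mx k J y
      + \sum_l J y l k *: (christoffel b (cmap b x) l *m J y);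
  christoffel_lie : forall a U s y k, local_section P a U s -> U y ->
    lie_algebra G (invmx (s y) *m (partial_mx k s y + christoffel a y k *m s y))
}.

(* The torsion at the frame u, as an element of T (x) Lambda^2 T inside
   T (x) T (x) T: the entry (i, j, k) is the i-th component in the frame u of
   Tor(u theta_j, u theta_k), where Tor(d_p, d_q) = nabla_p d_q - nabla_q d_p. *)
Definition torsion (G : set 'M[R]_N) (M : manifold) (P : gstructure G M)
    (nabla : connection P) (a : chart M) (x : M) (u : 'M[R]_N) : glT R N :=
  [ffun k => \matrix_(i, j) \sum_r \sum_p \sum_q
     invmx u i r * (christoffel nabla a (cmap a x) p r q
                    - christoffel nabla a (cmap a x) q r p) * u p j * u q k].

Definition skew (eta : glT R N) : glT R N :=
  [ffun k => \matrix_(i, j) (eta k i j - eta j i k)].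

(* The class of the torsion modulo g (x) T, as a coset. *)
Definition intrinsic_torsion (G : set 'M[R]_N) (M : manifold)
    (P : gstructure G M) (nabla : connection P) (a : chart M) (x : M)
    (u : 'M[R]_N) : set (glT R N) :=
  [set torsion nabla a x u + skew eta | eta in gT G].

(* The differential form on M corresponding to a G-invariant b, in the chart a
   and on the coordinate basis dx_1, ..., dx_N; it does not depend on the
   chosen frame because b is invariant. *)
Definition assoc_form (G : set 'M[R]_N) (M : manifold) (P : gstructure G M)
    (b : Lambda) (a : chart M) (y : T) : Lambda :=
  ext_act (invmx (xget 1%:M (frames P a (cinv a y))))^T b.

Definition ext_diff (w : T -> Lambda) (y : T) : Lambda :=
  \sum_(k < N) wedge (ext_vec (theta k.+1))
    [ffun S => partial (V := R^o) k (fun z => w z S) y].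

(* The value at the frame u of the exterior derivative of the form on M
   corresponding to b, as an element of Lambda^* T. *)
Definition diff_value (G : set 'M[R]_N) (M : manifold) (P : gstructure G M)
    (b : Lambda) (a : chart M) (x : M) (u : 'M[R]_N) : Lambda :=
  ext_act u^T (ext_diff (assoc_form P b a) (cmap a x)).

End Manifold.

Section SpecialUnitary.
Variables (R : realType) (n : nat).
Local Notation N := n.*2.+1.

Definition complex_part (v : 'cV[R]_N) : 'cV[R[i]]_n :=
  \col_k (v (inord k.*2) 0 +i* v (inord k.*2.+1) 0)%C.

Definition SU : set 'M[R]_N :=
  [set g | g *m theta N = theta N /\
    exists U : 'M[R[i]]_n, [/\ U \is unitarymx, \det U = 1
      & forall v : 'cV[R]_N, complex_part (g *m v) = U *m complex_part v
          /\ (g *m v) ord_max 0 = v ord_max 0]].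

Definition alpha_form : ext R N := ext_vec (theta N).

Definition F_form : ext R N :=
  \sum_(1 <= k < n.+1)
     wedge (ext_vec (theta k.*2.-1)) (ext_vec (theta k.*2)).

Definition Omega_form : ext R[i] N :=
  wedges [seq ext_vec (theta k.*2.-1 + 'i%C *: theta k.*2) | k <- iota 1 n].

Definition ReOmega_form : ext R N := [ffun S => complex.Re (Omega_form S)].
Definition ImOmega_form : ext R N := [ffun S => complex.Im (Omega_form S)].

Definition flagE (k : nat) : {vspace 'cV[R]_N} :=
  let E j := span [seq theta i.*2.-1 | i <- iota 1 j] in
  let E' j := (E n + span [seq theta i.*2 | i <- iota 1 j])%VS in
  if (k <= n)%N then E k
  else if (k < n.*2)%N then E' (k - n)%N
  else if k == n.*2 then (E' n.-1 + <[theta N]>)%VS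
  else fullv.

End SpecialUnitary.

(* Main.v *)
From HB Require Import structures.
From mathcomp Require Import all_boot all_order all_algebra.
From mathcomp Require Import perm spectral complex.
From mathcomp Require Import all_classical all_reals all_analysis.
From mathcomp Require Import ring lra zify.
Require Import Defs.

Set Implicit Arguments.
Unset Strict Implicit.
Unset Printing Implicit Defensive.

Import Order.TTheory GRing.Theory Num.Theory.
Import numFieldNormedType.Exports.

Local Open Scope classical_set_scope.
Local Open Scope ring_scope.

(** The proof squeezes Z0 between two spaces of the same dimension. Write N for
    2n + 1 and let A be any set of invariant forms that contains the four forms
    alpha, F, Re Omega and Im Omega.

    - Upper bound. The formula der1E, d_eta = - sum_k theta_k ^ D_(eta_k^T), with
      eta_k the k-th slice of eta, gives Cartan's inequality (cartan_inequality): the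
      dimension of Z0 A is at most the sum over the flag of the dimensions of the
      annihilators of the polar functionals. Such an annihilator consists of the
      matrices z for which certain coefficients of D_z alpha, D_z F and D_z Omega
      vanish. These are explicit linear equations on the entries of z (ann_alpha,
      ann_F, ann_Omega_im, ann_Omega_max, ann_Omega_trace): alpha makes entries of
      the last column zero; F makes z J symmetric, J being the complex structure; Omega
      makes z complex linear on the complex lines contained in the space of the flag,
      and makes its complex trace zero. They determine an explicit set of entries,
      the pivots, from the others (pivot_zero), and along the flag there are
      N (n^2 + n + 1) pivots in total (sum_card_pivot).

    - Lower bound. The space (su(n) (x) T) + (T (x) S^2 T) is contained in Z0 A: the
      first summand because the Lie algebra annihilates invariants, the second because
      theta_k ^ theta_j is alternating (gT_TS2T_Z0). The sum is direct, and
      su(n) has dimension at least n^2 - 1, since it contains the velocities of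
      explicit one-parameter groups (su_map_lie); so the codimension of the sum in
      gl(T) (x) T is at most N (n^2 + n + 1).

    The bounds agree, so all inequalities are equalities (Z0_squeeze). For A the set of
    all invariants this gives both ordinarity of the flag and strong admissibility.
    For A the set of the four forms it shows that they already cut out the same Z0.

    For the intrinsic torsion, let eta be the Christoffel symbols of a connection read
    in a frame u. The covariant derivatives of the forms associated with
    invariants vanish, so the value at u of the exterior derivative of the form
    associated with b is - d_eta b (diff_valueE), and the torsion is minus the
    skew-symmetrization of eta (torsionE). If two structures have the same values of
    d alpha, dF and d Omega, then the difference of the two tensors eta is annihilated
    by the four forms; by the squeeze it lies in (su(n) (x) T) + (T (x) S^2 T), and
    such a difference does not change the class of the torsion. *)

(** * Exterior multiplication on the standard basis *)

Section ExteriorAlgebra.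
Variables (K : comNzRingType) (N : nat).
Local Notation Lambda := (ext K N).
Local Notation ev := (@ext_vec K N).
Implicit Types (a b c : Lambda) (v : 'cV[K]_N) (S A B : {set 'I_N}) (i j : 'I_N).

(** The number of transpositions that move e_i to its place in e_S. *)
Definition below i S : nat := #|[set j in S | (j < i)%N]%SET|.

Definition basis S : Lambda := [ffun T => (T == S)%:R].

Lemma ext_basisE b : b = \sum_S b S *: basis S.
Proof.
apply/ffunP => S; rewrite sum_ffunE (bigD1 S) //= !ffunE eqxx big1 => [|T TS].
  by rewrite addr0 -[_ *: _]/(_ * _) mulr1.
by rewrite !ffunE eq_sym (negbTE TS) scaler0.
Qed.

Lemma ext_vecE v S : ev v S = \sum_(i | S == finset.set1 i) v i 0.
Proof. by rewrite ffunE. Qed.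

Lemma ext_vec1 v i : ev v (finset.set1 i) = v i 0.
Proof.
rewrite ffunE (eq_bigl (eq_op^~ i)) ?big_pred1_eq // => j.
by rewrite eq_sym; apply/eqP/eqP => [/finset.set1_inj|->].
Qed.

Lemma thetaE i j : theta i.+1 j 0 = (j == i)%:R :> K.
Proof. by rewrite mxE eqSS. Qed.

Lemma inversions1 i B : inversions (finset.set1 i) B = below i B.
Proof.
have pI : injective (pair i : 'I_N -> 'I_N * 'I_N) by move=> x y [].
rewrite /inversions /below -(card_imset _ pI).
apply: eq_card => -[x y]; rewrite !inE /=.
apply/idP/imsetP => [/andP[/andP[/eqP -> yB] yi]|[j]].
  by exists y => //; rewrite !inE yB.
by rewrite inE => /andP[jB ji] [-> ->]; rewrite eqxx jB.
Qed.

(** When the left factor has degree one only the singletons contribute to the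
    sum that defines wedge. All computations below go through this formula. *)
Lemma wedge_vecE v b S : wedge (ev v) b S =
  \sum_(i in S) v i 0 * ((-1) ^+ below i S * b (S :\ i)%SET).
Proof.
rewrite ffunE.
under eq_bigr => A AS.
  rewrite ext_vecE mulr_sumr mulr_suml.
  over.
rewrite (exchange_big_dep xpredT) //= [RHS]big_mkcond /=.
apply: eq_bigr => i _; case: (boolP (i \in S)) => iS.
  rewrite (big_pred1 (finset.set1 i)) => [|A]; last first.
    rewrite /= inE; case: (A =P finset.set1 i) => [->|]; last by rewrite andbF.
    by rewrite finset.sub1set iS.
  rewrite inversions1 [_ * v i 0]mulrC -mulrA; congr (_ * ((-1) ^+ _ * _)).
  apply: eq_card => j; rewrite !inE.
  by case: eqVneq => [->|]; rewrite ?ltnn ?andbF.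
by rewrite big1 // => A; rewrite inE => /andP[AS /eqP AE]; move: AS; rewrite AE finset.sub1set (negbTE iS).
Qed.

Lemma wedge_thetaE i b S : wedge (ev (theta i.+1)) b S =
  if i \in S then (-1) ^+ below i S * b (S :\ i)%SET else 0.
Proof.
rewrite wedge_vecE; case: ifP => iS.
  rewrite (bigD1 i) //= thetaE eqxx mul1r big1 ?addr0 // => j /andP[_ ji].
  by rewrite thetaE (negbTE ji) mul0r.
rewrite big1 // => j jS; rewrite thetaE; case: eqP jS => [->|]; rewrite ?mul0r //.
by rewrite iS.
Qed.

Lemma wedge_linl c : linear (fun a => wedge a c : Lambda).
Proof.
move=> k a b; apply/ffunP => S; rewrite !ffunE /= scaler_sumr -big_split.
apply: eq_bigr => A _; rewrite !ffunE /= mulrDr mulrDl; congr (_ + _).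
by rewrite -![k *: _]/(k * _); ring.
Qed.

Lemma wedge_linr a : linear (@wedge K N a).
Proof.
move=> k b c; apply/ffunP => S; rewrite !ffunE scaler_sumr -big_split.
apply: eq_bigr => A _; rewrite !ffunE /= mulrDr; congr (_ + _).
by rewrite -![k *: _]/(k * _); ring.
Qed.

HB.instance Definition _ a :=
  GRing.isLinear.Build K Lambda Lambda _ (@wedge K N a) (wedge_linr a).

Definition wedger b a : Lambda := wedge a b.
HB.instance Definition _ b :=
  GRing.isLinear.Build K Lambda Lambda _ (wedger b) (wedge_linl b).

Lemma ext_vec_lin : linear (@ext_vec K N).
Proof.
move=> k u v; apply/ffunP => S; rewrite !ffunE scaler_sumr -big_split.
by apply: eq_bigr => i _; rewrite !mxE.
Qed.
HB.instance Definition _ :=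
  GRing.isLinear.Build K 'cV[K]_N Lambda _ (@ext_vec K N) ext_vec_lin.

Lemma vec_thetaE v : v = \sum_i v i 0 *: theta i.+1.
Proof.
apply/colP => j; rewrite summxE (bigD1 j) //= mxE thetaE eqxx mulr1.
by rewrite big1 ?addr0 // => i ij; rewrite mxE thetaE eq_sym (negbTE ij) mulr0.
Qed.

Lemma wedge_vec_theta v b :
  wedge (ev v) b = \sum_i v i 0 *: wedge (ev (theta i.+1)) b.
Proof.
rewrite {1}(vec_thetaE v) -[LHS]/(wedger b _) linear_sum linear_sum.
by apply: eq_bigr => i _; rewrite linearZ linearZ.
Qed.

Lemma below_setD1 i j S : j != i -> j \in S ->
  below i S = ((j < i) + below i (S :\ j)%SET)%N.
Proof.
move=> ji jS; rewrite /below.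
case: (ltnP j i) => lji /=.
  rewrite (cardsD1 j) inE jS lji /=; congr (_ + _)%N; apply: eq_card => k.
  by rewrite !inE andbA.
apply: eq_card => k; rewrite !inE; case: eqVneq => //= ->.
by rewrite jS ltnNge lji.
Qed.

Lemma below_setU1 i j S : j \notin S -> below i (j |: S)%SET = ((j < i) + below i S)%N.
Proof.
move=> jS; case: (eqVneq j i) => [<-|ji].
  rewrite ltnn; apply: eq_card => k; rewrite !inE.
  by case: eqVneq => //= ->; rewrite ltnn andbF.
by rewrite (below_setD1 ji) ?finset.setU11 // finset.setU1K.
Qed.

Lemma below_setD1id i S : below i (S :\ i)%SET = below i S.
Proof.
apply: eq_card => j; rewrite !inE.
by case: eqVneq => [->|]; rewrite ?ltnn ?andbF.
Qed.

Lemma wedge_thetaC i j b :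
  wedge (ev (theta i.+1)) (wedge (ev (theta j.+1)) b) =
  - wedge (ev (theta j.+1)) (wedge (ev (theta i.+1)) b).
Proof.
apply/ffunP => S; rewrite [RHS]ffunE !wedge_thetaE !inE [i == j]eq_sym.
case: (eqVneq j i) => [->|ji] /=; first by rewrite ?eqxx /= !mulr0 !if_same oppr0.
case: (boolP (i \in S)) => iS; case: (boolP (j \in S)) => jS; rewrite ?mulr0 ?oppr0 //.
have [ij|ij|/val_inj e] := ltngtP i j; last by rewrite e eqxx in ji.
  rewrite (@below_setD1 j i S) // 1?eq_sym // ij.
  rewrite (@below_setD1 i j S) // ltnNge (ltnW ij) /= add0n.
  by rewrite exprD expr1 finset.setDDl finset.setUC -finset.setDDl; ring.
rewrite (@below_setD1 i j S) // ij.
rewrite (@below_setD1 j i S) // 1?eq_sym // ltnNge (ltnW ij) /= add0n.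
by rewrite exprD expr1 finset.setDDl finset.setUC -finset.setDDl; ring.
Qed.

Lemma wedge_theta_sqr i b :
  wedge (ev (theta i.+1)) (wedge (ev (theta i.+1)) b) = 0.
Proof.
apply/ffunP => S; rewrite [RHS]ffunE !wedge_thetaE !inE eqxx /=.
by rewrite mulr0 if_same.
Qed.

Lemma wedge_vec2 u v b : wedge (ev u) (wedge (ev v) b) =
  \sum_i \sum_j (u i 0 * v j 0) *:
    wedge (ev (theta i.+1)) (wedge (ev (theta j.+1)) b).
Proof.
rewrite (wedge_vec_theta u); apply: eq_bigr => i _.
rewrite (wedge_vec_theta v) linear_sum scaler_sumr.
by apply: eq_bigr => j _; rewrite linearZ /= scalerA.
Qed.

Lemma wedge_vecC u v b :
  wedge (ev u) (wedge (ev v) b) = - wedge (ev v) (wedge (ev u) b).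
Proof.
rewrite (wedge_vec2 u) (wedge_vec2 v) exchange_big -sumrN; apply: eq_bigr => i _.
rewrite -sumrN; apply: eq_bigr => j _.
by rewrite wedge_thetaC scalerN mulrC.
Qed.

(** The cancellation behind v ^ v = 0, and behind the fact that tensors
    symmetric in their last two indices annihilate every form. *)
Lemma sum_alternating (V : zmodType) (f : 'I_N -> 'I_N -> V) :
    (forall i, f i i = 0) -> (forall i j, f i j = - f j i) ->
  \sum_i \sum_j f i j = 0.
Proof.
move=> f0 fC.
have E i : \sum_j f i j = \sum_(j : 'I_N | (j < i)%N) f i j + \sum_(j : 'I_N | (i < j)%N) f i j.
  rewrite (bigID (fun j : 'I_N => (j < i)%N)) /=; congr (_ + _).
  rewrite (bigD1 i) ?ltnn //= f0 add0r; apply: eq_bigl => j.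
  by rewrite -leqNgt ltn_neqAle andbC eq_sym -val_eqE.
rewrite (eq_bigr _ (fun i _ => E i)) big_split /=.
rewrite [X in _ + X](exchange_big_dep xpredT) //= -big_split big1 //= => i _.
rewrite -big_split big1 //= => j _; first by rewrite fC addNr.
Qed.

Lemma wedge_vec_sqr v b : wedge (ev v) (wedge (ev v) b) = 0.
Proof.
rewrite wedge_vec2; apply: sum_alternating => [i|i j].
  by rewrite wedge_theta_sqr scaler0.
by rewrite wedge_thetaC scalerN mulrC.
Qed.

Definition ltI i j := (i < j)%N.

Lemma ltI_trans : transitive ltI.
Proof. by move=> i j k; apply: ltn_trans. Qed.

Lemma ltI_irr : irreflexive ltI.
Proof. by move=> i; rewrite /ltI ltnn. Qed.

Lemma enum_pairwise S : pairwise ltI (enum S).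
Proof.
rewrite -(sorted_pairwise ltI_trans) /enum_mem sorted_filter //; first exact: ltI_trans.
by have := iota_ltn_sorted 0 N; rewrite -val_enum_ord sorted_map enumT.
Qed.

Lemma pairwise_enum (s : seq 'I_N) S :
  pairwise ltI s -> s =i S -> s = enum S.
Proof.
move=> ps sS; apply: (irr_sorted_eq ltI_trans ltI_irr).
- by rewrite (sorted_pairwise ltI_trans).
- by rewrite (sorted_pairwise ltI_trans) enum_pairwise.
- by move=> i; rewrite sS mem_enum.
Qed.

(** An index i enters or leaves the increasing enumeration of S at position
    below i S. This matches the order in which ext_lift multiplies with the
    signs of wedge. *)
Lemma enum_split i S : let s1 := [seq j : 'I_N <- enum S | (j < i)%N] in
  let s2 := [seq j : 'I_N <- enum S | (i < j)%N] in
  [/\ size s1 = below i S, enum (S :\ i)%SET = s1 ++ s2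
    & enum (i |: S)%SET = s1 ++ i :: s2].
Proof.
move=> s1 s2.
have mf (p : pred 'I_N) x : (x \in [seq j : 'I_N <- enum S | p j]) = p x && (x \in S).
  by rewrite mem_filter mem_enum.
have p1 : pairwise ltI s1 by rewrite pairwise_filter // enum_pairwise.
have p2 : pairwise ltI s2 by rewrite pairwise_filter // enum_pairwise.
have lt1 x : x \in s1 -> ltI x i by rewrite mf => /andP[].
have lt2 x : x \in s2 -> ltI i x by rewrite mf => /andP[].
have p12 : allrel ltI s1 s2.
  by apply/allrelP => x y /lt1 xi /lt2; apply: ltI_trans xi.
have m12 x : (x \in s1 ++ s2) = (x != i) && (x \in S).
  by rewrite mem_cat !mf -andb_orl -neq_ltn.
split.
- have /card_uniqP <- : uniq s1 by rewrite filter_uniq // enum_uniq.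
  by apply: eq_card => x; rewrite mf !inE andbC.
- apply/esym/pairwise_enum; first by rewrite pairwise_cat p12 p1 p2.
  by move=> x; rewrite m12 !inE.
- apply/esym/pairwise_enum => [|x].
    rewrite pairwise_cat /= p1 p2 allrel_consr p12 !andbT /=.
    by apply/andP; split; apply/allP => x; [apply: lt1|apply: lt2].
  rewrite mem_cat !inE; have := m12 x; rewrite mem_cat.
  by case: eqVneq => [->|_]; rewrite ?orbT //= => ->.
Qed.

Lemma wedge_theta_basis i A : wedge (ev (theta i.+1)) (basis A) =
  if i \in A then 0 else (-1) ^+ below i A *: basis (i |: A)%SET.
Proof.
apply/ffunP => S; rewrite wedge_thetaE ffunE; case: (boolP (i \in A)) => iA; rewrite !ffunE.
  case: ifP => // iS; case: eqP iA => [<-|]; rewrite ?mulr0 //.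
  by rewrite !inE eqxx.
case: (boolP (i \in S)) => iS.
  case: (eqVneq (S :\ i)%SET A) => [<-|/eqP SA].
    by rewrite finset.setD1K // eqxx below_setD1id.
  case: eqP => [SE|]; rewrite ?scaler0 ?mulr0 //.
  by case: SA; rewrite SE finset.setU1K.
by case: eqP iS => [->|]; rewrite ?finset.setU11 // scaler0.
Qed.

(** Anticommuting operators T_i with zero squares make V a module over the
    exterior algebra, by its universal property; [lift_ext Phi] is then the
    module map that sends 1 to v0. The endomorphisms ext_act g and the
    derivations der0 z are both obtained in this way. *)
Section Lift.
Variables (V : lmodType K) (T : 'I_N -> {linear V -> V}) (v0 : V).
Hypothesis TC : forall i j x, T i (T j x) = - T j (T i x).
Hypothesis T2 : forall i x, T i (T i x) = 0.

Let Phi := foldr (fun i => T i) v0.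
Definition lift_ext (f : seq 'I_N -> V) b : V := \sum_S b S *: f (enum S).

Lemma lift_basis (f : seq 'I_N -> V) S : lift_ext f (basis S) = f (enum S).
Proof.
rewrite /lift_ext (bigD1 S) //= ffunE eqxx scale1r big1 ?addr0 // => A AS.
by rewrite ffunE (negbTE AS) scale0r.
Qed.

Lemma lift_lin (f : seq 'I_N -> V) : linear (lift_ext f).
Proof.
move=> k a b; rewrite /lift_ext scaler_sumr -big_split; apply: eq_bigr => S _.
by rewrite !ffunE scalerDl scalerA.
Qed.
HB.instance Definition _ f := GRing.isLinear.Build K Lambda V _ (lift_ext f) (lift_lin f).

Let move_in i s x :
  T i (foldr (fun i => T i) x s) = (-1) ^+ size s *: foldr (fun i => T i) (T i x) s.
Proof.
elim: s => [|j s IH] /=; first by rewrite scale1r.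
by rewrite TC IH linearZ /= exprS -scalerA scaleN1r.
Qed.

Let foldr0 s : foldr (fun i => T i) 0 s = 0.
Proof. by elim: s => //= i s ->; rewrite linear0. Qed.

Lemma lift_theta i b : lift_ext Phi (wedge (ev (theta i.+1)) b) = T i (lift_ext Phi b).
Proof.
rewrite {2}/lift_ext [b in LHS]ext_basisE !linear_sum.
apply: eq_bigr => S _; rewrite !linearZ /=; congr (_ *: _).
have [s1b eD eU] := enum_split i S.
rewrite wedge_theta_basis; case: (boolP (i \in S)) => iS.
  have <- : (i |: S)%SET = S by apply/finset.setUidPr; rewrite finset.sub1set.
  by rewrite linear0 eU /Phi foldr_cat move_in /= T2 foldr0 scaler0.
rewrite linearZ /= lift_basis eU.
have SD : (S :\ i)%SET = S by apply/finset.setDidPl; rewrite disjoint_sym disjoints1.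
move: eD; rewrite SD => eS.
by rewrite [in RHS]eS /Phi !foldr_cat move_in s1b.
Qed.

End Lift.

End ExteriorAlgebra.

(** * Endomorphisms, derivations and contractions *)

Section Derivations.
Variables (K : comNzRingType) (N : nat).
Local Notation Lambda := (ext K N).
Local Notation ev := (@ext_vec K N).
Implicit Types (a b c : Lambda) (v : 'cV[K]_N) (S A B : {set 'I_N}) (i j : 'I_N).

Lemma ext1E : @ext1 K N = basis K finset.set0.
Proof. by apply/ffunP => S; rewrite !ffunE. Qed.

Lemma lift_ext1 (V : lmodType K) (f : seq 'I_N -> V) : lift_ext f (@ext1 K N) = f [::].
Proof. by rewrite ext1E lift_basis enum_set0. Qed.

Definition wtheta (s : seq 'I_N) : Lambda :=
  wedges [seq ev (theta j.+1) | j : 'I_N <- s].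

(** Splitting off the least element of S costs no sign. *)
Lemma wtheta_enum S : wtheta (enum S) = basis K S.
Proof.
have [k le_k] := ubnP #|S|; elim: k => // k IH in S le_k *.
have [->|[i iS]] := set_0Vmem S; first by rewrite enum_set0 -ext1E.
have : exists2 m : 'I_N, m \in S & forall j, j \in S -> (m <= j)%N.
  by case: (arg_minnP (P := [pred j in S]) (fun j : 'I_N => j : nat) iS) => m mS mm; exists m.
case=> m mS mmin.
have [b0 eD eU] := enum_split m S.
have below0 : below m S = 0%N.
  apply/eqP; rewrite cards_eq0; apply/eqP/finset.setP => j; rewrite !inE.
  by apply/negP => /andP[/mmin]; rewrite leqNgt => /negP.
have SU : (m |: S)%SET = S by apply/finset.setUidPr; rewrite finset.sub1set.
move: eU eD; rewrite SU (size0nil (etrans b0 below0)) /=.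
move: [seq _ <- _ | _] => s2 -> <-.
rewrite /wtheta /= -/(wtheta _) IH; last by rewrite (cardsD1 m) mS in le_k.
apply/ffunP => A; rewrite wedge_thetaE !ffunE.
case: (eqVneq A S) => [->|AS]; first by rewrite mS below0 eqxx mul1r.
case: ifP => // mA; case: eqP => [AE|]; rewrite ?mulr0 //.
by case/eqP: AS; rewrite -(finset.setD1K mA) AE finset.setD1K.
Qed.

(** Every form is reached from 1 by linear combinations and left multiplication
    by basis covectors; the rules below are proved along this generation. *)
Lemma ext_ind (P : Lambda -> Prop) :
  (forall k a b, P a -> P b -> P (k *: a + b)) -> P (ext1 K N) ->
  (forall i b, P b -> P (wedge (ev (theta i.+1)) b)) -> forall b, P b.
Proof.
move=> Plin P1 Pw b.
have P0 : P 0 by rewrite -(addNr (ext1 K N)) -scaleN1r; exact: Plin.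
rewrite (ext_basisE b); elim/big_rec: _ => // S x _ Px; apply: Plin => //.
rewrite -wtheta_enum; elim: (enum S) => //= i s; exact: Pw.
Qed.

Lemma ext_ind_vec (P : Lambda -> Prop) :
  (forall k a b, P a -> P b -> P (k *: a + b)) -> P (ext1 K N) ->
  (forall v b, P b -> P (wedge (ev v) b)) -> forall b, P b.
Proof. by move=> Plin P1 Pw; apply: ext_ind => // i b; apply: Pw. Qed.

Lemma lift_vec (V : lmodType K) (T : 'I_N -> {linear V -> V}) (f : seq 'I_N -> V) v b :
  (forall i b, lift_ext f (wedge (ev (theta i.+1)) b) = T i (lift_ext f b)) ->
  lift_ext f (wedge (ev v) b) = \sum_i v i 0 *: T i (lift_ext f b).
Proof.
move=> fT; rewrite (wedge_vec_theta v) linear_sum; apply: eq_bigr => i _.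
by rewrite linearZ /= fT.
Qed.

Lemma ext_actE h b : ext_act h b =
  lift_ext (foldr (fun i => wedge (ev (col i h))) (ext1 K N)) b.
Proof.
by rewrite /ext_act /ext_lift /lift_ext; apply: eq_bigr => S _; rewrite /wedges foldr_map.
Qed.

Lemma ext_act_lin h : linear (@ext_act K N h).
Proof. by move=> k a b; rewrite !ext_actE linearP. Qed.
HB.instance Definition _ h :=
  GRing.isLinear.Build K Lambda Lambda _ (@ext_act K N h) (ext_act_lin h).

Lemma ext_act_ext1 h : ext_act h (ext1 K N) = ext1 K N.
Proof. by rewrite ext_actE lift_ext1. Qed.

Lemma mulmx_col (h : 'M[K]_N) v : h *m v = \sum_i v i 0 *: col i h.
Proof.
apply/colP => k; rewrite mxE summxE; apply: eq_bigr => i _.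
by rewrite !mxE mulrC.
Qed.

Lemma mulmx_theta (h : 'M[K]_N) i : h *m theta i.+1 = col i h.
Proof.
rewrite mulmx_col (bigD1 i) //= thetaE eqxx scale1r big1 ?addr0 // => j ji.
by rewrite thetaE (negbTE ji) scale0r.
Qed.

(** The operators v |-> (g v) ^ _ satisfy the relations of lift_theta. *)
Lemma ext_act_wedge h v b :
  ext_act h (wedge (ev v) b) = wedge (ev (h *m v)) (ext_act h b).
Proof.
rewrite !ext_actE mulmx_col.
rewrite (@lift_vec _ (fun i => wedge (ev (col i h)))) => [|i c].
  rewrite -[RHS]/(wedger _ _) !linear_sum; apply: eq_bigr => i _.
  by rewrite !linearZ.
rewrite (@lift_theta _ _ _ (fun i => wedge (ev (col i h)))) //= => *.
  exact: wedge_vecC.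
exact: wedge_vec_sqr.
Qed.

Lemma ext_act1 b : ext_act 1%:M b = b.
Proof.
elim/ext_ind_vec: b => [k a b ha hb||v b hb]; first by rewrite linearP /= ha hb.
  exact: ext_act_ext1.
by rewrite ext_act_wedge mul1mx hb.
Qed.

Lemma ext_actM g h b : ext_act (g *m h) b = ext_act g (ext_act h b).
Proof.
elim/ext_ind_vec: b => [k a b ha hb||v b hb]; first by rewrite !linearP /= ha hb.
  by rewrite !ext_act_ext1.
by rewrite !ext_act_wedge mulmxA hb.
Qed.

Lemma inversionsE A B : inversions A B = \sum_(i in A) below i B.
Proof.
rewrite /inversions -sum1dep_card.
rewrite (eq_bigl (fun p : 'I_N * 'I_N => (p.1 \in A) && ((p.2 \in B) && (p.2 < p.1)%N))).
  rewrite -(pair_big_dep (mem A) (fun i j : 'I_N => (j \in B) && (j < i)%N) (fun _ _ => 1%N)) /=.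
  by apply: eq_bigr => i _; rewrite /below sum1dep_card.
by move=> p; rewrite andbA.
Qed.

Lemma wedge_basisE A c S : wedge (basis K A) c S =
  if A \subset S then (-1) ^+ inversions A (S :\: A)%SET * c (S :\: A)%SET else 0.
Proof.
rewrite ffunE; case: ifP => AS.
  rewrite (bigD1 A) ?powersetE //= ffunE eqxx mulr1 big1 ?addr0 // => X /andP[_ XA].
  by rewrite ffunE (negbTE XA) mulr0 mul0r.
rewrite big1 // => X; rewrite powersetE ffunE; case: eqP => [->|]; rewrite ?AS //.
by rewrite mulr0 mul0r.
Qed.

(** On basis elements this is the additivity of the number of inversions. *)
Lemma wedge_thetaA i b c :
  wedge (wedge (ev (theta i.+1)) b) c = wedge (ev (theta i.+1)) (wedge b c).
Proof.
rewrite (ext_basisE b) linear_sum -[LHS]/(wedger c _) -[in RHS]/(wedger c _) !linear_sum.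
apply: eq_bigr => A _; rewrite !linearZ /= /wedger; congr (_ *: _).
rewrite wedge_theta_basis; apply/ffunP => S; rewrite wedge_thetaE !wedge_basisE.
case: ifP => iA.
  rewrite -/(wedger c 0) linear0 ffunE.
  by rewrite finset.subsetD1 iA andbF mulr0 if_same.
rewrite -/(wedger c _) linearZ /= /wedger ffunE wedge_basisE finset.subsetD1 iA andbT.
rewrite finset.subUset finset.sub1set.
case: (boolP (i \in S)) => iS /=; last by rewrite scaler0.
case: ifP => AS; rewrite ?scaler0 ?mulr0 // -[_ *: _]/(_ * _) !mulrA -!exprD.
have -> : ((S :\ i) :\: A = S :\: (i |: A))%SET by rewrite finset.setDDl.
congr (_ * _); rewrite !inversionsE (big_setU1 i) ?iA //= addnA.
set X := (S :\: _)%SET; rewrite exprD [in RHS]exprD; congr (_ * _).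
have -> : below i S = (below i A + below i X)%N.
  rewrite /below -cardsUI [X in (_ + X)%N](_ : _ = 0%N) ?addn0.
    apply: eq_card => j; rewrite /X !inE.
    case: (eqVneq j i) => [->|ji] /=; first by rewrite ltnn !andbF.
    by case: (boolP (j \in A)) => [/(fintype.subsetP AS) ->|] /=; rewrite ?orbF.
  apply/eqP; rewrite cards_eq0; apply/eqP/finset.setP => j; rewrite !inE.
  by case: (j \in A); rewrite ?orbT ?andbF.
by [].
Qed.

Lemma wedge_vecA v b c :
  wedge (wedge (ev v) b) c = wedge (ev v) (wedge b c).
Proof.
rewrite (wedge_vec_theta v b) (wedge_vec_theta v (wedge b c)).
rewrite -[LHS]/(wedger c _) linear_sum; apply: eq_bigr => i _.
by rewrite linearZ /= /wedger wedge_thetaA.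
Qed.

(** A derivation is not a module map, but b |-> (b, D_z b) is one, for the
    operators (x, y) |-> (e_i ^ x, (z e_i) ^ x + e_i ^ y). *)
Definition dpair (z : 'M[K]_N) i (x : Lambda * Lambda) : Lambda * Lambda :=
  (wedge (ev (theta i.+1)) x.1,
   wedge (ev (z *m theta i.+1)) x.1 + wedge (ev (theta i.+1)) x.2).

Lemma dpair_lin z i : linear (dpair z i).
Proof.
move=> k [a1 a2] [b1 b2]; rewrite /dpair /= !linearP /=; congr (_, _) => /=.
by rewrite scalerDr !addrA; congr (_ + _); rewrite -!addrA; congr (_ + _); rewrite addrC.
Qed.
HB.instance Definition _ z i :=
  GRing.isLinear.Build K (Lambda * Lambda)%type (Lambda * Lambda)%type _ (dpair z i) (dpair_lin z i).

Lemma dpairC z i j x : dpair z i (dpair z j x) = - dpair z j (dpair z i x).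
Proof.
case: x => x y; rewrite /dpair /=; congr (_, _); first exact: wedge_vecC.
rewrite !linearD /= ?opprD (wedge_vecC (z *m theta i.+1) (theta j.+1)).
by rewrite (wedge_vecC (theta i.+1) (z *m _)) (wedge_vecC (theta i.+1) (theta _)) addrCA.
Qed.

Lemma dpair_sqr z i x : dpair z i (dpair z i x) = 0.
Proof.
case: x => x y; rewrite /dpair /=; congr (_, _); first exact: wedge_vec_sqr.
by rewrite linearD /= wedge_vec_sqr addr0 wedge_vecC addNr.
Qed.

Lemma lift_dpair z b :
  lift_ext (foldr (fun i => dpair z i) (ext1 K N, 0)) b = (b, der0 z b).
Proof.
have E s : foldr (fun i => dpair z i) (ext1 K N, 0) s =
    (wtheta s, leibniz 1 (fun i => ev (z *m theta i.+1)) s).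
  by elim: s => //= i s ->; rewrite /dpair /= scale1r.
rewrite [LHS]surjective_pairing /lift_ext; congr (_, _).
  rewrite [RHS](ext_basisE b) (raddf_sum fst); apply: eq_bigr => S _.
  by rewrite E wtheta_enum.
by rewrite (raddf_sum snd); apply: eq_bigr => S _; rewrite E.
Qed.

Lemma der0_lin (z : 'M[K]_N) : linear (@der0 K N z).
Proof.
by move=> k a b; have /= := linearP (lift_ext (foldr (fun i => dpair z i) (ext1 K N, 0))) k a b;
  rewrite !lift_dpair => -[].
Qed.
HB.instance Definition _ z :=
  GRing.isLinear.Build K Lambda Lambda _ (@der0 K N z) (der0_lin z).

Lemma der0_ext1 (z : 'M[K]_N) : der0 z (ext1 K N) = 0.
Proof.
have := lift_ext1 (foldr (fun i => dpair z i) (ext1 K N, 0)).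
by rewrite lift_dpair => -[].
Qed.

Lemma der0_wedge (z : 'M[K]_N) v b : der0 z (wedge (ev v) b) =
  wedge (ev (z *m v)) b + wedge (ev v) (der0 z b).
Proof.
rewrite {1}(wedge_vec_theta v) linear_sum /= (wedge_vec_theta v) mulmx_col.
rewrite linear_sum -[X in X + _]/(wedger b _) linear_sum -big_split; apply: eq_bigr => i _.
rewrite !linearZ /= -scalerDr /wedger; congr (_ *: _).
have := lift_theta (T := dpair z) (ext1 K N, 0) (dpairC z) (dpair_sqr z) i b.
by rewrite !lift_dpair => -[->]; rewrite mulmx_theta.
Qed.

Lemma wedge_ext1 v : wedge (ev v) (ext1 K N) = ev v.
Proof.
rewrite (wedge_vec_theta v) [in RHS](vec_thetaE v) linear_sum.
apply: eq_bigr => i _; rewrite linearZ /=; congr (_ *: _).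
rewrite ext1E wedge_theta_basis finset.in_set0 finset.setU0.
have -> : below i finset.set0 = 0%N.
  by apply/eqP; rewrite cards_eq0; apply/eqP/finset.setP => j; rewrite !inE.
rewrite scale1r; apply/ffunP => S; rewrite !ffunE big_mkcond (bigD1 i) //= big1 ?addr0.
  by rewrite thetaE eqxx; case: eqP.
by move=> j ji; rewrite thetaE (negbTE ji) if_same.
Qed.

Lemma der0_vec (z : 'M[K]_N) v : der0 z (ev v) = ev (z *m v).
Proof. by rewrite -wedge_ext1 der0_wedge der0_ext1 linear0 addr0 wedge_ext1. Qed.

Lemma der0_linz k (z z' : 'M[K]_N) b :
  der0 (k *: z + z') b = k *: der0 z b + der0 z' b.
Proof.
elim/ext_ind_vec: b => [c a b ha hb||v b hb].
- by rewrite !linearP /= ha hb !scalerDr !scalerA [c * k]mulrC -!addrA; congr (_ + _); rewrite addrCA.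
- by rewrite !der0_ext1 scaler0 addr0.
rewrite !der0_wedge hb mulmxDl -scalemxAl !linearP /= -[X in X + _ = _]/(wedger b _) linearP /= /wedger.
by rewrite scalerDr -!addrA; congr (_ + _); rewrite addrCA.
Qed.

(** The derivation with its two arguments exchanged, so that its linearity in
    the matrix is a canonical instance. *)
Definition der0_at b (z : 'M[K]_N) := der0 z b.
Lemma der0_at_lin b : linear (der0_at b).
Proof. by move=> k y z; exact: der0_linz. Qed.
HB.instance Definition _ b := GRing.isLinear.Build K _ _ _ (der0_at b) (der0_at_lin b).

Lemma der00 b : der0 0 b = 0.
Proof. exact: (linear0 (der0_at b)). Qed.

Lemma der0N z b : der0 (- z) b = - der0 z b.
Proof. exact: (linearN (der0_at b)). Qed.

Lemma leibniz_der1 (eta : glT K N) (s : seq 'I_N) :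
  leibniz (-1) (fun i => - \sum_(j < N) \sum_(k < N)
    (eta k i j *: wedge (ev (theta k.+1)) (ev (theta j.+1)))) s =
  - \sum_(k < N) wedge (ev (theta k.+1))
      (leibniz 1 (fun i => ev ((eta k)^T *m theta i.+1)) s).
Proof.
elim: s => [|i s IH] /=; first by rewrite big1 ?oppr0 // => k _; rewrite linear0.
rewrite IH linearN /= scaleN1r opprK (linear_sum (wedge (ev (theta i.+1)))) /=.
set W := wedges _.
have -> : \sum_(j < N) \sum_(k < N) eta k i j *: wedge (ev (theta k.+1)) (ev (theta j.+1)) =
    \sum_(k < N) wedge (ev (theta k.+1)) (ev ((eta k)^T *m theta i.+1)).
  rewrite exchange_big; apply: eq_bigr => k _.
  rewrite [_ *m _]vec_thetaE !linear_sum; apply: eq_bigr => j _.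
  by rewrite !linearZ /= mulmx_theta !mxE.
rewrite -[wedge (- _) W]/(wedger W _) linearN (linear_sum (wedger W)) -sumrN -big_split /= -sumrN.
apply: eq_bigr => k _.
by rewrite /wedger wedge_vecA scale1r linearD opprD; congr (_ + _); exact: wedge_vecC.
Qed.

(** Both sides are derivations of degree one with the same value on theta_i.
    Through this formula every statement about d_eta becomes one about the
    derivations D_z, with z the transposed slices of eta. *)
Lemma der1E (eta : glT K N) b : der1 eta b =
  - \sum_(k < N) wedge (ev (theta k.+1)) (der0 (eta k)^T b).
Proof.
rewrite /der1 /ext_lift.
under eq_bigr do rewrite leibniz_der1 scalerN.
rewrite sumrN; congr (- _); under eq_bigr do rewrite scaler_sumr.
rewrite exchange_big; apply: eq_bigr => k _; rewrite linear_sum.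
by apply: eq_bigr => S _; rewrite linearZ.
Qed.

Lemma der1_lin b k (eta eta' : glT K N) :
  der1 (k *: eta + eta') b = k *: der1 eta b + der1 eta' b.
Proof.
rewrite !der1E scalerN -opprD scaler_sumr -big_split; congr (- _).
apply: eq_bigr => i _; rewrite !ffunE.
have -> : (k *: eta i + eta' i)^T = k *: (eta i)^T + (eta' i)^T.
  by apply/matrixP => p q; rewrite !mxE.
by rewrite der0_linz linearP.
Qed.

(** The contraction of b with the i-th basis vector. *)
Definition contr i b : Lambda :=
  [ffun S : {set 'I_N} => if i \in S then 0 else (-1) ^+ below i S * b (i |: S)%SET].

Lemma contr_lin i : linear (contr i).
Proof.
move=> k a b; apply/ffunP => S; rewrite !ffunE; case: ifP => _; first by rewrite scaler0 addr0.
by rewrite mulrDr -![_ *: _]/(_ * _) mulrCA.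
Qed.
HB.instance Definition _ i := GRing.isLinear.Build K Lambda Lambda _ (contr i) (contr_lin i).

Lemma contrE i b S :
  contr i b S = if i \in S then 0 else (-1) ^+ below i S * b (i |: S)%SET.
Proof. by rewrite ffunE. Qed.

Lemma addE a b S : (a + b) S = a S + b S. Proof. by rewrite ffunE. Qed.

Lemma subE a b S : (a - b) S = a S - b S. Proof. by rewrite !ffunE. Qed.

Lemma scaleE k a S : (k *: a) S = k * a S. Proof. by rewrite ffunE. Qed.

Lemma contr_theta i j b : contr i (wedge (ev (theta j.+1)) b) =
  (i == j)%:R *: b - wedge (ev (theta j.+1)) (contr i b).
Proof.
apply/ffunP => S; rewrite subE scaleE contrE !wedge_thetaE !contrE !inE.
rewrite [j == i]eq_sym; case: (eqVneq i j) => [<-{j}|ij] /=.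
  case: (boolP (i \in S)) => iS.
    rewrite below_setD1id mulrA -exprD addnn -signr_odd odd_double expr0 !mul1r.
    by rewrite finset.setD1K // subrr.
  by rewrite finset.setU1K // below_setU1 // ltnn mulrA -exprD addnn -signr_odd odd_double expr0 !mul1r subr0.
case: (boolP (i \in S)) => iS /=; first by rewrite ?mul0r ?mulr0 ?if_same ?subr0.
case: (boolP (j \in S)) => jS; rewrite ?mul0r ?mulr0 ?subr0 ?add0r //.
have -> : ((i |: S) :\ j = i |: S :\ j)%SET.
  apply/finset.setP => x; rewrite !inE; case: (eqVneq x j) => [->|_] //=.
  by rewrite eq_sym (negbTE ij).
rewrite below_setU1 // (@below_setD1 _ i j S) // 1?eq_sym //.
have [lt|lt|/val_inj e] := ltngtP i j; last by rewrite e eqxx in ij.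
  by rewrite /= ?add0n ?add1n ?exprS; ring.
by rewrite /= ?add0n ?add1n ?exprS; ring.
Qed.

Lemma contr_wedge i v b : contr i (wedge (ev v) b) =
  v i 0 *: b - wedge (ev v) (contr i b).
Proof.
rewrite (wedge_vec_theta v) (wedge_vec_theta v (contr i b)) linear_sum -sumrN /=.
rewrite (eq_bigr (fun j => v j 0 *: ((i == j)%:R *: b) +
   - (v j 0 *: wedge (ev (theta j.+1)) (contr i b)))) => [|j _]; last first.
  by rewrite linearZ /= contr_theta scalerBr.
rewrite big_split; congr (_ + _); rewrite (bigD1 i) //= eqxx scale1r big1 ?addr0 // => j ji.
by rewrite eq_sym (negbTE ji) scale0r scaler0.
Qed.

Lemma contr_ext1 i : contr i (ext1 K N) = 0.
Proof.
apply/ffunP => S; rewrite !ffunE; case: ifP => // _; case: eqP; rewrite ?mulr0 //.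
by move/finset.setP/(_ i); rewrite !inE eqxx.
Qed.

(** Coefficients are read off by contraction, and D_z commutes with contraction
    up to the action of z on the contracting vector; so the coefficients of D_z b
    need only those of the contractions of b. *)
Lemma contr_der0 (z : 'M[K]_N) j b : contr j (der0 z b) =
  der0 z (contr j b) + \sum_i z j i *: contr i b.
Proof.
elim/ext_ind_vec: b => [k a b ha hb||v b hb].
- rewrite !linearP /= ha hb scalerDr -!addrA; congr (_ + _).
  rewrite addrCA; congr (_ + _); rewrite scaler_sumr -big_split.
  by apply: eq_bigr => i _; rewrite linearP /= scalerDr !scalerA mulrC.
- rewrite !contr_ext1 der0_ext1 !linear0 big1 ?addr0 // => i _.
  by rewrite contr_ext1 scaler0.
rewrite der0_wedge linearD /= !contr_wedge hb linearB linearZ /= der0_wedge.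
have -> : \sum_i z j i *: contr i (wedge (ev v) b) =
    (z *m v) j 0 *: b - wedge (ev v) (\sum_i z j i *: contr i b).
  rewrite mxE scaler_suml linear_sum -sumrB; apply: eq_bigr => i _.
  by rewrite contr_wedge linearZ /= scalerBr scalerA.
rewrite linearD /= !opprD !addrA; congr (_ + _).
by rewrite [RHS]addrC -!addrA; congr (_ + _); rewrite addrCA.
Qed.

Lemma homogeneous_wedge p v b : homogeneous p b -> homogeneous p.+1 (wedge (ev v) b).
Proof.
move=> hb S; rewrite wedge_vecE; apply: contraTeq => Sp; rewrite negbK big1 // => i iS.
case: (eqVneq (b (S :\ i)%SET) 0) => [->|/hb b0]; first by rewrite !mulr0.
by move: Sp; rewrite (cardsD1 i) iS b0 add1n eqxx.
Qed.

Lemma homogeneous_ext1 : homogeneous 0 (ext1 K N).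
Proof. by move=> S; rewrite ffunE; case: (S =P _) => [->|_]; rewrite ?cards0 ?eqxx. Qed.

Lemma homogeneous_wedges (vs : seq 'cV[K]_N) : homogeneous (size vs) (wedges (map ev vs)).
Proof. by elim: vs => [|v vs IH]; [exact: homogeneous_ext1|apply: homogeneous_wedge]. Qed.

Lemma below_index i S : i \in S -> below i S = index i (enum S).
Proof.
move=> iS; have [<- _] := enum_split i S.
have -> : (i |: S)%SET = S by apply/finset.setUidPr; rewrite finset.sub1set.
set s1 := [seq _ <- _ | _]; set s2 := [seq _ <- _ | _] => eS.
by rewrite [in RHS]eS index_cat {1}/s1 mem_filter ltnn /= eqxx addn0.
Qed.

Lemma below_nth i0 (c : nat) S : (c < #|S|)%N -> below (nth i0 (enum S) c) S = c.
Proof.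
move=> cS; rewrite below_index; first by rewrite index_uniq ?enum_uniq // -cardE.
by rewrite -mem_enum mem_nth // -cardE.
Qed.

Lemma nth_enumD1 i0 i S k : i \in S ->
  nth i0 (enum (S :\ i)%SET) k = nth i0 (enum S) (bump (below i S) k).
Proof.
move=> iS; have [<- ->] := enum_split i S.
have -> : (i |: S)%SET = S by apply/finset.setUidPr; rewrite finset.sub1set.
set s1 := [seq _ <- _ | _]; set s2 := [seq _ <- _ | _] => eS.
rewrite [in RHS]eS !nth_cat /bump; case: (ltnP k (size s1)) => ks.
  by rewrite add0n ks.
by rewrite add1n ltnNge (leq_trans ks) //= subSn.
Qed.

(** By induction, wedge_vecE being the Laplace expansion along the first row. *)
Lemma wedges_det i0 n (vs : 'I_n -> 'cV[K]_N) S : #|S| = n ->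
  wedges [seq ev (vs k) | k : 'I_n <- enum 'I_n] S =
  \det (\matrix_(r < n, c < n) vs r (nth i0 (enum S) c) 0).
Proof.
elim: n vs S => [|n IH] vs S Sn.
  rewrite det_mx00 enum_ord0 /= ffunE.
  by have -> : S = finset.set0; [apply/eqP; rewrite -cards_eq0 Sn|rewrite eqxx].
rewrite enum_ordSl /= -map_comp wedge_vecE (expand_det_row _ ord0).
rewrite -big_enum (big_nth i0) -cardE big_mkord Sn; apply: eq_bigr => c _.
rewrite mxE; congr (_ * _); rewrite /cofactor add0n.
have cS : (c < #|S|)%N by rewrite Sn.
set i := nth _ _ _.
have iS : i \in S by rewrite -mem_enum mem_nth // -cardE.
rewrite (below_nth i0 cS); congr (_ * _).
rewrite (IH (fun k => vs (lift ord0 k))); last by move: Sn; rewrite (cardsD1 i) iS => -[].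
congr (\det _); apply/matrixP => r k; rewrite !mxE (nth_enumD1 _ _ iS) (below_nth i0 cS).
by [].
Qed.

End Derivations.

(** * Change of scalars *)

Section ChangeOfScalars.
Variables (K L : comNzRingType) (f : {rmorphism K -> L}) (N : nat).
Implicit Types (a b : ext K N) (v : 'cV[K]_N).

(** Omega is a complex form. Its real and imaginary parts are studied together
    after extending the scalars of real forms and real derivations. *)
Definition ext_map b : ext L N := [ffun S => f (b S)].

Lemma ext_mapE b S : ext_map b S = f (b S).
Proof. by rewrite ffunE. Qed.

Lemma ext_mapP k a b : ext_map (k *: a + b) = f k *: ext_map a + ext_map b.
Proof. by apply/ffunP => S; rewrite !ffunE rmorphD rmorphM. Qed.

Lemma ext_map_sum (J : Type) (s : seq J) (P : pred J) (F : J -> ext K N) :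
  ext_map (\sum_(j <- s | P j) F j) = \sum_(j <- s | P j) ext_map (F j).
Proof.
apply/ffunP => S; rewrite ext_mapE !sum_ffunE rmorph_sum.
by apply: eq_bigr => j _; rewrite ext_mapE.
Qed.

Lemma ext_map_ext1 : ext_map (ext1 K N) = ext1 L N.
Proof. by apply/ffunP => S; rewrite !ffunE rmorph_nat. Qed.

Lemma ext_map_wedge v b :
  ext_map (wedge (ext_vec v) b) = wedge (ext_vec (map_mx f v)) (ext_map b).
Proof.
apply/ffunP => S; rewrite ffunE !wedge_vecE rmorph_sum; apply: eq_bigr => i _.
by rewrite mxE ffunE !rmorphM rmorph_sign.
Qed.

Lemma ext_map_vec v : ext_map (ext_vec v) = ext_vec (map_mx f v).
Proof. by rewrite -wedge_ext1 ext_map_wedge ext_map_ext1 wedge_ext1. Qed.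

Lemma ext_map_der0 z b : ext_map (der0 z b) = der0 (map_mx f z) (ext_map b).
Proof.
elim/ext_ind_vec: b => [k a b ha hb||v b hb].
- by rewrite linearP /= !ext_mapP ha hb linearP.
- rewrite der0_ext1 ext_map_ext1 der0_ext1.
  by apply/ffunP => S; rewrite !ffunE rmorph0.
rewrite der0_wedge -[X in X + _]scale1r ext_mapP !ext_map_wedge rmorph1 scale1r.
by rewrite der0_wedge hb map_mxM.
Qed.

Lemma ext_map_act h b : ext_map (ext_act h b) = ext_act (map_mx f h) (ext_map b).
Proof.
elim/ext_ind_vec: b => [k a b ha hb||v b hb].
- by rewrite linearP /= !ext_mapP ha hb linearP.
- by rewrite ext_act_ext1 ext_map_ext1 ext_act_ext1.
by rewrite ext_act_wedge !ext_map_wedge ext_act_wedge hb map_mxM.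
Qed.

End ChangeOfScalars.

(** * Dimension counts and Cartan's inequality *)

Section LinearAlgebra.
Variable K : fieldType.

Lemma dim_setE (vT : vectType K) (V : set vT) (U : {vspace vT}) :
  (forall x, x \in U <-> V x) -> dim_set V = \dim U.
Proof.
move=> UV; rewrite /dim_set; case: xgetP => [U' _ U'V|/(_ U)//].
by congr (\dim _); apply/vspaceP => x; apply/idP/idP => [/(U'V x).1/(UV x).2|/(UV x).1/(U'V x).2].
Qed.

Lemma span_set_vspace (vT : vectType K) (S : set vT) :
  exists U : {vspace vT}, forall x, x \in U <-> span_set S x.
Proof.
apply: linear_set_vspace => [|a x y [s sS xs] [t tS yt]].
  by exists [::] => //; rewrite mem0v.
exists (s ++ t) => [z|]; first by rewrite mem_cat => /orP[/sS|/tS].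
by rewrite span_cat; apply: memv_add => //; rewrite memvZ.
Qed.

Lemma dim_inj_le (aT rT : vectType K) (f : {linear aT -> rT}) (U : {vspace aT}) :
  (forall u, u \in U -> f u = 0 -> u = 0) -> (\dim U <= dim rT)%N.
Proof.
move=> fU; rewrite -(@limg_dim_eq _ _ _ (linfun f)) -?dimvf ?dimvS ?subvf //.
apply/eqP; rewrite -subv0; apply/subvP => u; rewrite memv_cap memv_ker lfunE /= memv0.
by move=> /andP[/fU uU /eqP/uU ->].
Qed.

Lemma dim_ffun (I : finType) (vT : vectType K) : dim {ffun I -> vT} = (#|I| * dim vT)%N.
Proof. by []. Qed.

Section Dual.
Variables (vT : vectType K) (m : nat).

Definition eval_at (b : 'I_m -> vT) (f : 'Hom(vT, K^o)) : {ffun 'I_m -> K^o} :=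
  [ffun i => f (b i)].
Lemma eval_at_lin b : linear (eval_at b).
Proof. by move=> k f g; apply/ffunP => i; rewrite !ffunE !lfunE /= !lfunE. Qed.
HB.instance Definition _ b := GRing.isLinear.Build K _ _ _ (eval_at b) (eval_at_lin b).

Definition eval_by (X : 'I_m -> 'Hom(vT, K^o)) (v : vT) : {ffun 'I_m -> K^o} :=
  [ffun i => X i v].
Lemma eval_by_lin X : linear (eval_by X).
Proof. by move=> k f g; apply/ffunP => i; rewrite !ffunE linearP. Qed.
HB.instance Definition _ X := GRing.isLinear.Build K _ _ _ (eval_by X) (eval_by_lin X).
End Dual.

(** Each inequality comes from an injection into functions on a finite index
    set: functionals are determined by their values on a basis of a complement of
    the annihilator, vectors modulo the annihilator by the values on them of a basis
    of the span. *)
Lemma dim_annihilator (vT : vectType K) (S : set 'Hom(vT, K^o)) :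
  (dim_set (span_set S) + dim_set [set v | forall f, S f -> f v = 0%R])%N = dim vT.
Proof.
have [U US] := span_set_vspace S.
have [A AS] : exists A : {vspace vT}, forall x, x \in A <-> (forall f, S f -> f x = 0).
  apply: (linear_set_vspace (V := [set v | forall f, S f -> f v = 0])) => [f _|a x y hx hy f Sf].
    by rewrite linear0.
  by rewrite linearP /= hx // hy // scaler0 addr0.
rewrite (dim_setE US) (dim_setE AS).
have fA f v : f \in U -> v \in A -> f v = 0.
  move=> /US[s sS fs] vA; rewrite (@coord_span _ _ _ (in_tuple s) _ fs) sum_lfunE big1 // => i _.
  rewrite scale_lfunE /=; have /sS/((AS v).1 vA) -> : s`_i \in s by rewrite mem_nth.
  by rewrite scaler0.
apply/eqP; rewrite eqn_leq; apply/andP; split.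
- rewrite -dimvf -(subnK (dimvS (subvf A))) leq_add2r -dimv_compl.
  have : (\dim U <= dim {ffun 'I_(\dim A^C) -> K^o})%N.
    apply: (dim_inj_le (f := eval_at (fun i => (vbasis A^C)`_i))) => f fU f0.
    apply/lfunP => v; rewrite zero_lfunE.
    have : v \in (A + A^C)%VS by rewrite addv_complf memvf.
    move=> /memv_addP[x xA [y yA ->]]; rewrite linearD /= (fA _ _ fU xA) add0r.
    rewrite (coord_vbasis yA) linear_sum big1 // => i _; rewrite linearZ /=.
    by have /ffunP/(_ i) := f0; rewrite !ffunE => ->; rewrite scaler0.
  by rewrite dim_ffun card_ord muln1.
- pose X i := (vbasis U)`_i.
  rewrite -dimvf -(limg_ker_dim (linfun (eval_by (fun i : 'I_(\dim U) => X i))) fullv).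
  rewrite addnC leq_add //.
    by rewrite (leq_trans (dimvS (subvf _))) // dimvf dim_ffun card_ord muln1.
  rewrite dimvS //; apply/subvP => v; rewrite memv_cap memv_ker lfunE /= => /andP[_ /eqP v0].
  apply/AS => f Sf.
  have fU : f \in U by apply/US; exists [:: f]; rewrite ?memv_span1 // => g; rewrite inE => /eqP ->.
  rewrite (coord_vbasis fU) sum_lfunE big1 // => i _; rewrite scale_lfunE.
  by have /ffunP/(_ i) := v0; rewrite !ffunE => ->; rewrite scaler0.
Qed.

End LinearAlgebra.

Section Cartan.
Variables (R : realType) (N : nat) (A : set (ext R N)).
Local Notation ev := (@ext_vec R N).
Implicit Types (b : ext R N) (S B : {set 'I_N}) (i j k : 'I_N).

(** The annihilator of the polar functionals of the space spanned by the basis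
    vectors with index in B. By multilinearity it suffices to evaluate forms on
    these vectors, that is, to look at coefficients (polar_annihilatorE). *)
Definition polar_annihilator B : set 'M[R]_N :=
  [set z | forall b p S, A b -> (0 < p)%N -> homogeneous p b ->
     S \subset B -> #|S| = p -> der0 z b S = 0].

Definition eval_der0 b p (w : p.-tuple 'cV[R]_N) (z : 'M[R]_N) : R^o :=
  ext_eval (der0 z b) w.
Lemma eval_der0_lin b p (w : p.-tuple 'cV[R]_N) : linear (eval_der0 b w).
Proof.
move=> k y z; rewrite /eval_der0 /ext_eval scaler_sumr -big_split.
apply: eq_bigr => S _; rewrite der0_linz !ffunE mulrDl; congr (_ + _).
by rewrite -!mulrA.
Qed.
HB.instance Definition _ b p (w : p.-tuple 'cV[R]_N) :=
  GRing.isLinear.Build R _ _ _ (eval_der0 b w) (eval_der0_lin b w).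

Lemma ext_eval_basis b S (w : #|S|.-tuple 'cV[R]_N) :
    (forall r, tnth w r = theta (enum_val r).+1) ->
  ext_eval b w = b S.
Proof.
move=> wS; rewrite /ext_eval (bigD1 S) //= big1 ?addr0 => [|S' /andP[/eqP S'S neS]].
  rewrite (_ : matrix_of_fun _ _ = 1%:M) ?det1 ?mulr1 //.
  apply/matrixP => r c; rewrite !mxE (nth_map (enum_val r)) -?cardE //.
  by rewrite -enum_val_nth wS thetaE (inj_eq enum_val_inj).
have [i iS' iS] : exists2 i, i \in S' & i \notin S.
  apply/subsetPn; apply: contraNN neS => sS; rewrite finset.eqEcard sS S'S leqnn.
  by [].
rewrite (expand_det_row _ (cast_ord S'S (enum_rank_in iS' i))) big1 ?mulr0 // => c _.
rewrite mxE (nth_map i); last by rewrite -cardE; exact: (ltn_ord (enum_rank_in iS' i)).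
rewrite wS thetaE; case: eqP; rewrite ?mul0r //= => e.
case/negP: iS; have -> : i = enum_val c; last exact: enum_valP.
by rewrite -e -{1}(enum_rankK_in iS' iS') (enum_val_nth i).
Qed.

Lemma ext_eval_out b p (w : p.-tuple 'cV[R]_N) B :
    (forall S, S \subset B -> #|S| = p -> b S = 0) ->
    (forall r i, i \notin B -> tnth w r i 0 = 0) ->
  ext_eval b w = 0.
Proof.
move=> bB wB; rewrite /ext_eval big1 // => S /eqP Sp.
case: (boolP (S \subset B)) => [SB|/subsetPn[i iS iB]]; first by rewrite bB ?mul0r.
rewrite (expand_det_row _ (cast_ord Sp (enum_rank_in iS i))) big1 ?mulr0 // => c _.
rewrite mxE (nth_map i); last by rewrite -cardE; exact: (ltn_ord (enum_rank_in iS i)).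
rewrite -[nth _ _ _](enum_val_nth i (enum_rank_in iS i)) enum_rankK_in // wB //.
by rewrite mul0r.
Qed.

Lemma polar_annihilatorE (W : {vspace 'cV[R]_N}) B :
    (forall v, v \in W <-> forall i, i \notin B -> v i 0 = 0) ->
  [set z | forall f, polar_functionals A W f -> f z = 0] = polar_annihilator B.
Proof.
move=> WB; apply/seteqP; split => z /= hz.
- move=> b p S Ab p0 hb SB Sp; case: _ / Sp p0 hb => p0 hb.
  pose w := [tuple (theta (enum_val r).+1 : 'cV[R]_N) | r < #|S|].
  have wE r : tnth w r = theta (enum_val r).+1 by rewrite tnth_mktuple.
  rewrite -(ext_eval_basis (der0 z b) wE).
  have := hz (linfun (eval_der0 b w)); rewrite lfunE /=; apply.
  exists #|S|, b, w; split => // [r|y]; last by rewrite lfunE.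
  rewrite wE; apply/WB => i iB; rewrite thetaE; case: eqP => // iE.
  by case/negP: iB; rewrite iE (fintype.subsetP SB) // enum_valP.
- move=> f [p [b [w [p0 Ab hb wW ->]]]].
  apply: (@ext_eval_out _ _ _ B) => [S SB Sp|r i iB]; first exact: (hz b p).
  exact: (WB _).1 (wW r) i iB.
Qed.

Lemma polar_annihilator_vspace B :
  exists U : {vspace 'M[R]_N}, forall z, z \in U <-> polar_annihilator B z.
Proof.
apply: linear_set_vspace => [b p S *|k y z hy hz b p S Ab p0 hb SB Sp].
  by rewrite der00 ffunE.
by rewrite der0_linz !ffunE (hy b p S) // (hz b p S) // scaler0 addr0.
Qed.

(** The dual count: c(W) is the codimension of an annihilator. *)
Lemma polar_dimE (W : {vspace 'cV[R]_N}) B :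
    (forall v, v \in W <-> forall i, i \notin B -> v i 0 = 0) ->
  (polar_dim A W + dim_set (polar_annihilator B))%N = (N * N)%N.
Proof.
move=> /polar_annihilatorE <-; rewrite -[RHS](dim_matrix R N N).
exact: dim_annihilator.
Qed.

Lemma Z0_vspace : exists U : {vspace glT R N}, forall eta, eta \in U <-> Z0 A eta.
Proof.
apply: linear_set_vspace => [b Ab|k x y hx hy b Ab].
  have := der1_lin b (-1) (0 : glT R N) 0.
  by rewrite scaler0 addr0 scaleN1r addNr.
by rewrite der1_lin hx // hy // scaler0 addr0.
Qed.

(** The matrix that acts in the direction theta_k in der1E. *)
Definition slice k (eta : glT R N) : 'M[R]_N := (eta k)^T.
Lemma slice_lin k : linear (slice k).
Proof. by move=> c x y; apply/matrixP => i j; rewrite !mxE !ffunE !mxE. Qed.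
HB.instance Definition _ k := GRing.isLinear.Build R _ _ _ (slice k) (slice_lin k).

(** In the coefficient of d_eta b on m |: S only the term theta_m ^ D b of der1E
    survives, as the slices of eta in the directions of S vanish. *)
Lemma der1_slice (eta : glT R N) b B m S :
    (forall j, j \in B -> eta j = 0) -> m \notin B -> S \subset B ->
    der1 eta b = 0 -> der0 (slice m eta) b S = 0.
Proof.
move=> etaB mB SB /ffunP/(_ (m |: S)%SET).
have mS : m \notin S by apply: contraNN mB => /(fintype.subsetP SB).
rewrite der1E !ffunE sum_ffunE => /eqP; rewrite oppr_eq0 (bigD1 m) //= big1 ?addr0 => [|j jm].
  by rewrite wedge_thetaE finset.setU11 finset.setU1K // mulf_eq0 signr_eq0 => /eqP.
rewrite wedge_thetaE; case: ifP => //; rewrite !inE (negbTE jm) /= => jS.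
rewrite etaB ?(fintype.subsetP SB) // trmx0.
by rewrite der00 ffunE mulr0.
Qed.

(** Cartan's inequality, one half of Cartan's test. Filter Z0 by the number of
    initial directions of the flag in which the slices of eta vanish: by
    der1_slice each graded piece embeds, through the next slice, into the
    annihilator of the polar functionals at that step. *)
Lemma cartan_inequality (rk : 'I_N -> 'I_N) : injective rk ->
  (dim_set (Z0 A) <=
     \sum_(k < N) dim_set (polar_annihilator [set i | (rk i < k)%N]%SET))%N.
Proof.
move=> rkI; pose B (k : nat) : {set 'I_N} := [set i | (rk i < k)%N]%SET.
pose Z (k : nat) := [set eta : glT R N | Z0 A eta /\ forall j, j \in B k -> eta j = 0].
have ZV (k : nat) : exists U : {vspace glT R N}, forall eta, eta \in U <-> Z k eta.
  have [U UZ] := Z0_vspace.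
  apply: linear_set_vspace => [|c x y [/UZ xU hx] [/UZ yU hy]].
    by split=> [|j _]; [apply/UZ; rewrite mem0v|rewrite ffunE].
  split; first by apply/UZ; rewrite memvD // memvZ.
  by move=> j jB; rewrite !ffunE hx // hy // scaler0 addr0.
suff H (k : nat) : (k <= N)%N -> (dim_set (Z0 A) <=
     \sum_(j < k) dim_set (polar_annihilator (B j)) + dim_set (Z k))%N.
  apply: (leq_trans (H N (leqnn N))).
  have [U UZ] := ZV N; rewrite (dim_setE UZ).
  have -> : U = 0%VS; last by rewrite dimv0 addn0.
  apply/eqP; rewrite -subv0; apply/subvP => eta /UZ[_ eta0].
  by rewrite memv0; apply/eqP/ffunP => j; rewrite ffunE eta0 // inE ltn_ord.
elim: k => [_|k IH kN].
  rewrite big_ord0 add0n; have [U UZ] := Z0_vspace; have [V VZ] := ZV 0%N.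
  rewrite (dim_setE UZ) (dim_setE VZ) dimvS //; apply/subvP => eta /UZ etaZ.
  by apply/VZ; split => // j; rewrite inE.
apply: (leq_trans (IH (ltnW kN))); rewrite big_ord_recr /= -addnA leq_add2l.
have [V VZ] := ZV k; have [V' VZ'] := ZV k.+1.
have [P PA] := polar_annihilator_vspace (B k).
(* the direction that enters the flag at step k *)
have [m rm] : exists m, rk m = Ordinal kN.
  by have [f _ fK] := injF_bij rkI; exists (f (Ordinal kN)); rewrite fK.
rewrite (dim_setE VZ) (dim_setE VZ') (dim_setE PA) addnC.
rewrite -(limg_ker_dim (linfun (slice m)) V) leq_add // dimvS //; apply/subvP => eta.
  rewrite memv_cap memv_ker lfunE /= => /andP[/VZ[etaZ eta0] /eqP etam].
  apply/VZ'; split => // j; rewrite inE ltnS leq_eqVlt => /orP[/eqP jk|jk].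
    have -> : j = m by apply: rkI; rewrite rm; apply: val_inj.
    by rewrite -[eta m]trmxK -/(slice m eta) etam trmx0.
  by apply: eta0; rewrite inE.
move=> /memv_imgP[e /VZ[eZ e0] ->]; rewrite lfunE /=; apply/PA => b p S Ab _ _ SB _.
apply: (der1_slice (B := B k)) => //; last exact: eZ.
by rewrite inE rm /= ltnn.
Qed.

End Cartan.

(** * The group SU(n) as a group of real matrices *)

Lemma invmx_uniq (K : comUnitRingType) n (A B : 'M[K]_n) : A *m B = 1%:M -> invmx B = A.
Proof.
move=> AB; have [_ Bu] := mulmx1_unit AB.
by rewrite -[LHS]mul1mx -AB -mulmxA mulmxV // mulmx1.
Qed.

Section Realification.
Variables (R : realType) (n : nat).
Local Notation C := R[i].
Local Notation N := n.*2.+1.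
Implicit Types (p q : 'I_n) (b c : bool) (i j : 'I_N).

(** The index of the real (b = false) or imaginary (b = true) part of the p-th
    complex coordinate. *)
Definition ix p b : 'I_N := inord (b + p.*2).

Lemma val_ix p b : ix p b = (b + p.*2)%N :> nat.
Proof.
by rewrite /ix inordK //; have := ltn_ord p; case: b => /=; lia.
Qed.

Lemma ix_eq p b q c : (ix p b == ix q c) = (p == q) && (b == c).
Proof.
rewrite -val_eqE /= !val_ix -[p == q]val_eqE /=.
by case: b; case: c => /=; lia.
Qed.

Lemma ix_max p b : (ix p b == ord_max) = false.
Proof.
rewrite -val_eqE /= val_ix; apply/negbTE; rewrite neq_ltn; apply/orP; left.
by have := ltn_ord p; case: b => /=; lia.
Qed.

Variant idx_spec : 'I_N -> Type :=
| IdxPair p b : idx_spec (ix p b)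
| IdxMax : idx_spec ord_max.

Lemma idxP i : idx_spec i.
Proof.
have [lt|ge] := ltnP i n.*2; last first.
  have -> : i = ord_max by apply: val_inj; apply/eqP; rewrite eqn_leq ge -ltnS ltn_ord.
  exact: IdxMax.
have hn : (i./2 < n)%N by rewrite -ltn_double (leq_ltn_trans _ lt) // -[X in (_ <= X)%N]odd_double_half leq_addl.
have -> : i = ix (Ordinal hn) (odd i) by apply: val_inj; rewrite /= val_ix /= odd_double_half.
exact: IdxPair.
Qed.

Lemma big_idx (T : Type) (idx : T) (op : Monoid.com_law idx) (f : 'I_N -> T) :
  \big[op/idx]_i f i =
  op (\big[op/idx]_p (op (f (ix p false)) (f (ix p true)))) (f ord_max).
Proof.
rewrite big_ord_recr /=; congr (op _ _).
have E (g : nat -> T) m :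
    \big[op/idx]_(k < m.*2) g k = \big[op/idx]_(k < m) op (g k.*2) (g k.*2.+1).
  elim: m => [|m IH]; first by rewrite !big_ord0.
  by rewrite doubleS !big_ord_recr /= IH Monoid.mulmA.
transitivity (\big[op/idx]_(k < n.*2) f (inord k)).
  by apply: eq_bigr => k _; congr f; apply: ord_inj; rewrite inordK /= ?ltnS ?(ltnW (ltn_ord k)).
by rewrite (E (fun k => f (inord k))); apply: eq_bigr.
Qed.

Lemma sum_idx (V : nmodType) (f : 'I_N -> V) :
  \sum_i f i = \sum_p (f (ix p false) + f (ix p true)) + f ord_max.
Proof. exact: big_idx. Qed.

(** The entries of the real 2 x 2 matrix of multiplication by u. *)
Definition cblock (u : C) b c : R :=
  if b == c then complex.Re u else if b then complex.Im u else - complex.Im u.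

(** The inverse of ix, undefined on the last index. *)
Definition dec i : option ('I_n * bool) := [pick pb | ix pb.1 pb.2 == i].

Lemma dec_ix p b : dec (ix p b) = Some (p, b).
Proof.
rewrite /dec; case: pickP => [[q c]|/(_ (p, b))] /=; last by rewrite eqxx.
by rewrite ix_eq => /andP[/eqP -> /eqP ->].
Qed.

Lemma dec_max : dec ord_max = None.
Proof. by rewrite /dec; case: pickP => // -[q c] /=; rewrite ix_max. Qed.

(** The real matrix of U acting on R^2n = C^n, and of t acting on the last
    coordinate. *)
Definition rho (t : R) (U : 'M[C]_n) : 'M[R]_N := \matrix_(i, j)
  match dec i, dec j with
  | Some (p, b), Some (q, c) => cblock (U p q) b c
  | None, None => t
  | _, _ => 0
  end.

Lemma rho_ix t U p b q c : rho t U (ix p b) (ix q c) = cblock (U p q) b c.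
Proof. by rewrite mxE !dec_ix. Qed.

Lemma rho_ixmax t U p b : rho t U (ix p b) ord_max = 0.
Proof. by rewrite mxE dec_ix dec_max. Qed.

Lemma rho_maxix t U p b : rho t U ord_max (ix p b) = 0.
Proof. by rewrite mxE dec_ix dec_max. Qed.

Lemma rho_max t U : rho t U ord_max ord_max = t.
Proof. by rewrite mxE dec_max. Qed.

Definition rhoE := (rho_ix, rho_ixmax, rho_maxix, rho_max).

Lemma ReIm (z : C) : z = (complex.Re z +i* complex.Im z)%C.
Proof. by case: z. Qed.

Lemma eqC (z w : C) : complex.Re z = complex.Re w ->
  complex.Im z = complex.Im w -> z = w.
Proof. by case: z w => [a b] [a' b'] /= -> ->. Qed.

Lemma ReD (z w : C) : complex.Re (z + w) = complex.Re z + complex.Re w.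
Proof. exact: raddfD. Qed.

Lemma ImD (z w : C) : complex.Im (z + w) = complex.Im z + complex.Im w.
Proof. exact: raddfD. Qed.

Lemma ReM (z w : C) : complex.Re (z * w) =
  complex.Re z * complex.Re w - complex.Im z * complex.Im w.
Proof. by case: z; case: w. Qed.

Lemma ImM (z w : C) : complex.Im (z * w) =
  complex.Re z * complex.Im w + complex.Im z * complex.Re w.
Proof. by case: z; case: w. Qed.

Lemma Re_conj (z : C) : complex.Re z^* = complex.Re z.
Proof. by case: z. Qed.

Lemma Im_conj (z : C) : complex.Im z^* = - complex.Im z.
Proof. by case: z. Qed.

Lemma rho_inj t s U V : rho t U = rho s V -> t = s /\ U = V.
Proof.
move=> e; split; first by rewrite -(rho_max t U) e rho_max.
apply/matrixP => p q; apply: eqC.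
  by have := congr1 (fun M : 'M[R]_N => M (ix p false) (ix q false)) e; rewrite !rhoE.
by have := congr1 (fun M : 'M[R]_N => M (ix p true) (ix q false)) e; rewrite !rhoE.
Qed.

Lemma rhoP (M : 'M[R]_N) t (U : 'M[C]_n) :
  (forall p b q c, M (ix p b) (ix q c) = cblock (U p q) b c) ->
  (forall p b, M (ix p b) ord_max = 0) -> (forall p b, M ord_max (ix p b) = 0) ->
  M ord_max ord_max = t -> M = rho t U.
Proof.
move=> h1 h2 h3 h4; apply/matrixP => i j.
by case: (idxP i) => [p b|]; case: (idxP j) => [q c|]; rewrite rhoE.
Qed.

Lemma rho1 : rho 1 1%:M = 1%:M.
Proof.
apply/esym/rhoP => [p b q c|p b|p b|]; rewrite mxE ?eqxx // ?ix_max //.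
  rewrite ix_eq /cblock mxE; case: eqP => _; case: b; case: c => //=; rewrite ?oppr0 //.
by rewrite eq_sym ix_max.
Qed.

Lemma cblockM (f g : 'I_n -> C) b c :
  \sum_r (cblock (f r) b false * cblock (g r) false c +
          cblock (f r) b true * cblock (g r) true c) =
  cblock (\sum_r f r * g r) b c.
Proof.
have Es (h : 'I_n -> C) : cblock (\sum_r h r) b c = \sum_r cblock (h r) b c.
  by rewrite /cblock; case: b; case: c => //=; rewrite raddf_sum // -sumrN.
rewrite Es {Es}; apply: eq_bigr => r _; rewrite /cblock.
by case: b; case: c => //=; rewrite ?ReM ?ImM; ring.
Qed.

Lemma rhoM t s U V : rho t U *m rho s V = rho (t * s) (U *m V).
Proof.
apply: rhoP => [p b q c|p b|p b|]; rewrite mxE sum_idx !rhoE.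
- rewrite mul0r addr0 mxE -cblockM; apply: eq_bigr => r _; by rewrite !rhoE.
- by rewrite mul0r addr0 big1 // => r _; rewrite !rhoE !mulr0 addr0.
- by rewrite mulr0 addr0 big1 // => r _; rewrite !rhoE !mul0r addr0.
- by rewrite big1 ?add0r // => r _; rewrite !rhoE !mul0r addr0.
Qed.

Lemma rhoT t U : (rho t U)^T = rho t (U^t*)%sesqui.
Proof.
apply: rhoP => [p b q c|p b|p b|]; rewrite mxE !rhoE // !mxE /cblock Re_conj Im_conj.
by case: b; case: c => //=; rewrite ?opprK.
Qed.

Lemma rhoP_lin k t s U V :
  rho (k * t + s) (k%:C%C *: U + V) = k *: rho t U + rho s V.
Proof.
apply/esym/rhoP => [p b q c|p b|p b|]; rewrite mxE mxE !rhoE ?mulr0 ?addr0 //.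
rewrite !mxE /cblock ReD ImD ReM ImM /=.
by case: b; case: c => //=; ring.
Qed.

Lemma rho00 : rho 0 0 = 0.
Proof.
apply/esym/rhoP => [p b q c|p b|p b|]; rewrite mxE // /cblock mxE.
by case: b; case: c; rewrite /= ?oppr0.
Qed.

Lemma complex_partE (v : 'cV[R]_N) p :
  complex_part v p 0 = (v (ix p false) 0 +i* v (ix p true) 0)%C.
Proof. by rewrite mxE. Qed.

Lemma complex_part_inj (v w : 'cV[R]_N) : complex_part v = complex_part w ->
  v ord_max 0 = w ord_max 0 -> v = w.
Proof.
move=> e em; apply/colP => i; case: (idxP i) => [p b|//].
by have /colP/(_ p) := e; rewrite !complex_partE => -[]; case: b.
Qed.

Lemma complex_part_rho t U (v : 'cV[R]_N) :
  complex_part (rho t U *m v) = U *m complex_part v.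
Proof.
apply/colP => p; rewrite complex_partE [RHS]mxE; apply: eqC; rewrite /= raddf_sum;
  rewrite mxE sum_idx rhoE mul0r addr0; apply: eq_bigr => q _;
  rewrite !rhoE complex_partE /cblock /=; [rewrite ReM|rewrite ImM] => /=; ring.
Qed.

Lemma rho_mul_max t U (v : 'cV[R]_N) : (rho t U *m v) ord_max 0 = t * v ord_max 0.
Proof.
by rewrite mxE sum_idx rhoE big1 ?add0r // => q _; rewrite !rhoE !mul0r addr0.
Qed.

Lemma mulmx_inj (M M' : 'M[R]_N) : (forall v : 'cV[R]_N, M *m v = M' *m v) -> M = M'.
Proof.
by move=> e; apply/matrixP => i j; have /colP/(_ i) := e (theta j.+1); rewrite !mulmx_theta !mxE.
Qed.

Lemma theta_max : theta N = theta (@ord_max n.*2).+1 :> 'cV[R]_N.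
Proof. by []. Qed.

(** A vector is determined by its complex coordinates and the last one, so the
    conditions defining SU(n) determine all entries of g. *)
Lemma SUE (g : 'M[R]_N) : SU g <->
  exists U : 'M[C]_n, [/\ U \is unitarymx, \det U = 1 & g = rho 1 U].
Proof.
split=> [[_ [U [Uu Ud Ug]]]|[U [Uu Ud ->]]].
  exists U; split => //; apply: mulmx_inj => v; have [e em] := Ug v.
  apply: complex_part_inj; first by rewrite complex_part_rho.
  by rewrite rho_mul_max mul1r.
split.
  apply: complex_part_inj; last by rewrite rho_mul_max mul1r.
  rewrite complex_part_rho (_ : complex_part _ = 0) ?mulmx0 //.
  apply/colP => p; rewrite complex_partE theta_max !thetaE !ix_max mxE.
  by apply: eqC.
by exists U; split => // v; rewrite complex_part_rho rho_mul_max mul1r.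
Qed.

Lemma det_conjt (U : 'M[C]_n) : \det (U^t*)%sesqui = (\det U)^*.
Proof. by rewrite det_map_mx det_tr. Qed.

Lemma SU_orthogonal : orthogonal_subgroup (@SU R n).
Proof.
have orth (g : 'M[R]_N) : SU g -> g *m g^T = 1%:M.
  move=> /SUE[U [/unitarymxP UU _ ->]]; by rewrite rhoT rhoM UU mul1r rho1.
split=> //.
- by apply/SUE; exists 1%:M; rewrite det1 rho1; split => //; apply/unitarymxP; rewrite trmx1 map_mx1 mulmx1.
- move=> g h /SUE[U [Uu Ud ->]] /SUE[V [Vu Vd ->]]; apply/SUE; exists (U *m V).
  split; first exact: (mul_unitarymx Uu Vu).
    by rewrite det_mulmx Ud Vd mulr1.
  by rewrite rhoM mulr1.
- move=> g Gg.
  have -> : invmx g = g^T by apply: invmx_uniq; exact/mulmx1C/orth.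
  have [U [Uu Ud ->]] := (SUE g).1 Gg; apply/SUE; exists (U^t*)%sesqui.
  by rewrite trmxC_unitary det_conjt Ud rhoT; split => //; rewrite conjC1.
Qed.

End Realification.

(** * The invariant forms *)

Section WedgeProducts.
Variables (K : comNzRingType) (N : nat).
Local Notation ev := (@ext_vec K N).

Lemma ext_act_vec h (v : 'cV[K]_N) : ext_act h (ev v) = ev (h *m v).
Proof. by rewrite -wedge_ext1 ext_act_wedge ext_act_ext1 wedge_ext1. Qed.

Lemma ext_act_wedges h (T : Type) (s : seq T) (v : T -> 'cV[K]_N) :
  ext_act h (wedges [seq ev (v t) | t <- s]) = wedges [seq ev (h *m v t) | t <- s].
Proof.
elim: s => [|t s IH] /=; first exact: ext_act_ext1.
by rewrite ext_act_wedge IH.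
Qed.

(** The coefficients of a product of n vectors are minors, by wedges_det, and the
    determinant is multiplicative. *)
Lemma wedges_mulmx (i0 : 'I_N) n (M : 'M[K]_n) (v : 'I_n -> 'cV[K]_N) :
  wedges [seq ev (\sum_q M p q *: v q) | p <- enum 'I_n] =
  \det M *: wedges [seq ev (v p) | p <- enum 'I_n].
Proof.
apply/ffunP => S; rewrite scaleE; case: (eqVneq #|S| n) => Sn.
  rewrite !(wedges_det i0) // -det_mulmx; congr (\det _).
  apply/matrixP => r c; rewrite !mxE summxE; apply: eq_bigr => q _.
  by rewrite !mxE.
have h0 (w : 'I_n -> 'cV[K]_N) : wedges [seq ev (w p) | p <- enum 'I_n] S = 0.
  apply: contraNeq Sn; rewrite (map_comp ev w) => /homogeneous_wedges ->.
  by rewrite size_map size_enum_ord.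
by rewrite !h0 mulr0.
Qed.

(** The contraction with e_j - c e_i kills every factor. *)
Lemma contr_wedges i j c (s : seq 'cV[K]_N) :
    (forall v, v \in s -> v j 0 = c * v i 0) ->
  contr j (wedges (map ev s)) = c *: contr i (wedges (map ev s)).
Proof.
elim: s => [|v s IH] hs /=; first by rewrite !contr_ext1 scaler0.
rewrite !contr_wedge hs ?mem_head // IH; last by move=> w ws; apply: hs; rewrite in_cons ws orbT.
by rewrite linearZ /= scalerBr scalerA.
Qed.

Lemma contr_vec i (v : 'cV[K]_N) : contr i (ev v) = v i 0 *: ext1 K N.
Proof. by rewrite -wedge_ext1 contr_wedge contr_ext1 linear0 subr0. Qed.

(** Writing D_z through multiplications and contractions displays the symmetry in
    j and k of d_eta for eta in T (x) S^2 T. *)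
Lemma der0E (z : 'M[K]_N) b :
  der0 z b = \sum_i \sum_j z j i *: wedge (ev (theta j.+1)) (contr i b).
Proof.
elim/ext_ind_vec: b => [k a b ha hb||v b hb].
- rewrite linearP /= ha hb scaler_sumr -big_split; apply: eq_bigr => i _.
  rewrite scaler_sumr -big_split; apply: eq_bigr => j _.
  by rewrite !linearP.
- rewrite der0_ext1 big1 // => i _; rewrite big1 // => j _.
  by rewrite contr_ext1 linear0 scaler0.
rewrite der0_wedge hb linear_sum /= (wedge_vec_theta (z *m v)).
transitivity (\sum_i ((\sum_j (z j i * v i 0) *: wedge (ev (theta j.+1)) b) +
   wedge (ev v) (\sum_j z j i *: wedge (ev (theta j.+1)) (contr i b)))).
  rewrite big_split /=; congr (_ + _); rewrite exchange_big; apply: eq_bigr => j _.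
  by rewrite mxE scaler_suml.
apply: eq_bigr => i _; rewrite linear_sum -big_split; apply: eq_bigr => j _.
rewrite contr_wedge [wedge _ (_ - _)]linearB /= [wedge _ (_ *: b)]linearZ /= scalerBr scalerA.
congr (_ + _).
by rewrite linearZ /= wedge_vecC scalerN.
Qed.

Lemma wedge_vv (v : 'cV[K]_N) : wedge (ev v) (ev v) = 0.
Proof. by have := wedge_vec_sqr v (ext1 K N); rewrite wedge_ext1. Qed.

Lemma wedge_vvC (u v : 'cV[K]_N) : wedge (ev u) (ev v) = - wedge (ev v) (ev u).
Proof. by have := wedge_vecC u v (ext1 K N); rewrite !wedge_ext1. Qed.

Lemma wedge_conj (x y : 'cV[K]_N) (a : K) :
  wedge (ev (x + a *: y)) (ev (x + (- a) *: y)) = (- a *+ 2) *: wedge (ev x) (ev y).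
Proof.
have E w : wedge (ev (x + a *: y)) w = wedge (ev x) w + a *: wedge (ev y) w.
  by rewrite linearD /= linearZ -[LHS]/(wedger w _) linearD linearZ.
rewrite [ev (x + - a *: y)]linearD /= linearZ /= linearD linearZ /= !E !wedge_vv.
by rewrite scaler0 addr0 add0r (wedge_vvC y x) scalerN -scaleNr -scalerDl mulr2n.
Qed.

Lemma wedge_bilinear (m : nat) (f g : 'I_m -> K) (v w : 'I_m -> 'cV[K]_N) :
  wedge (ev (\sum_q f q *: v q)) (ev (\sum_r g r *: w r)) =
  \sum_q \sum_r (f q * g r) *: wedge (ev (v q)) (ev (w r)).
Proof.
rewrite [ev (\sum_q _)]linear_sum -[LHS]/(wedger _ _) linear_sum; apply: eq_bigr => q _ /=.
rewrite [ev (_ *: _)]linearZ /= [wedger _ _]linearZ /= /wedger.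
rewrite [ev (\sum_r _)]linear_sum [wedge _ _]linear_sum scaler_sumr.
by apply: eq_bigr => r _; rewrite /= [ev (_ *: _)]linearZ [wedge _ (_ *: _)]linearZ /= scalerA.
Qed.

End WedgeProducts.

Section Forms.
Variables (R : realType) (n : nat).
Local Notation C := R[i].
Local Notation N := n.*2.+1.
Local Notation rc := (real_complex R).
Local Notation I := ('i%C : C).
Implicit Types (p q r : 'I_n) (b c : bool) (i j : 'I_N).

(** dz_p for y = i, and its conjugate for y = - i. *)
Definition zc (y : C) p : 'cV[C]_N := theta (ix p false).+1 + y *: theta (ix p true).+1.

Lemma zc_ix y p q b : zc y p (ix q b) 0 = if q == p then if b then y else 1 else 0.
Proof.
rewrite mxE thetaE mxE thetaE !ix_eq.
by case: (q == p); case: b; rewrite /= ?mulr0 ?mulr1 ?addr0 ?add0r.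
Qed.

Lemma zc_max y p : zc y p ord_max 0 = 0.
Proof. by rewrite mxE thetaE mxE thetaE ![ord_max == _]eq_sym !ix_max mulr0 addr0. Qed.

Lemma Omega_formE : Omega_form R n = wedges [seq ext_vec (zc I p) | p <- enum 'I_n].
Proof.
rewrite /Omega_form; congr wedges.
have -> : iota 1 n = map succn (map val (enum 'I_n)) by rewrite val_enum_ord -(iotaDl 1 0).
rewrite -2!map_comp.
apply: eq_map => p /=; congr (ext_vec (_ + _)).
  by rewrite val_ix.
by rewrite val_ix.
Qed.

Lemma F_formE : F_form R n =
  \sum_(p < n) wedge (ext_vec (theta (ix p false).+1)) (ext_vec (theta (ix p true).+1)).
Proof.
rewrite /F_form big_add1 big_mkord; apply: eq_bigr => p _.
by rewrite !val_ix.
Qed.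

Definition complexify (a b : ext R N) : ext C N := ext_map rc a + I *: ext_map rc b.

Lemma complexifyE (a b : ext R N) S : complexify a b S = (a S +i* b S)%C.
Proof.
rewrite addE scaleE !ext_mapE; apply: eqC.
  by rewrite ReD ReM /=; ring.
by rewrite ImD ImM /=; ring.
Qed.

Lemma complexify_inj (a b a' b' : ext R N) :
  complexify a b = complexify a' b' -> a = a' /\ b = b'.
Proof.
move=> e; have E S : (a S +i* b S)%C = (a' S +i* b' S)%C by rewrite -!complexifyE e.
by split; apply/ffunP => S; case: (E S).
Qed.

Lemma Omega_split : Omega_form R n = complexify (ReOmega_form R n) (ImOmega_form R n).
Proof.
by apply/ffunP => S; rewrite complexifyE [ReOmega_form _ _ S]ffunE [ImOmega_form _ _ S]ffunE; apply: ReIm.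
Qed.

(** The vector zc i p is of type - i for the complex structure, and U acts on such
    vectors through its conjugate. *)
Lemma SU_zc (U : 'M[C]_n) p :
  map_mx rc (rho 1 U) *m zc I p = \sum_q (U^t*)%sesqui p q *: zc I q.
Proof.
apply/colP => i; rewrite mxE sum_idx zc_max mulr0 addr0 summxE.
rewrite (bigD1 p) //= big1 => [|q qp]; last by rewrite !zc_ix (negbTE qp) !mulr0 addr0.
rewrite !zc_ix eqxx mulr1 addr0; case: (idxP i) => [q b|]; rewrite !mxE -!/(rho 1 U _ _).
  rewrite (bigD1 q) //= big1 => [|r rq]; last by rewrite mxE zc_ix eq_sym (negbTE rq) mulr0.
  rewrite mxE zc_ix eqxx addr0 !mxE !dec_ix /cblock.
  by apply: eqC; case: b; rewrite ?ReD ?ImD ?ReM ?ImM ?Re_conj ?Im_conj /=; ring.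
rewrite !dec_ix dec_max !rmorph0 mul0r addr0 big1 // => q _.
by rewrite mxE zc_max mulr0.
Qed.

(** The n vectors zc i p are transformed by a matrix of determinant one. *)
Lemma Omega_act (g : 'M[R]_N) : SU g ->
  ext_act (map_mx rc g) (Omega_form R n) = Omega_form R n.
Proof.
move=> /SUE[U [Uu Ud ->]]; rewrite Omega_formE ext_act_wedges.
rewrite (eq_map (fun p => congr1 (@ext_vec C N) (SU_zc U p))).
rewrite (wedges_mulmx ord_max) det_conjt Ud.
by rewrite (_ : 1^* = 1) ?scale1r // conjC1.
Qed.

Lemma complexify_act (g : 'M[R]_N) (a b : ext R N) :
  ext_act (map_mx rc g) (complexify a b) = complexify (ext_act g a) (ext_act g b).
Proof. by rewrite linearD linearZ /= /complexify !ext_map_act. Qed.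

Lemma complexify_der0 (z : 'M[R]_N) (a b : ext R N) :
  der0 (map_mx rc z) (complexify a b) = complexify (der0 z a) (der0 z b).
Proof. by rewrite linearD linearZ /= /complexify !ext_map_der0. Qed.

Lemma invariants_Re : invariants (@SU R n) (ReOmega_form R n).
Proof.
by move=> g /Omega_act; rewrite Omega_split complexify_act => /complexify_inj[].
Qed.

Lemma invariants_Im : invariants (@SU R n) (ImOmega_form R n).
Proof.
by move=> g /Omega_act; rewrite Omega_split complexify_act => /complexify_inj[].
Qed.

Lemma invariants_alpha : invariants (@SU R n) (alpha_form R n).
Proof. by move=> g [ge _]; rewrite /alpha_form ext_act_vec ge. Qed.

(** F is, up to a constant, the Hermitian form sum z_p ^ conj z_p, which is
    unitarily invariant. *)
Lemma F_hermitian : \sum_p wedge (ext_vec (zc I p)) (ext_vec (zc (- I) p)) =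
  (- I *+ 2) *: ext_map rc (F_form R n).
Proof.
rewrite F_formE.
have -> : ext_map rc (\sum_(p < n) wedge (ext_vec (theta (ix p false).+1 : 'cV[R]_N))
      (ext_vec (theta (ix p true).+1))) =
    \sum_(p < n) wedge (ext_vec (theta (ix p false).+1 : 'cV[C]_N)) (ext_vec (theta (ix p true).+1)).
  rewrite ext_map_sum; apply: eq_bigr => p _; rewrite ext_map_wedge ext_map_vec.
  by congr (wedge (ext_vec _) (ext_vec _)); apply/colP => i; rewrite mxE !thetaE rmorph_nat.
rewrite scaler_sumr; apply: eq_bigr => p _.
rewrite /zc; set x := theta (ix p false).+1; set y := theta _.
exact: wedge_conj.
Qed.

Lemma SU_zcbar (U : 'M[C]_n) p :
  map_mx rc (rho 1 U) *m zc (- I) p = \sum_q U q p *: zc (- I) q.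
Proof.
apply/colP => i; rewrite mxE sum_idx zc_max mulr0 addr0 summxE.
rewrite (bigD1 p) //= big1 => [|q qp]; last by rewrite !zc_ix (negbTE qp) !mulr0 addr0.
rewrite !zc_ix eqxx mulr1 addr0; case: (idxP i) => [q b|]; rewrite !mxE -!/(rho 1 U _ _).
  rewrite (bigD1 q) //= big1 => [|r rq]; last by rewrite mxE zc_ix eq_sym (negbTE rq) mulr0.
  rewrite mxE zc_ix eqxx addr0 !dec_ix /cblock.
  by apply: eqC; case: b; rewrite ?ReD ?ImD ?ReM ?ImM ?Re_conj ?Im_conj /=; ring.
rewrite !dec_ix dec_max !rmorph0 mul0r addr0 big1 // => q _.
by rewrite mxE zc_max mulr0.
Qed.

Lemma ext_map_rc_inj (k : C) (a b : ext R N) : k != 0 ->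
  k *: ext_map rc a = k *: ext_map rc b -> a = b.
Proof.
move=> k0 e; apply/ffunP => S; have := congr1 (fun w : ext C N => w S) e.
by rewrite !scaleE !ext_mapE => /(mulfI k0)/complexI.
Qed.

Lemma invariants_F : invariants (@SU R n) (F_form R n).
Proof.
move=> g /SUE[U [/unitarymxP Uu _ ->]].
have k0 : (- I *+ 2 : C) != 0 by rewrite mulrn_eq0 /= oppr_eq0 complexiE neq0Ci.
apply: (ext_map_rc_inj k0); rewrite ext_map_act -linearZ /= -F_hermitian linear_sum.
transitivity (\sum_p \sum_q \sum_r ((U^t*)%sesqui p q * U r p) *:
    wedge (ext_vec (zc I q)) (ext_vec (zc (- I) r))).
  apply: eq_bigr => p _; rewrite /= ext_act_wedge ext_act_vec SU_zc SU_zcbar.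
  exact: wedge_bilinear.
rewrite exchange_big; apply: eq_bigr => q _ /=.
rewrite exchange_big (bigD1 q) //= [X in _ + X]big1 ?addr0 => [|r rq].
  rewrite -scaler_suml (_ : \sum_p _ = 1) ?scale1r //.
  transitivity ((U *m (U^t*)%sesqui) q q); last by rewrite Uu mxE eqxx.
  by rewrite mxE; apply: eq_bigr => p _; rewrite mulrC.
rewrite -scaler_suml (_ : \sum_p _ = 0) ?scale0r //.
transitivity ((U *m (U^t*)%sesqui) r q); last by rewrite Uu mxE (negbTE rq).
by rewrite mxE; apply: eq_bigr => p _; rewrite mulrC.
Qed.

End Forms.

(** * The equations imposed by the four forms *)

Section Equations.
Variables (R : realType) (n : nat).
Local Notation C := R[i].
Local Notation N := n.*2.+1.
Local Notation rc := (real_complex R).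
Local Notation I := ('i%C : C).
Implicit Types (p q r : 'I_n) (b c : bool) (i j : 'I_N).

(** The directions of E_n, on which Omega takes the value 1. *)
Definition real_set : {set 'I_N} := [set ix p false | p : 'I_n]%SET.
Local Notation O := real_set.

Lemma ix_real p b : (ix p b \in O) = ~~ b.
Proof.
apply/imsetP/idP => [[q _ /eqP]|]; first by rewrite ix_eq => /andP[_ /eqP ->].
by case: b => // _; exists p.
Qed.

Lemma max_real : (ord_max \in O) = false.
Proof. by apply/negbTE/imsetP => -[q _ /eqP]; rewrite eq_sym ix_max. Qed.

Lemma card_real : #|O| = n.
Proof.
by rewrite card_imset ?card_ord // => p q /eqP; rewrite ix_eq andbT => /eqP.
Qed.

Lemma Omega_real : Omega_form R n O = 1.
Proof.
rewrite Omega_formE (wedges_det ord_max) ?card_real //.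
rewrite (_ : matrix_of_fun _ _ = 1%:M) ?det1 //; apply/matrixP => r c.
have -> : enum O = [seq ix p false | p <- enum 'I_n].
  apply/esym/pairwise_enum => [|i].
    rewrite pairwise_map; have := enum_pairwise [set: 'I_n]%SET.
    rewrite enum_setT -enumT; apply: sub_pairwise => p q.
    by rewrite /relpre /ltI /= !val_ix !add0n ltn_double.
  apply/mapP/imsetP => -[p _ ->]; exists p => //; exact: mem_enum.
rewrite [LHS]mxE [RHS]mxE (nth_map c) ?size_enum_ord // nth_ord_enum zc_ix eq_sym.
by case: (r == c).
Qed.

Lemma homogeneous_Omega : homogeneous n (Omega_form R n).
Proof.
have := @homogeneous_wedges C N [seq zc I p | p <- enum 'I_n].
by rewrite size_map size_enum_ord -map_comp -Omega_formE.
Qed.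

Lemma homogeneous_Re : homogeneous n (ReOmega_form R n).
Proof.
move=> S; rewrite ffunE => h; apply: homogeneous_Omega; apply: contraNneq h => ->.
by [].
Qed.

Lemma homogeneous_Im : homogeneous n (ImOmega_form R n).
Proof.
move=> S; rewrite ffunE => h; apply: homogeneous_Omega; apply: contraNneq h => ->.
by [].
Qed.

Lemma homogeneous_vec (v : 'cV[R]_N) : homogeneous 1 (ext_vec v).
Proof. by rewrite -wedge_ext1; apply/homogeneous_wedge/homogeneous_ext1. Qed.

Lemma homogeneous_F : homogeneous 2 (F_form R n).
Proof.
move=> S; rewrite F_formE sum_ffunE; apply: contraNeq => S2; apply/eqP/big1 => p _.
by apply: contraNeq S2 => /(homogeneous_wedge (@homogeneous_vec _)) ->.
Qed.

Lemma contr_Omega_im q :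
  contr (ix q true) (Omega_form R n) = I *: contr (ix q false) (Omega_form R n).
Proof.
rewrite Omega_formE (map_comp (@ext_vec _ _) (zc I)); apply: contr_wedges.
by move=> _ /mapP[p _ ->]; rewrite !zc_ix; case: (q == p); rewrite ?mulr1 ?mulr0.
Qed.

Lemma contr_Omega_max : contr ord_max (Omega_form R n) = 0.
Proof.
rewrite -[RHS](scale0r (contr ord_max (Omega_form R n))) Omega_formE.
rewrite (map_comp (@ext_vec _ _) (zc I)); apply: contr_wedges.
by move=> _ /mapP[p _ ->]; rewrite zc_max mul0r.
Qed.

Variables (A : set (ext R N)) (B : {set 'I_N}) (z : 'M[R]_N).
Hypothesis (zB : polar_annihilator A B z).

Section Alpha.
Hypothesis A_alpha : A (alpha_form R n).

Lemma ann_alpha i : i \in B -> z i ord_max = 0.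
Proof.
move=> iB; have := zB (S := [set i]%SET) A_alpha (ltn0Sn 0) (@homogeneous_vec _).
rewrite finset.sub1set cards1 => /(_ iB erefl).
by rewrite /alpha_form der0_vec ext_vec1 theta_max mulmx_theta mxE.
Qed.

End Alpha.

Section Kahler.
Hypothesis A_F : A (F_form R n).

(** The entry (i, j) of - z J, where J is the complex structure. *)
Definition zJ i j : R :=
  match dec j with
  | Some (q, c) => if c then z i (ix q false) else - z i (ix q true)
  | None => 0
  end.

Lemma contr_F i : contr i (F_form R n) =
  match dec i with
  | Some (p, b) => (-1) ^+ b *: ext_vec (theta (ix p (~~ b)).+1)
  | None => 0
  end.
Proof.
rewrite F_formE linear_sum /=.
have E q : contr i (wedge (ext_vec (theta (ix q false).+1 : 'cV[R]_N))
      (ext_vec (theta (ix q true).+1))) =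
    (i == ix q false)%:R *: ext_vec (theta (ix q true).+1) -
    (i == ix q true)%:R *: ext_vec (theta (ix q false).+1).
  by rewrite contr_wedge contr_vec !thetaE linearZ /= wedge_ext1.
rewrite (eq_bigr _ (fun q _ => E q)); case: (idxP i) => [p b|].
  rewrite dec_ix (bigD1 p) //= big1 => [|q qp]; last first.
    by rewrite !ix_eq [p == q]eq_sym (negbTE qp) !scale0r subr0.
  rewrite !ix_eq eqxx addr0; case: b; rewrite /= ?scale0r ?sub0r ?subr0 ?expr1 ?expr0 //.
  by rewrite scale1r scaleN1r.
by rewrite dec_max big1 // => q _; rewrite ![ord_max == _]eq_sym !ix_max !scale0r subr0.
Qed.

(** Since F is the form g(J _, _), D_z F is the skew part of z J. *)
Lemma contr2_der0_F i j :
  contr j (contr i (der0 z (F_form R n))) = (zJ i j - zJ j i) *: ext1 R N.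
Proof.
rewrite contr_der0 linearD /= addrC scalerBl; congr (_ + _).
  rewrite linear_sum /= sum_idx contr_F dec_max /= scaler0 linear0 addr0 /zJ.
  have E p b : contr j (z i (ix p b) *: contr (ix p b) (F_form R n)) =
     (z i (ix p b) * ((-1) ^+ b * (j == ix p (~~ b))%:R)) *: ext1 R N.
    by rewrite contr_F dec_ix /= !linearZ /= contr_vec thetaE !scalerA !mulrA.
  under eq_bigr do rewrite !E -scalerDl.
  rewrite -scaler_suml; congr (_ *: _); case: (idxP j) => [q c|].
    rewrite dec_ix (bigD1 q) //= big1 => [|p pq]; last first.
      by rewrite !ix_eq [q == p]eq_sym (negbTE pq) !mulr0 addr0.
    by rewrite !ix_eq eqxx; case: c; rewrite /= ?expr0 ?expr1; ring.
  by rewrite dec_max big1 // => p _; rewrite ![ord_max == _]eq_sym !ix_max !mulr0 addr0.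
rewrite contr_F /zJ; case: (idxP i) => [p b|]; last by rewrite dec_max /= !linear0 scale0r oppr0.
rewrite dec_ix /= !linearZ /= der0_vec contr_vec mulmx_theta mxE scalerA ?scalerN -scaleNr.
by congr (_ *: _); case: b; rewrite /= ?expr0 ?expr1; ring.
Qed.

Lemma contr2E i j (w : ext R N) : i != j ->
  w [set i; j]%SET = 0 -> contr j (contr i w) finset.set0 = 0.
Proof.
move=> ij w0; rewrite !contrE finset.in_set0 finset.setU0 !inE (negbTE ij).
by rewrite w0 !mulr0.
Qed.

Lemma ann_F i j : i \in B -> j \in B -> zJ i j = zJ j i.
Proof.
move=> iB jB; case: (eqVneq i j) => [->//|ij].
have := zB (S := [set i; j]%SET) A_F (ltn0Sn 1) homogeneous_F.
rewrite cards2 ij finset.subUset !finset.sub1set iB jB => /(_ isT erefl) /(contr2E ij).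
by rewrite contr2_der0_F scaleE ffunE eqxx mulr1 => /eqP; rewrite subr_eq0 => /eqP.
Qed.

End Kahler.

Section Volume.
Hypotheses (A_Re : A (ReOmega_form R n)) (A_Im : A (ImOmega_form R n)).
Hypothesis OB : O \subset B.
Hypothesis n_gt0 : (0 < n)%N.
Local Notation zC := (map_mx rc z).
Local Notation D := (der0 zC (Omega_form R n)).

Lemma der0_Omega0 (S : {set 'I_N}) : S \subset B -> #|S| = n -> D S = 0.
Proof.
move=> SB Sn; rewrite Omega_split complexify_der0 complexifyE.
by rewrite (zB A_Re n_gt0 homogeneous_Re SB Sn) (zB A_Im n_gt0 homogeneous_Im SB Sn).
Qed.

Local Notation T r := (O :\ ix r false)%SET.

(** The coefficients of D_z Omega used below are those on e_i and on the directions
    of E_n other than the r-th. *)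
Lemma contr_D r i : i \in B -> contr i D (T r) = 0.
Proof.
move=> iB; rewrite contrE; case: ifP => // iT; rewrite der0_Omega0 ?mulr0 //.
  by rewrite finset.subUset finset.sub1set iB (fintype.subset_trans (subD1set _ _) OB).
by rewrite cardsU1 iT /=; have := cardsD1 (ix r false) O; rewrite ix_real card_real => /esym.
Qed.

(** Contracting with e_(r,true) is contracting with e_(r,false) and multiplying by
    i, so row i of z meets Omega only through these combinations. *)
Definition zeta i r : C := (z i (ix r false))%:C%C + I * (z i (ix r true))%:C%C.

Lemma contr_Omega_T r : (-1) ^+ below (ix r false) O * contr (ix r false) (Omega_form R n) (T r) = 1.
Proof.
rewrite contrE finset.setD11 below_setD1id mulrA -exprD addnn -signr_odd odd_double expr0 mul1r.
by rewrite finset.setD1K ?ix_real // Omega_real.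
Qed.

Lemma sum_contr_Omega r i :
  (\sum_k zC i k *: contr k (Omega_form R n)) (T r) =
  zeta i r * contr (ix r false) (Omega_form R n) (T r).
Proof.
rewrite sum_ffunE sum_idx contr_Omega_max scaler0 ffunE addr0.
rewrite (bigD1 r) //= big1 => [|s sr]; rewrite !contr_Omega_im.
  by rewrite addr0 !scaleE /zeta !mxE; ring.
rewrite !scaleE [contr (ix s false) _ _]contrE !inE ix_real ix_eq (negbTE sr) /=.
by rewrite !mulr0 addr0.
Qed.

Lemma contr_der0_Omega r i :
  contr i D (T r) = der0 zC (contr i (Omega_form R n)) (T r) +
   zeta i r * contr (ix r false) (Omega_form R n) (T r).
Proof. by rewrite contr_der0 addE sum_contr_Omega. Qed.

Lemma contr_Omega_T_neq0 r : contr (ix r false) (Omega_form R n) (T r) != 0.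
Proof.
by apply: contra_eq_neq (contr_Omega_T r) => ->; rewrite mulr0 eq_sym oner_eq0.
Qed.

(** The vector e_(q,1) - i e_(q,0) annihilates Omega, so contracting D_z Omega
    with it leaves only the contraction with the image of that vector. *)
Lemma ann_Omega_im q r : ix q true \in B -> zeta (ix q true) r = I * zeta (ix q false) r.
Proof.
move=> qB; apply: (mulIf (contr_Omega_T_neq0 r)); apply/eqP; rewrite -subr_eq0 -mulrA.
have := contr_der0_Omega r (ix q true); rewrite contr_D // contr_Omega_im linearZ /= scaleE.
have := contr_der0_Omega r (ix q false); rewrite contr_D; last first.
  by rewrite (fintype.subsetP OB) // ix_real.
move=> e0 e1; apply/eqP; move/eqP: e0; rewrite eq_sym addr_eq0 => /eqP e0.
by rewrite {}e0 in e1; rewrite [RHS]e1; ring.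
Qed.

(** As for ann_Omega_im, with the vector e_N. *)
Lemma ann_Omega_max r : ord_max \in B -> zeta ord_max r = 0.
Proof.
move=> qB; apply: (mulIf (contr_Omega_T_neq0 r)); rewrite mul0r.
have := contr_der0_Omega r ord_max; rewrite contr_D // contr_Omega_max linear0 ffunE add0r.
by move=> <-.
Qed.

(** On E_n, where Omega is 1, D_z Omega is the complex trace of z. *)
Lemma ann_Omega_trace : \sum_r zeta (ix r false) r = 0.
Proof.
have := der0_Omega0 OB card_real; rewrite der0E exchange_big sum_ffunE sum_idx.
rewrite [X in _ + X](_ : _ = 0) ?addr0 => [e|]; last first.
  rewrite sum_ffunE big1 // => i _; rewrite scaleE wedge_thetaE max_real mulr0.
  by [].
apply: etrans e; apply: eq_bigr => r _; rewrite [X in _ = _ + X](_ : _ = 0) ?addr0; last first.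
  by rewrite sum_ffunE big1 // => i _; rewrite scaleE wedge_thetaE ix_real mulr0.
rewrite sum_ffunE.
transitivity ((-1) ^+ below (ix r false) O *
   (\sum_k zC (ix r false) k *: contr k (Omega_form R n)) (T r)).
  by rewrite sum_contr_Omega mulrCA contr_Omega_T mulr1.
rewrite sum_ffunE mulr_sumr. apply: eq_bigr => k _.
by rewrite !scaleE wedge_thetaE ix_real mulrCA.
Qed.

End Volume.
End Equations.

(** * The flag *)

Lemma span_theta (R : realType) (N : nat) (s : seq nat) (v : 'cV[R]_N) :
  v \in span [seq theta m | m <- s] <-> forall i : 'I_N, i.+1 \notin s -> v i 0 = 0.
Proof.
split=> [vs i im|hv].
  have [U UE] := @linear_set_vspace _ _ [set w : 'cV[R]_N | w i 0 = 0]
    ltac:(by rewrite /= mxE) ltac:(by move=> a x y /= hx hy; rewrite !mxE hx hy mulr0 addr0).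
  apply/UE; have /subvP : (span [seq theta m | m <- s] <= U)%VS; last exact.
  apply/span_subvP => _ /mapP[m ms ->]; apply/UE; rewrite /= mxE.
  by case: eqP im => // ->; rewrite ms.
rewrite (vec_thetaE v) memv_suml // => i _.
case: (boolP (i.+1 \in s)) => im; last by rewrite hv // scale0r mem0v.
by apply/memvZ/memv_span/map_f.
Qed.

Section Flag.
Variables (R : realType) (n : nat).
Hypothesis n_gt1 : (1 < n)%N.
Local Notation N := n.*2.+1.
Implicit Types (p q r : 'I_n) (b c : bool) (i j : 'I_N).

(** The step of the flag at which a basis vector enters. *)
Definition rank i : nat :=
  match dec i with
  | Some (p, b) => if b then if (p.+1 < n)%N then (n + p)%N else n.*2 else p
  | None => n.*2.-1
  end.

Lemma rank_ix p b : rank (ix p b) =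
  if b then if (p.+1 < n)%N then (n + p)%N else n.*2 else p.
Proof. by rewrite /rank dec_ix. Qed.

Lemma rank_max : rank ord_max = n.*2.-1.
Proof. by rewrite /rank dec_max. Qed.

Lemma rank_lt i : (rank i < N)%N.
Proof.
case: (idxP i) => [p b|]; rewrite ?rank_ix ?rank_max; last by lia.
by have := ltn_ord p; case: b => /=; try case: ifP; lia.
Qed.

Definition rk i : 'I_N := Ordinal (rank_lt i).

Lemma rk_inj : injective rk.
Proof.
move=> i j /(congr1 val) /=; case: (idxP i) => [p b|]; case: (idxP j) => [q c|]; rewrite ?rank_ix ?rank_max //.
- have := ltn_ord p; have := ltn_ord q; move=> hq hp e.
  apply/eqP; rewrite ix_eq; apply/andP; split; last by move: e; case: b; case: c => //=; try case: ifP; lia.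
  by rewrite -val_eqE /=; move: e; case: b; case: c => /=; do 2?case: ifP; lia.
- by have := ltn_ord p; case: b => /=; try case: ifP; lia.
- by have := ltn_ord q; case: c => /=; try case: ifP; lia.
Qed.

Definition stage (k : nat) : {set 'I_N} := [set i | (rk i < k)%N]%SET.

Lemma mem_stage k i : (i \in stage k) = (rank i < k)%N.
Proof. by rewrite inE. Qed.

Lemma flagE_span k : (k <= n.*2)%N -> exists2 s : seq nat,
  flagE R n k = span [seq theta m | m <- s] & forall i, (i.+1 \in s) = (rank i < k)%N.
Proof.
have odds m i : (i.+1 \in [seq l.*2.-1 | l <- iota 1 m]) =
    match dec i with Some (p, b) => ~~ b && (p < m)%N | None => (n < m)%N end.
  apply/mapP/idP => [[l]|].
    rewrite mem_iota add1n ltnS => /andP[l0 lm]; case: (idxP i) => [p b|] e.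
      by rewrite dec_ix; move: e; rewrite val_ix; case: b => /=; lia.
    by rewrite dec_max; move: e => /=; lia.
  case: (idxP i) => [p b|]; rewrite ?dec_ix ?dec_max => h.
    exists p.+1; first by rewrite mem_iota; lia.
    by move: h; rewrite val_ix; case: b => //=; lia.
  by exists n.+1; [rewrite mem_iota; lia|rewrite /=; lia].
have evens m i : (i.+1 \in [seq l.*2 | l <- iota 1 m]) =
    match dec i with Some (p, b) => b && (p < m)%N | None => false end.
  apply/mapP/idP => [[l]|].
    rewrite mem_iota add1n ltnS => /andP[l0 lm]; case: (idxP i) => [p b|] e.
      by rewrite dec_ix; move: e; rewrite val_ix; case: b => /=; lia.
    by move: e => /=; lia.
  case: (idxP i) => [p b|]; rewrite ?dec_ix ?dec_max => h //.
  exists p.+1; first by rewrite mem_iota; lia.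
  by move: h; rewrite val_ix; case: b => //=; lia.
have comp (f : nat -> nat) m : [seq theta (f l) : 'cV[R]_N | l <- iota 1 m] =
    [seq theta m' | m' <- [seq f l | l <- iota 1 m]].
  by rewrite -map_comp.
move=> kN; rewrite /flagE; case: (leqP k n) => kn.
  exists [seq l.*2.-1 | l <- iota 1 k]; first by rewrite -map_comp.
  move=> i; rewrite odds /rank; case: (dec i) => [[p b]|]; last by lia.
  by have := ltn_ord p; case: b => //=; case: ifP; lia.
case: (ltnP k n.*2) => kn2.
  exists ([seq l.*2.-1 | l <- iota 1 n] ++ [seq l.*2 | l <- iota 1 (k - n)]).
    by rewrite map_cat span_cat -!map_comp.
  move=> i; rewrite mem_cat odds evens /rank; case: (dec i) => [[p b]|]; last by lia.
  by have := ltn_ord p; case: b => //=; rewrite ?orbF; [case: ifP|]; lia.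
have -> : k = n.*2 by lia.
rewrite eqxx; exists ([seq l.*2.-1 | l <- iota 1 n] ++ [seq l.*2 | l <- iota 1 n.-1] ++ [:: N]).
  by rewrite !map_cat !span_cat -!map_comp /= span_seq1 addvA.
move=> i; rewrite !mem_cat odds evens inE; case: (idxP i) => [p b|].
  rewrite dec_ix rank_ix val_ix; have := ltn_ord p; case: b => /=; try case: ifP; lia.
by rewrite dec_max rank_max /=; lia.
Qed.

Lemma flagE_mem k v : (k <= N)%N ->
  v \in flagE R n k <-> forall i, i \notin stage k -> v i 0 = 0.
Proof.
rewrite leq_eqVlt => /orP[/eqP ->|].
  rewrite /flagE [(N <= n)%N]leqNgt [(n < N)%N](_ : _ = true) /=; last by lia.
  rewrite [(N < n.*2)%N](_ : _ = false); last by lia.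
  rewrite [N == n.*2](_ : _ = false); last by lia.
  by rewrite memvf; split=> // _ i; rewrite mem_stage rank_lt.
rewrite ltnS => /flagE_span[s -> hs]; apply: (iff_trans (span_theta s v)).
by split=> h i hi; apply: h; move: hi; rewrite ?hs mem_stage.
Qed.

Lemma flagE_complete : complete_flag (flagE R n).
Proof.
split=> [k kN|]; last first.
  apply/vspaceP => v; rewrite memvf; apply/flagE_mem => // i.
  by rewrite mem_stage rank_lt.
split.
  apply/subvP => v /(flagE_mem v (ltnW kN)) h; apply/(flagE_mem v kN) => i hi.
  by apply: h; apply: contraNN hi; rewrite !mem_stage => /leqW.
have [f _ fK] := injF_bij rk_inj; pose m := f (Ordinal kN).
have rm : rank m = k by have := congr1 val (fK (Ordinal kN)).
apply/eqP => e; have : theta m.+1 \in flagE R n k.+1.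
  apply/(flagE_mem _ kN) => i; rewrite mem_stage thetaE; case: eqP => // ->.
  by rewrite rm ltnSn.
rewrite -e => /(flagE_mem _ (ltnW kN))/(_ m); rewrite mem_stage rm ltnn thetaE eqxx.
by move=> /(_ isT)/eqP; rewrite oner_eq0.
Qed.

End Flag.

(** * The entries determined by the equations *)

Section Pivots.
Variables (R : realType) (n : nat).
Hypothesis n_gt1 : (1 < n)%N.
Local Notation N := n.*2.+1.
Implicit Types (p q r : 'I_n) (b c : bool) (i j : 'I_N).
Variable A : set (ext R N).
Hypotheses (A_alpha : A (alpha_form R n)) (A_F : A (F_form R n))
  (A_Re : A (ReOmega_form R n)) (A_Im : A (ImOmega_form R n)).

(** The number of complex lines contained in the k-th space of the flag. *)
Definition lines (k : nat) : nat := minn (k - n) n.-1.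

(** The matrix entries that the equations at step k express through the others:
    the last column on E_k by alpha; half of the entries of two symmetric systems by
    F, the second of which becomes skew, and so includes its diagonal, once the
    equations of Omega are used; the rows of the vectors i e_p and of e_N by Omega;
    and one entry for each of the real and imaginary parts of the trace. *)
Definition pivot (k : nat) i j : bool :=
  match dec i, dec j with
  | Some (p, false), None => (p < k)%N
  | Some (p, false), Some (q, true) =>
      (p < q < k)%N || [&& (n <= k)%N, p == n.-1 :> nat & q == n.-1 :> nat]
  | Some (p, false), Some (q, false) =>
      (q <= p)%N && (q < lines k)%N ||
      [&& (n <= k)%N, p == n.-1 :> nat & q == n.-1 :> nat]
  | Some (p, true), _ => (p < lines k)%N
  | None, _ => k == n.*2
  end.

Lemma stage_real k p : (ix p false \in stage n_gt1 k) = (p < k)%N.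
Proof. by rewrite mem_stage rank_ix. Qed.

Lemma stage_im k p : (k <= n.*2)%N ->
  (ix p true \in stage n_gt1 k) = (p < lines k)%N.
Proof.
rewrite mem_stage rank_ix /lines => kn; have := ltn_ord p; case: ifP; lia.
Qed.

Lemma stage_max k : (k <= n.*2)%N -> (ord_max \in stage n_gt1 k) = (k == n.*2).
Proof. by rewrite mem_stage rank_max => kn; lia. Qed.

Variables (k : nat) (z : 'M[R]_N).
Hypotheses (k_le : (k <= n.*2)%N)
  (zk : polar_annihilator A (stage n_gt1 k) z)
  (zP : forall i j, ~~ pivot k i j -> z i j = 0).
Local Notation B := (stage n_gt1 k).

Lemma Re_zeta i r : complex.Re (zeta z i r) = z i (ix r false).
Proof. by rewrite /zeta ReD ReM /=; ring. Qed.

Lemma Im_zeta i r : complex.Im (zeta z i r) = z i (ix r true).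
Proof. by rewrite /zeta ImD ImM /=; ring. Qed.

Lemma zeta0 i r : zeta z i r = 0 -> z i (ix r false) = 0 /\ z i (ix r true) = 0.
Proof.
by move=> e; rewrite -Re_zeta -Im_zeta e.
Qed.

Lemma pivot_col_max i : z i ord_max = 0.
Proof.
case: (boolP (i \in B)) => iB; first exact: (ann_alpha zk).
apply: zP; case: (idxP i) iB => [p b|]; rewrite /pivot ?dec_ix ?dec_max.
  by case: b; rewrite ?stage_real ?stage_im.
by rewrite stage_max.
Qed.

Lemma pivot_real_im p q : (p < k)%N -> (q < k)%N -> z (ix p false) (ix q true) = z (ix q false) (ix p true).
Proof.
move=> pk qk; have := ann_F zk A_F (i := ix p false) (j := ix q false).
rewrite !stage_real pk qk => /(_ isT isT); rewrite /zJ !dec_ix.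
by lra.
Qed.

Lemma pivot_zero_small : (k < n)%N -> z = 0.
Proof.
move=> kn; have l0 : lines k = 0%N by rewrite /lines; lia.
apply/matrixP => i j; rewrite [RHS]mxE; case: (boolP (pivot k i j)) => [|/zP //].
rewrite /pivot; case: (idxP i) => [p b|]; rewrite ?dec_ix ?dec_max; last by lia.
case: (idxP j) => [q c|]; rewrite ?dec_ix ?dec_max; last by rewrite pivot_col_max.
case: b => //=; rewrite ?l0 ?ltn0 //.
have kn' : (n <= k)%N = false by lia.
case: c => /=; rewrite kn' ?ltn0 ?andbF ?orbF //= => /andP[pq qk].
rewrite pivot_real_im //; last by lia.
by apply: zP; rewrite /pivot !dec_ix; lia.
Qed.

Section Large.
Hypothesis kn : (n <= k)%N.

Lemma pivot_real_sub : real_set n \subset B.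
Proof.
apply/fintype.subsetP => i; case: (idxP i) => [p b|]; last by rewrite max_real.
by rewrite ix_real => /negbTE ->; rewrite stage_real; have := ltn_ord p; lia.
Qed.

Let n_gt0 : (0 < n)%N. Proof. by lia. Qed.

Lemma pivot_row_max j : z ord_max j = 0.
Proof.
case: (boolP (ord_max \in B)) => iB; last first.
  by apply: zP; rewrite /pivot dec_max -stage_max.
case: (idxP j) => [r c|]; last exact: pivot_col_max.
have := ann_Omega_max zk A_Re A_Im pivot_real_sub n_gt0 r iB.
by case/zeta0; case: c.
Qed.

Lemma pivot_row_im q r : (q < lines k)%N ->
  z (ix q true) (ix r false) = - z (ix q false) (ix r true) /\
  z (ix q true) (ix r true) = z (ix q false) (ix r false).
Proof.
move=> ql; have := ann_Omega_im zk A_Re A_Im pivot_real_sub n_gt0 (q := q) r.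
rewrite stage_im // => /(_ ql) e.
rewrite -!Re_zeta -!Im_zeta e ReM ImM /=; split; ring.
Qed.

Lemma pivot_trace : \sum_r z (ix r false) (ix r false) = 0 /\
  \sum_r z (ix r false) (ix r true) = 0.
Proof.
have e := ann_Omega_trace zk A_Re A_Im pivot_real_sub n_gt0.
split.
  rewrite -[RHS]/(complex.Re (0 : R[i])) -e.
  by elim/big_rec2: _ => // r x y _ ->; rewrite ReD Re_zeta.
rewrite -[RHS]/(complex.Im (0 : R[i])) -e.
by elim/big_rec2: _ => // r x y _ ->; rewrite ImD Im_zeta.
Qed.

Let lt_k p : (p < k)%N. Proof. by have := ltn_ord p; lia. Qed.

(** Symmetry leaves the diagonal, where all entries but the last are not pivots; the
    imaginary part of the trace gives the last one. *)
Lemma pivot_real_im0 p q : z (ix p false) (ix q true) = 0.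
Proof.
have off (p' q' : 'I_n) : ~~ ((p' == q') && (p' == n.-1 :> nat)) -> z (ix p' false) (ix q' true) = 0.
  move=> h; case: (ltnP p' q') => pq.
    rewrite pivot_real_im //; apply: zP; rewrite /pivot !dec_ix.
    by move: h; rewrite -val_eqE /=; lia.
  by apply: zP; rewrite /pivot !dec_ix; move: h; rewrite -val_eqE /=; lia.
case: (boolP ((p == q) && (p == n.-1 :> nat))) => [/andP[/eqP <- pn]|/off //].
have [_] := pivot_trace; rewrite (bigD1 p) //= big1 ?addr0 // => r rp.
by apply: off; rewrite eqxx; move: rp pn; rewrite -val_eqE /=; lia.
Qed.

(** Here F and Omega together give skew-symmetry, and the real part of the trace
    gives the last diagonal entry. *)
Lemma pivot_real_real0 p q : z (ix p false) (ix q false) = 0.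
Proof.
have skew' (p' q' : 'I_n) : (q' < lines k)%N ->
    z (ix p' false) (ix q' false) = - z (ix q' false) (ix p' false).
  move=> ql; have := ann_F zk A_F (i := ix p' false) (j := ix q' true).
  rewrite stage_real stage_im // ql lt_k => /(_ isT isT).
  by rewrite /zJ !dec_ix (pivot_row_im _ ql).2.
have off (p' q' : 'I_n) : ~~ ((p' == q') && (p' == n.-1 :> nat)) -> z (ix p' false) (ix q' false) = 0.
  move=> h; case: (boolP (pivot k (ix p' false) (ix q' false))) => [|/zP //].
  rewrite /pivot !dec_ix => /orP[/andP[qp ql]|]; last first.
    by move=> /and3P[_ /eqP pn /eqP qn]; move: h; rewrite -val_eqE /= pn qn !eqxx.
  have := skew' p' q' ql; case: (eqVneq p' q') => [->|pq]; first by lra.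
  move=> ->; apply/eqP; rewrite oppr_eq0; apply/eqP/zP; rewrite /pivot !dec_ix.
  by move: h pq; rewrite -val_eqE /=; lia.
case: (boolP ((p == q) && (p == n.-1 :> nat))) => [/andP[/eqP <- pn]|/off //].
have [+ _] := pivot_trace; rewrite (bigD1 p) //= big1 ?addr0 // => r rp.
by apply: off; rewrite eqxx; move: rp pn; rewrite -val_eqE /=; lia.
Qed.

Lemma pivot_zero_large : z = 0.
Proof.
apply/matrixP => i j; rewrite [RHS]mxE.
case: (idxP j) => [q c|]; last exact: pivot_col_max.
case: (idxP i) => [p b|]; last exact: pivot_row_max.
case: b; last by case: c; rewrite ?pivot_real_im0 ?pivot_real_real0.
case: (ltnP p (lines k)) => pl; last by apply: zP; rewrite /pivot !dec_ix -leqNgt.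
have [h1 h2] := pivot_row_im q pl.
by case: c; rewrite ?h1 ?h2 ?pivot_real_im0 ?pivot_real_real0 ?oppr0.
Qed.

End Large.

(** Hence the annihilator of the polar functionals injects into the matrices of
    entries outside the pivots. *)
Lemma pivot_zero : z = 0.
Proof. by case: (ltnP k n) => [/pivot_zero_small|/pivot_zero_large]. Qed.

End Pivots.

(** * Counting pivots *)

Section Counting.
Local Open Scope nat_scope.

Lemma sum_lt n m : m <= n -> \sum_(p < n) (p < m : nat) = m.
Proof.
move=> mn; rewrite -[RHS](card_ord m) -sum1_card (big_ord_widen n (fun=> 1)) //.
by rewrite [RHS]big_mkcond; apply: eq_bigr => p _; case: ifP.
Qed.

Lemma sum_lt_mul n m (f : nat -> nat) : m <= n ->
  \sum_(q < n) (q < m) * f q = \sum_(q < m) f q.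
Proof.
move=> mn; rewrite (big_ord_widen n f mn) [RHS]big_mkcond; apply: eq_bigr => p _.
by case: ifP; rewrite ?mul1n.
Qed.

Lemma sum_eq_pred n : 0 < n -> \sum_(p < n) (p == n.-1 :> nat : nat) = 1.
Proof.
move=> n0; have pn : n.-1 < n by lia.
rewrite (bigD1 (Ordinal pn)) //= eqxx big1 // => q.
by rewrite -val_eqE /= => /negbTE ->.
Qed.

Lemma sum_le n q : q < n -> \sum_(p < n) (q <= p : nat) = n - q.
Proof.
move=> qn; have := sum_lt (ltnW qn).
suff : \sum_(p < n) (p < q : nat) + \sum_(p < n) (q <= p : nat) = n by lia.
rewrite -big_split /= (eq_bigr (fun=> 1)) ?sum1_card ?card_ord // => p _.
by case: ltnP.
Qed.

Lemma if_orb (a b : bool) : ~~ (a && b) -> (if a || b then 1 else 0) = a + b.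
Proof. by case: a; case: b. Qed.

Lemma sum_id m : (\sum_(q < m) q) * 2 + m = m * m.
Proof.
elim: m => [|m IH]; rewrite ?big_ord0 // big_ord_recr /=.
by move: (\sum_(q < m) q) IH => S IH; nia.
Qed.

Lemma sum_sub n m : m <= n -> \sum_(q < m) (n - q) + \sum_(q < m) q = m * n.
Proof.
elim: m => [|m IH] mn; rewrite ?big_ord0 // !big_ord_recr /=; have := IH (ltnW mn).
by move: (\sum_(q < m) q) (\sum_(q < m) _) => S T; nia.
Qed.

End Counting.

Section PivotCount.
Variables (R : realType) (n : nat).
Hypothesis n_gt1 : (1 < n)%N.
Local Notation N := n.*2.+1.
Local Open Scope nat_scope.
Implicit Types (p q r : 'I_n) (b c : bool) (i j : 'I_N).

Definition pivot_set (k : nat) : {set 'I_N * 'I_N} := [set x | pivot k x.1 x.2]%SET.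

(** In order, the terms count the pivots of the skew system, of the trace, of the
    symmetric system, of alpha, and in the rows of the vectors i e_p and e_N. *)
Lemma card_pivot k : #|pivot_set k| =
  \sum_(q < lines n k) (n - q) + 2 * (n <= k) + \sum_(q < minn k n) q + minn k n
  + N * lines n k + N * (k == n.*2).
Proof.
have l_le : lines n k <= n by rewrite /lines; lia.
rewrite -sum1_card (eq_bigl (fun x => pivot k x.1 x.2)) => [|x]; last by rewrite inE.
rewrite big_mkcond /= -(pair_bigA _ (fun i j : 'I_N => if pivot k i j then 1 else 0)) /=.
have Nsum c : \sum_(j < N) c = N * c by rewrite sum_nat_const card_ord.
rewrite big_idx /= [X in _ + X](eq_bigr (fun=> (k == n.*2 : nat))) => [|j _]; last first.
  by rewrite /pivot dec_max; case: eqP.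
rewrite Nsum; congr (_ + _).
rewrite big_split /= [X in _ + X](eq_bigr (fun p : 'I_n => N * (p < lines n k))) => [|p _]; last first.
  by rewrite -Nsum; apply: eq_bigr => j _; rewrite /pivot dec_ix; case: ifP.
rewrite -big_distrr /= sum_lt //; congr (_ + _).
pose e p q : nat := [&& n <= k, p == n.-1 :> nat & q == n.-1 :> nat].
pose f p q : nat := (q <= p) && (q < lines n k).
pose g p q : nat := p < q < k.
rewrite (eq_bigr (fun p => \sum_(q < n) (f p q + e p q + (g p q + e p q)) + (p < minn k n))) => [|p _]; last first.
  rewrite big_idx /=; congr (_ + _); last first.
    by rewrite /pivot dec_ix dec_max /= leq_min ltn_ord andbT; case: (p < k).
  apply: eq_bigr => q _; rewrite /pivot !dec_ix /f /e /g; congr (_ + _).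
    by apply: if_orb; rewrite /lines; lia.
  by apply: if_orb; lia.
rewrite big_split /= sum_lt ?geq_minr //; congr (_ + _).
have eS : \sum_(p < n) \sum_(q < n) e p q = (n <= k).
  rewrite (eq_bigr (fun p : 'I_n => (n <= k) * ((p : nat) == n.-1))) => [|p _].
    by rewrite -big_distrr /= sum_eq_pred ?muln1 //; lia.
  rewrite (eq_bigr (fun q : 'I_n => (n <= k) * ((p : nat) == n.-1) * ((q : nat) == n.-1))) => [|q _].
    by rewrite -big_distrr /= sum_eq_pred ?muln1 //; lia.
  by rewrite /e; do 3!case: eqP => _ || case: leqP => _.
have fS : \sum_(p < n) \sum_(q < n) f p q = \sum_(q < lines n k) (n - q).
  rewrite exchange_big /= -(sum_lt_mul (fun m => n - m) l_le); apply: eq_bigr => q _.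
  rewrite (eq_bigr (fun p : 'I_n => (q < lines n k) * (q <= p))) => [|p _].
    by rewrite -big_distrr /= sum_le.
  by rewrite /f andbC; case: (q < _); case: (q <= _).
have gS : \sum_(p < n) \sum_(q < n) g p q = \sum_(q < minn k n) q.
  rewrite exchange_big /= -(@sum_lt_mul n _ (fun m => m) (geq_minr k n)); apply: eq_bigr => q _.
  rewrite (eq_bigr (fun p : 'I_n => (q < minn k n) * (p < q))) => [|p _].
    by rewrite -big_distrr /= sum_lt // ltnW.
  by rewrite /g leq_min ltn_ord andbT andbC; case: (q < k); case: (p < q).
rewrite (eq_bigr (fun p => \sum_(q < n) f p q + \sum_(q < n) e p q +
    (\sum_(q < n) g p q + \sum_(q < n) e p q))) => [|p _]; last by rewrite !big_split.
by rewrite !big_split /= fS eS gS mul2n -addnn addnACA addnAC.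
Qed.

Lemma sum_stages (c : nat -> nat) :
  (forall k : 'I_n, c k = \sum_(q < k) q + k) ->
  (forall m, m <= n -> c (n + m) = \sum_(q < minn m n.-1) (n - q) + 2 +
    \sum_(q < n) q + n + N * minn m n.-1 + N * (m == n)) ->
  \sum_(k < N) c k = N * (n * n + n + 1).
Proof.
move=> small large.
rewrite big_ord_recr /=.
have -> : \sum_(k < n.*2) c k = \sum_(k < n) c k + \sum_(k < n) c (n + k).
  by rewrite -addnn big_split_ord.
rewrite (eq_bigr _ (fun k _ => small k)) -[n.*2]addnn (large n) // eqxx.
rewrite [\sum_(k < n) c _](eq_bigr (fun k : 'I_n => \sum_(q < k) (n - q) + 2 + \sum_(q < n) q + n + N * k)) => [|k _]; last first.
  have kn := ltn_ord k; rewrite large; last exact: ltnW.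
  rewrite (_ : minn k n.-1 = k); last by lia.
  by rewrite (_ : (k == n :> nat) = false) ?muln0 ?addn0 //; lia.
have E m : m <= n -> (\sum_(k < m) \sum_(q < k) q) * 6 + 3 * m * m = m * m * m + 2 * m.
  elim: m => [|m IH] mn; first by rewrite big_ord0.
  rewrite big_ord_recr /=; have := sum_id m; have := IH (ltnW mn).
  by move: (\sum_(q < m) q) (\sum_(k < m) _) => S T; nia.
have F m : m <= n -> \sum_(k < m) \sum_(q < k) (n - q) + \sum_(k < m) \sum_(q < k) q = n * (\sum_(k < m) k).
  elim: m => [|m IH] mn; first by rewrite !big_ord0 muln0.
  rewrite !big_ord_recr /=; have := sum_sub (ltnW mn); have := IH (ltnW mn).
  move: (\sum_(q < m) q) (\sum_(q < m) (n - q)) (\sum_(k < m) _) (\sum_(k < m) _) => S T U V; nia.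
rewrite !big_split /= !sum_nat_const !card_ord -!big_distrr /=.
have := sum_id n; have := E n (leqnn n); have := F n (leqnn n).
have -> : minn n n.-1 = n.-1 by lia.
have := sum_id n.-1; have := sum_sub (leq_pred n).
move: (\sum_(k < n) \sum_(q < k) (n - q)) (\sum_(k < n) \sum_(q < k) q) (\sum_(q < n) q)
  (\sum_(q < n.-1) q) (\sum_(q < n.-1) (n - q)) => x1 x2 x3 x4 x5.
case: n n_gt1 => // m _ /= h1 h2 h3 h4 h5.
have h6 : m * (x3 * 2 + m.+1) = m * (m.+1 * m.+1) by rewrite h5.
clear small large E F; nia.
Qed.

(** The total N (n^2 + n + 1) is the codimension in gl(T) (x) T of
    (su(n) (x) T) + (T (x) S^2 T). *)
Lemma sum_card_pivot : \sum_(k < N) #|pivot_set k| = N * (n * n + n + 1).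
Proof.
have small (k : 'I_n) : #|pivot_set k| = \sum_(q < k) q + k.
  rewrite card_pivot (_ : lines n k = 0); last by rewrite /lines; have := ltn_ord k; lia.
  rewrite big_ord0 (_ : minn k n = k); last by have := ltn_ord k; lia.
  have -> : (n <= k) = false by have := ltn_ord k; lia.
  have -> : (k == n.*2 :> nat) = false by have := ltn_ord k; lia.
  by rewrite !muln0 !addn0 !add0n.
have large m : m <= n -> #|pivot_set (n + m)| = \sum_(q < minn m n.-1) (n - q) + 2 +
    \sum_(q < n) q + n + N * minn m n.-1 + N * (m == n).
  move=> mn; rewrite card_pivot.
  rewrite (_ : lines n (n + m) = minn m n.-1); last by rewrite /lines; lia.
  rewrite (_ : minn (n + m) n = n); last by lia.
  by rewrite leq_addr muln1 (_ : (n + m == n.*2) = (m == n)) //; lia.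
exact: (@sum_stages (fun k => #|pivot_set k|) small large).
Qed.

End PivotCount.

(** * Differentiating families of forms *)

Section Derivatives.
Variables (R : realType) (N : nat) (V : normedModType R).
Implicit Types (x v : V) (b : ext R N).

Lemma is_derive_big (J : Type) (s : seq J) (P : pred J) (h : J -> V -> R^o)
    (dh : J -> R^o) x v :
  (forall j, is_derive x v (h j) (dh j)) ->
  is_derive x v (fun y => \sum_(j <- s | P j) h j y : R^o) (\sum_(j <- s | P j) dh j).
Proof.
move=> hd; elim: s => [|j s IH].
  rewrite big_nil; under eq_fun do rewrite big_nil.
  exact: is_derive_cst.
rewrite big_cons; under eq_fun do rewrite big_cons.
by case: ifP => _ //; exact: is_deriveD.
Qed.

Lemma is_derive_mul (f g : V -> R^o) (df dg : R^o) x v :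
  is_derive x v f df -> is_derive x v g dg ->
  is_derive x v (fun y => f y * g y : R^o) (df * g x + f x * dg).
Proof.
move=> hf hg; have := is_deriveM hf hg.
by rewrite addrC -![_ *: _]/(_ * _) [g x * df]mulrC.
Qed.

Lemma is_derive_mulc (k : R) (f : V -> R^o) (df : R^o) x v :
  is_derive x v f df -> is_derive x v (fun y => k * f y : R^o) (k * df).
Proof. exact: is_deriveZ. Qed.

Definition mx_derive m p (M : V -> 'M[R]_(m, p)) (dM : 'M[R]_(m, p)) x v :=
  forall i j, is_derive x v (fun y => M y i j : R^o) (dM i j : R^o).

Lemma mx_deriveM m p q (M : V -> 'M[R]_(m, p)) (M' : V -> 'M[R]_(p, q)) dM dM' x v :
  mx_derive M dM x v -> mx_derive M' dM' x v ->
  mx_derive (fun y => M y *m M' y) (dM *m M' x + M x *m dM') x v.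
Proof.
move=> hM hM' i j; rewrite mxE.
under eq_fun do rewrite mxE.
rewrite !mxE -big_split; apply: is_derive_big => k.
exact: is_derive_mul.
Qed.

Lemma mx_derive_cst m p (M : 'M[R]_(m, p)) x v : mx_derive (fun _ => M) 0 x v.
Proof. by move=> i j; rewrite mxE; exact: is_derive_cst. Qed.

Lemma mx_derive_trmx m p (M : V -> 'M[R]_(m, p)) dM x v :
  mx_derive M dM x v -> mx_derive (fun y => (M y)^T) dM^T x v.
Proof. by move=> h i j; rewrite mxE; under eq_fun do rewrite mxE; exact: h. Qed.

Lemma mx_derive_unique m p (M : V -> 'M[R]_(m, p)) dM dM' x v :
  mx_derive M dM x v -> mx_derive M dM' x v -> dM = dM'.
Proof.
by move=> h h'; apply/matrixP => i j; case: (h i j) => _ <-; case: (h' i j) => _ <-.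
Qed.

Definition ext_derive (w : V -> ext R N) (dw : ext R N) x v :=
  forall S, is_derive x v (fun y => w y S : R^o) (dw S).

Lemma ext_derive_cst b x v : ext_derive (fun _ => b) 0 x v.
Proof. by move=> S; rewrite ffunE; exact: is_derive_cst. Qed.

Lemma ext_derive_wedge (u : V -> 'cV[R]_N) du w dw x v :
  mx_derive u du x v -> ext_derive w dw x v ->
  ext_derive (fun y => wedge (ext_vec (u y)) (w y))
    (wedge (ext_vec du) (w x) + wedge (ext_vec (u x)) dw) x v.
Proof.
move=> hu hw S; rewrite addE !wedge_vecE -big_split.
under eq_fun do rewrite wedge_vecE.
apply: is_derive_big => i; apply: is_derive_mul => //.
exact: is_derive_mulc.
Qed.

Lemma ext_derive_wedges (h : V -> 'M[R]_N) dh (s : seq 'I_N) x v :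
  mx_derive h dh x v -> h x = 1%:M ->
  ext_derive (fun y => wedges [seq ext_vec (col i (h y)) | i <- s])
    (leibniz 1 (fun i => ext_vec (dh *m theta i.+1)) s) x v.
Proof.
move=> hh h1; elim: s => [|i s IH] /=; first exact: ext_derive_cst.
have hcol j : mx_derive (fun y => col j (h y)) (col j dh) x v.
  by move=> k l; rewrite mxE; under eq_fun do rewrite mxE; exact: hh.
have := ext_derive_wedge (hcol i) IH; rewrite scale1r h1 mulmx_theta.
rewrite -[col i 1%:M]mulmx_theta mul1mx (_ : [seq ext_vec (col j 1%:M) | j <- s] =
  [seq ext_vec (theta j.+1) | j : 'I_N <- s]) //.
by apply: eq_map => j; rewrite -mulmx_theta mul1mx.
Qed.

(** At the identity, the action of the general linear group differentiates to
    the derivation der0. *)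
Lemma ext_derive_act (h : V -> 'M[R]_N) dh b x v :
  mx_derive h dh x v -> h x = 1%:M ->
  ext_derive (fun y => ext_act (h y) b) (der0 dh b) x v.
Proof.
move=> hh h1 S; rewrite /der0 /ext_lift sum_ffunE.
under eq_fun do rewrite /ext_act /ext_lift sum_ffunE.
apply: is_derive_big => A; rewrite ffunE.
under eq_fun do rewrite ffunE.
by apply: is_derive_mulc; exact: ext_derive_wedges.
Qed.

Lemma ext_derive_unique (w : V -> ext R N) dw dw' x v :
  ext_derive w dw x v -> ext_derive w dw' x v -> dw = dw'.
Proof.
by move=> h h'; apply/ffunP => S; case: (h S) => _ <-; case: (h' S) => _ <-.
Qed.

End Derivatives.

(** * The Lie algebra of a group of orthogonal matrices *)

Section LieAlgebra.
Variables (R : realType) (N : nat) (G : set 'M[R]_N).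

Lemma lie_algebraP X : lie_algebra G X <-> exists c : R -> 'M[R]_N,
  [/\ c 0 = 1%:M, forall t, G (c t), forall t i j, derivable (fun t => c t i j : R^o) t 1
    & mx_derive c X (0 : R^o) 1].
Proof.
split=> -[c [c0 cG cd cX]]; exists c; split=> //.
- by move=> t; apply/derivable_mxP.
- move=> i j; apply: DeriveDef; first by have /derivable_mxP := cd 0; apply.
  by rewrite -cX derive_mx // mxE.
- by move=> t; apply/derivable_mxP => i j; exact: cd.
- rewrite derive_mx; last by apply/derivable_mxP => i j; exact: cd.
  by apply/matrixP => i j; rewrite mxE; case: (cX i j).
Qed.

Hypothesis GG : orthogonal_subgroup G.

Lemma lie_algebra0 : lie_algebra G 0.
Proof.
case: GG => G1 _ _ _; apply/lie_algebraP; exists (fun=> 1%:M); split=> //.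
exact: mx_derive_cst.
Qed.

(** The curve t |-> c (k t) d t. *)
Lemma lie_algebra_lin k X Y : lie_algebra G X -> lie_algebra G Y ->
  lie_algebra G (k *: X + Y).
Proof.
case: GG => _ GM _ _.
move=> /lie_algebraP[c [c0 cG cd cX]] /lie_algebraP[d [d0 dG dd dY]].
apply/lie_algebraP; exists (fun t => c (k * t) *m d t).
have ck t i j (dc : R) : is_derive (k * t : R) (1 : R) (fun t => c t i j) dc ->
    is_derive (t : R) (1 : R) (fun t => c (k * t) i j) (dc * k).
  move=> h; have := @is_derive1_comp R (fun t => c t i j) ( *%R k) t dc k h.
  apply; have := is_derive_mulc k (is_derive_id (t : R^o) (1 : R^o)).
  by rewrite -[1 : R^o]/(1 : R) mulr1.
split=> [|t|t i j|].
- by rewrite mulr0 c0 d0 mulmx1.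
- exact: GM.
- under eq_fun do rewrite mxE.
  have := is_derive_big (index_enum 'I_N) xpredT (x := t : R^o) (v := 1) (fun l =>
    is_derive_mul (ck t i l _ (derivableP (cd (k * t) i l))) (derivableP (dd t l j))).
  by case.
- have := @mx_deriveM R R^o _ _ _ (fun t => c (k * t)) d (k *: X) Y 0 1.
  rewrite mulr0 c0 d0 mulmx1 mul1mx; apply=> // i j.
  by rewrite mxE mulrC; apply: ck; rewrite mulr0; exact: cX.
Qed.

Lemma lie_algebra_vspace :
  exists U : {vspace 'M[R]_N}, forall X, X \in U <-> lie_algebra G X.
Proof.
apply: (linear_set_vspace (V := lie_algebra G)); first exact: lie_algebra0.
exact: lie_algebra_lin.
Qed.

Lemma lie_algebra_skew X : lie_algebra G X -> X^T = - X.
Proof.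
case: GG => _ _ _ GT /lie_algebraP[c [c0 cG cd cX]].
have := mx_deriveM cX (mx_derive_trmx cX); rewrite c0 trmx1 mulmx1 mul1mx => h.
have e : X + X^T = 0.
  apply: (mx_derive_unique h); have -> : (fun y => c y *m (c y)^T) = (fun=> 1%:M).
    by apply/funext => y; rewrite GT.
  exact: mx_derive_cst.
by apply/eqP; rewrite -addr_eq0 addrC e.
Qed.

(** Differentiate the invariance of b along a curve in G. *)
Lemma lie_algebra_invariants X b : lie_algebra G X -> invariants G b -> der0 X b = 0.
Proof.
move=> /lie_algebraP[c [c0 cG cd cX]] Gb.
apply: (ext_derive_unique (ext_derive_act b cX c0)) => S.
under eq_fun do rewrite Gb //.
exact: ext_derive_cst.
Qed.

End LieAlgebra.

(** * Compactness of SU(n) *)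

Section CompactSU.
Variables (R : realType) (n : nat).
Local Notation C := R[i].
Local Notation N := n.*2.+1.

Lemma closed_eqs (T : topologicalType) (J : Type) (f : J -> T -> R) (a : J -> R) :
  (forall j, continuous (f j)) -> closed [set v | forall j, f j v = a j].
Proof.
move=> fc; rewrite (_ : [set v | _] = \bigcap_(j in [set: J]) (f j @^-1` [set a j])).
  apply: closed_bigI => j _; apply: closed_comp => [v _|]; first exact: fc.
  exact: closed_eq.
by apply/seteqP; split => v /= h j; [move=> _; exact: h|exact: h].
Qed.

(** Continuity of the two real components stands in for a topology on R[i]. *)
Definition ccont (T : topologicalType) (f : T -> C) :=
  continuous (fun v => complex.Re (f v) : R) /\ continuous (fun v => complex.Im (f v) : R).

Section CCont.
Variable T : topologicalType.
Implicit Types f g : T -> C.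

Lemma ccont_cst (c : C) : ccont (fun _ : T => c).
Proof. by split; apply: cst_continuous. Qed.

Lemma ccontD f g : ccont f -> ccont g -> ccont (fun v => f v + g v).
Proof.
move=> [f1 f2] [g1 g2]; split => v.
  under eq_fun do rewrite ReD.
  by apply: cvgD; [exact: f1|exact: g1].
under eq_fun do rewrite ImD.
by apply: cvgD; [exact: f2|exact: g2].
Qed.

Lemma ccontM f g : ccont f -> ccont g -> ccont (fun v => f v * g v).
Proof.
move=> [f1 f2] [g1 g2]; split => v.
  under eq_fun do rewrite ReM.
  by apply: cvgB; apply: cvgM; do ?[exact: f1|exact: g1|exact: f2|exact: g2].
under eq_fun do rewrite ImM.
by apply: cvgD; apply: cvgM; do ?[exact: f1|exact: g1|exact: f2|exact: g2].
Qed.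

Lemma continuous_mul (f g : T -> R) :
  continuous f -> continuous g -> continuous (fun v => f v * g v).
Proof. by move=> fc gc v; apply: cvgM; [exact: fc|exact: gc]. Qed.

Lemma continuous_sub (f g : T -> R) :
  continuous f -> continuous g -> continuous (fun v => f v - g v).
Proof. by move=> fc gc v; apply: cvgB; [exact: fc|exact: gc]. Qed.

Lemma continuous_opp (f : T -> R) : continuous f -> continuous (fun v => - f v).
Proof. by move=> fc v; apply: cvgN; exact: fc. Qed.

Lemma continuous_big (J : Type) (s : seq J) (f : J -> T -> R) :
  (forall j, continuous (f j)) -> continuous (fun v => \sum_(j <- s) f j v).
Proof.
move=> fc; elim: s => [|j s IH].
  by under eq_fun do rewrite big_nil; exact: cst_continuous.
under eq_fun do rewrite big_cons.
by move=> v; apply: cvgD; [exact: fc|exact: IH].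
Qed.

Lemma ccont_det (M : T -> 'M[C]_n) :
  (forall p q, ccont (fun v => M v p q)) -> ccont (fun v => \det (M v)).
Proof.
move=> Mc; rewrite /determinant.
elim: (index_enum _) => [|s l IH].
  by under eq_fun do rewrite big_nil; exact: ccont_cst.
under eq_fun do rewrite big_cons.
apply: ccontD => //; apply: ccontM; first exact: ccont_cst.
elim: (index_enum _) => [|p l' IH'].
  by under eq_fun do rewrite big_nil; exact: ccont_cst.
by under eq_fun do rewrite big_cons; exact: ccontM.
Qed.

End CCont.

Lemma vec_mx_continuous m p : continuous (@vec_mx R m p).
Proof.
move=> v A /nbhs_ballP[e /= e0 eA]; apply/nbhs_ballP; exists e => //= w [_ vw].
by apply: eA; split=> // i j; rewrite !mxE; exact: vw.
Qed.

(** The complex matrix that a matrix in SU(n) realifies. *)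
Definition unrho (g : 'M[R]_N) : 'M[C]_n :=
  \matrix_(p, q) (g (ix p false) (ix q false) +i* g (ix p true) (ix q false))%C.

Lemma unrhoK t U : unrho (rho t U) = U.
Proof. by apply/matrixP => p q; rewrite mxE !rhoE; apply: eqC. Qed.

Lemma SU_equations (g : 'M[R]_N) : SU g <->
  [/\ g *m g^T = 1%:M, g = rho 1 (unrho g) & \det (unrho g) = 1].
Proof.
split=> [Gg|[gg gr gd]].
  have [_ _ _ orth] := @SU_orthogonal R n; split; first exact: orth.
    by have [U [_ _ ->]] := (SUE g).1 Gg; rewrite unrhoK.
  by have [U [_ Ud ->]] := (SUE g).1 Gg; rewrite unrhoK.
apply/SUE; exists (unrho g); split=> //; apply/unitarymxP.
move: gg; rewrite gr rhoT rhoM mulr1 -(rho1 R n) => /rho_inj[_].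
by rewrite unrhoK.
Qed.

(** SU(n) is closed, being defined by continuous equations, and bounded, its rows
    being unit vectors. The Heine-Borel theorem is used on row vectors, into which
    matrices are reshaped. *)
Lemma SU_compact : compact (@SU R n).
Proof.
pose A : set 'rV[R]_(N * N) := [set v | SU (vec_mx v)].
have -> : @SU R n = vec_mx @` A.
  apply/seteqP; split => [g Gg|_ [v Av <-] //].
  by exists (mxvec g); rewrite ?/A /= mxvecK.
apply: continuous_compact; first exact/continuous_subspaceT/vec_mx_continuous.
have ec i j : continuous (fun v : 'rV[R]_(N * N) => vec_mx v i j : R).
  by move=> v; under eq_fun do rewrite mxE; exact: coord_continuous.
apply: bounded_closed_compact.
  exists 1; split; first exact: num_real.
  move=> M M1 v Av /=; rewrite [leLHS]/Num.Def.normr /= mx_normrE.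
  apply: bigmax_le => [|[r s] _ /=]; first exact: (le_trans ler01 (ltW M1)).
  rewrite (le_trans _ (ltW M1)) //.
  have [gg _ _] := (SU_equations _).1 Av.
  case/mxvec_indexP: s => i j; rewrite (ord1 r).
  have -> : v 0 (mxvec_index i j) = vec_mx v i j by rewrite mxE.
  have : \sum_k vec_mx v i k ^+ 2 = 1.
    have := congr1 (fun M' : 'M[R]_N => M' i i) gg; rewrite [RHS]mxE eqxx mxE => gg1; rewrite -[RHS]gg1.
    by apply: eq_bigr => k _; rewrite expr2 [_^T _ _]mxE.
  move=> e1; rewrite -(@ler_pXn2r _ 2) ?nnegrE ?ler01 // expr1n real_normK ?num_real //.
  by rewrite -e1 (bigD1 j) //= lerDl sumr_ge0 // => k _; exact: sqr_ge0.
(* the conditions of SU_equations as real equations *)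
pose f1 (x : 'I_N * 'I_N) (v : 'rV[R]_(N * N)) := \sum_k vec_mx v x.1 k * vec_mx v x.2 k.
pose f2 (x : 'I_N * 'I_N) (v : 'rV[R]_(N * N)) := vec_mx v x.1 x.2 - rho 1 (unrho (vec_mx v)) x.1 x.2.
pose f3 (x : bool) (v : 'rV[R]_(N * N)) := let d := \det (unrho (vec_mx v)) in
  if x then complex.Re d else complex.Im d.
have -> : A = [set v | forall x, f1 x v = (x.1 == x.2)%:R] `&`
    ([set v | forall x, f2 x v = 0] `&` [set v | forall x, f3 x v = x%:R]).
  apply/seteqP; split => v.
    move=> /SU_equations[gg gr gd]; split=> [x|]; last split=> x.
    - have := congr1 (fun M' : 'M[R]_N => M' x.1 x.2) gg; rewrite [LHS]mxE [RHS]mxE => <-.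
      by apply: eq_bigr => k _; rewrite [_^T _ _]mxE.
    - by rewrite /f2 -gr subrr.
    - by rewrite /f3 gd; case: x.
  move=> [h1 [h2 h3]]; apply/SU_equations; split.
  - apply/matrixP => i j; rewrite [LHS]mxE [RHS]mxE -(h1 (i, j)); apply: eq_bigr => k _.
    by rewrite [_^T _ _]mxE.
  - by apply/matrixP => i j; apply/eqP; rewrite -subr_eq0; apply/eqP/(h2 (i, j)).
  - by apply: eqC; [exact: (h3 true)|exact: (h3 false)].
have uc p q : ccont (fun v : 'rV[R]_(N * N) => unrho (vec_mx v) p q).
  by split; under eq_fun do rewrite mxE /=; exact: ec.
apply: closedI; first apply: closed_eqs => -[i j].
  apply: continuous_big => k /=.
  by apply: continuous_mul; exact: ec.
apply: closedI; last first.
  apply: closed_eqs => x; have [h1 h2] := ccont_det uc.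
  by case: x; [exact: h1|exact: h2].
apply: closed_eqs => -[i j].
apply: continuous_sub; first exact: ec.
case: (idxP i) => [p b|]; case: (idxP j) => [q c|] /=; under eq_fun do rewrite rhoE;
  try exact: cst_continuous.
have [h1 h2] := uc p q; rewrite /cblock; case: (b == c); first exact: h1.
by case: b; [exact: h2|apply: continuous_opp; exact: h2].
Qed.

End CompactSU.

(** * Elements of su(n) *)

Section Quadratic.
Variables (K : comNzRingType) (n : nat).
Implicit Types (X D : 'M[K]_n).

(** If X^3 = - X then exp (t X) = 1 + sin t X + (1 - cos t) X^2. *)
Definition quad X (a b : K) : 'M[K]_n := 1%:M + (a *: X + b *: (X *m X)).

Lemma quadM X a b a' b' : X *m X *m X = - X -> quad X a b *m quad X a' b' =
  quad X (a + a' - a * b' - b * a') (b + b' + a * a' - b * b').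
Proof.
move=> X3; have X3' : X *m (X *m X) = - X by rewrite mulmxA X3.
have X4 : X *m X *m (X *m X) = - (X *m X) by rewrite mulmxA X3 mulNmx.
rewrite /quad !mulmxDl !mulmxDr !mul1mx !mulmx1 -!scalemxAl -!scalemxAr X3 X3' X4.
by apply/matrixP => i j; rewrite !mxE; ring.
Qed.

Lemma quadN X a b : quad (- X) a b = quad X (- a) b.
Proof. by rewrite /quad mulNmx mulmxN opprK scalerN scaleNr. Qed.

Lemma quad00 X : quad X 0 0 = 1%:M.
Proof. by rewrite /quad !scale0r !addr0. Qed.

Lemma quad_conj X D a b : D *m D = 1%:M -> D *m quad X a b *m D = quad (D *m X *m D) a b.
Proof.
move=> DD; have DXX : D *m (X *m X) *m D = (D *m X *m D) *m (D *m X *m D).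
  by rewrite !mulmxA -[D *m X *m D *m D]mulmxA DD mulmx1.
by rewrite /quad !mulmxDr !mulmxDl mulmx1 DD -!scalemxAr -!scalemxAl DXX.
Qed.

Lemma quad_trmx X a b : (quad X a b)^T = quad X^T a b.
Proof. by rewrite /quad !linearD !linearZ /= trmx1 trmx_mul. Qed.

End Quadratic.

Lemma quad_map (K L : comNzRingType) (f : {rmorphism K -> L}) n (X : 'M[K]_n) a b :
  map_mx f (quad X a b) = quad (map_mx f X) (f a) (f b).
Proof. by rewrite /quad !map_mxD !map_mxZ map_mxM map_mx1. Qed.

Lemma quad_angle (K L : comNzRingType) (f : {rmorphism K -> L}) n (X : 'M[L]_n) s1 c1 s2 c2 :
  X *m X *m X = - X -> quad X (f s1) (f (1 - c1)) *m quad X (f s2) (f (1 - c2)) =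
  quad X (f (s1 * c2 + c1 * s2)) (f (1 - (c1 * c2 - s1 * s2))).
Proof. by move=> X3; rewrite quadM //; congr (quad _ _ _); ring. Qed.

Lemma quad_opp (K L : comNzRingType) (f : {rmorphism K -> L}) n (X : 'M[L]_n) s b :
  quad (- X) (f s) b = quad X (f (- s)) b.
Proof. by rewrite quadN rmorphN. Qed.

Section Generators.
Variables (R : realType) (n : nat).
Local Notation C := R[i].
Local Notation N := n.*2.+1.
Local Notation I := ('i%C : C).
Local Notation rc := (real_complex R).
Implicit Types (p q r s : 'I_n) (X D : 'M[C]_n).

Section OneParameter.
Variables X D : 'M[C]_n.
Hypotheses (X3 : X *m X *m X = - X) (Xt : (X^t*)%sesqui = - X)
  (DD : D *m D = 1%:M) (DX : D *m X *m D = - X).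

Definition expX (t : R) := quad X (rc (sin t)) (rc (1 - cos t)).

Lemma expXD t u : expX t *m expX u = expX (t + u).
Proof.
by rewrite /expX sinD cosD; exact: (quad_angle rc).
Qed.

Lemma expX0 : expX 0 = 1%:M.
Proof. by rewrite /expX sin0 cos0 subrr rmorph0 quad00. Qed.

Lemma expX_conj t : D *m expX t *m D = expX (- t).
Proof. by rewrite /expX (quad_conj _ _ _ DD) DX sinN cosN; exact: (quad_opp rc). Qed.

(** D conjugates exp (t X) to its inverse, which forces the determinant, a square
    of that of exp ((t / 2) X), to be 1. *)
Lemma det_expX t : \det (expX t) = 1.
Proof.
have tE : t = t / 2 + t / 2 by lra.
have dD : \det D * \det D = 1 by rewrite -det_mulmx DD det1.
rewrite [in LHS]tE -expXD det_mulmx.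
have -> : \det (expX (t / 2)) * \det (expX (t / 2)) =
    \det (expX (t / 2)) * \det (expX (- (t / 2))).
  by rewrite -[in RHS]expX_conj !det_mulmx [\det D * _]mulrC -[in RHS]mulrA dD mulr1.
by rewrite -det_mulmx expXD subrr expX0 det1.
Qed.

Lemma unitary_expX t : expX t \is unitarymx.
Proof.
apply/unitarymxP.
have -> : ((expX t)^t*)%sesqui = expX (- t).
  have cR (c : R) : (rc c)^* = rc c by apply: eqC; rewrite ?Re_conj ?Im_conj /= ?oppr0.
  rewrite /expX quad_trmx quad_map sinN cosN; apply: etrans (quad_opp rc _ _ _).
  exact: (f_equal3 (@quad _ _) Xt (cR _) (cR _)).
by rewrite expXD subrr expX0.
Qed.

Lemma rho_expX t : rho 1 (expX t) =
  1%:M + (sin t *: rho 0 X + (1 - cos t) *: (rho 0 X *m rho 0 X)).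
Proof.
rewrite rhoM mul0r -(rho1 R n) /expX /quad.
have h k U V : rho (k * 0 + 0) (rc k *: U + V) = k *: rho 0 U + rho 0 V :> 'M[R]_N.
  exact: rhoP_lin.
have h1 U V : rho 1 (U + V) = rho 1 U + rho 0 V :> 'M[R]_N.
  by have := rhoP_lin 1 1 0 U V; rewrite !scale1r mul1r addr0.
rewrite h1; congr (_ + _).
have := h (sin t) X (rc (1 - cos t) *: (X *m X)); rewrite mulr0 addr0 => ->.
congr (_ + _); have := h (1 - cos t) (X *m X) 0; rewrite mulr0 !addr0 => ->.
by rewrite rho00 addr0.
Qed.

Lemma lie_rho0 : lie_algebra (@SU R n) (rho 0 X).
Proof.
apply/lie_algebraP; exists (fun t => rho 1 (expX t)).
pose Y := rho 0 X; pose f i j t : R^o := 1%:M i j + (sin t * Y i j + (1 - cos t) * (Y *m Y) i j).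
have fE i j : (fun t => rho 1 (expX t) i j : R^o) = f i j.
  by apply/funext => t; rewrite rho_expX mxE /f; congr (_ + _); rewrite mxE; congr (_ + _); rewrite mxE.
have fd i j t : is_derive (t : R) (1 : R) (f i j) (cos t * Y i j + sin t * (Y *m Y) i j).
  rewrite /f; apply: is_derive_eq => /=.
  by rewrite -![_ *: _]/(_ * _); ring.
split=> [|t|t i j|i j].
- by rewrite expX0 rho1.
- apply/SUE; exists (expX t); split=> //; [exact: unitary_expX|exact: det_expX].
- by rewrite fE; case: (fd i j t).
- rewrite fE; have := fd i j 0; rewrite cos0 sin0 mul1r mul0r addr0; exact.
Qed.

End OneParameter.

Definition E p q : 'M[C]_n := delta_mx p q.

Lemma E_mul p q r s : E p q *m E r s = if q == r then E p s else 0.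
Proof. by rewrite /E mul_delta_mx_cond; case: eqP. Qed.

Lemma E_conj p q : ((E p q)^t*)%sesqui = E q p.
Proof. by apply/matrixP => i j; rewrite !mxE rmorph_nat andbC. Qed.

Lemma adjB (M M' : 'M[C]_n) : ((M - M')^t*)%sesqui = (M^t*)%sesqui - (M'^t*)%sesqui.
Proof. by rewrite linearB map_mxB. Qed.

Lemma adjZ (k : C) (M : 'M[C]_n) : ((k *: M)^t*)%sesqui = k^* *: (M^t*)%sesqui.
Proof. by rewrite linearZ map_mxZ. Qed.

Lemma conjI : I^* = - I.
Proof. by apply: eqC; rewrite ?Re_conj ?Im_conj /= ?oppr0. Qed.

(** The sign change D of the p-th coordinate anticommutes with this matrix. *)
Lemma lie_offdiag p q (x : C) : p != q -> x * x^* = 1 ->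
  lie_algebra (@SU R n) (rho 0 (x *: E p q - x^* *: E q p)).
Proof.
move=> pq xx; have qp : (q == p) = false by rewrite eq_sym (negbTE pq).
have pq' := negbTE pq; pose D : 'M[C]_n := 1%:M - E p p - E p p.
have X2 : (x *: E p q - x^* *: E q p) *m (x *: E p q - x^* *: E q p) = - (E p p + E q q).
  rewrite !mulmxBl !mulmxBr -!scalemxAl -!scalemxAr !E_mul qp pq' !eqxx !scaler0.
  by rewrite sub0r subr0 !scalerA [x^* * x]mulrC xx !scale1r opprD.
have Dp r : D *m E p r = - E p r.
  by rewrite !mulmxBl mul1mx E_mul eqxx subrr sub0r.
have Dq r : D *m E q r = E q r by rewrite !mulmxBl mul1mx E_mul pq' !subr0.
have pD r : E r p *m D = - E r p.
  by rewrite !mulmxBr mulmx1 E_mul eqxx subrr sub0r.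
have qD r : E r q *m D = E r q by rewrite !mulmxBr mulmx1 E_mul qp !subr0.
have DD : D *m D = 1%:M by rewrite {2}/D !mulmxBr mulmx1 Dp opprK {1}/D !subrK.
move: D Dp Dq pD qD DD => D Dp Dq pD qD DD; apply: (@lie_rho0 _ D).
- rewrite X2 mulNmx mulmxDl !mulmxBr -!scalemxAr !E_mul !eqxx qp pq' !scaler0 !subr0 sub0r.
  by rewrite opprD.
- by rewrite adjB !adjZ !E_conj conjCK opprB.
- exact: DD.
- have -> : D *m (x *: E p q - x^* *: E q p) = - (x *: E p q) - x^* *: E q p.
    by rewrite mulmxBr -!scalemxAr Dp Dq scalerN.
  by rewrite mulmxBl mulNmx -!scalemxAl qD pD scalerN opprK opprB addrC.
Qed.

(** Here D is the transposition of the coordinates p and q. *)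
Lemma lie_diag p q : lie_algebra (@SU R n) (rho 0 (I *: E p p - I *: E q q)).
Proof.
case: (eqVneq p q) => [->|pq].
  rewrite subrr rho00; exact/lie_algebra0/SU_orthogonal.
have qp : (q == p) = false by rewrite eq_sym (negbTE pq).
have pq' := negbTE pq; have II : I * I = -1 by apply: eqC; rewrite ?ReM ?ImM /=; ring.
have X2 : (I *: E p p - I *: E q q) *m (I *: E p p - I *: E q q) = - (E p p + E q q).
  rewrite !mulmxBl !mulmxBr -!scalemxAl -!scalemxAr !E_mul qp pq' !eqxx !scaler0.
  by rewrite subr0 sub0r opprK !scalerA II !scaleN1r -opprD.
have TT : tperm_mx p q *m tperm_mx p q = 1%:M :> 'M[C]_n.
  by rewrite -perm_mxM tperm2 perm_mx1.
apply: (@lie_rho0 _ (tperm_mx p q)).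
- rewrite X2 mulNmx mulmxDl !mulmxBr -!scalemxAr !E_mul !eqxx qp pq' !scaler0.
  by rewrite subr0 sub0r.
- by rewrite adjB !adjZ !E_conj conjI !scaleNr opprK opprB addrC.
- exact: TT.
- have tp i : (tperm p q i == p) = (i == q).
    by rewrite (can2_eq (tpermK p q) (tpermK p q)) tpermL.
  have tq i : (tperm p q i == q) = (i == p).
    by rewrite (can2_eq (tpermK p q) (tpermK p q)) tpermR.
  have conjT (M : 'M[C]_n) : tperm_mx p q *m M *m tperm_mx p q =
      \matrix_(i, j) M (tperm p q i) (tperm p q j).
    by rewrite -xrowE -xcolE; apply/matrixP => i j; rewrite !mxE.
  by rewrite conjT; apply/matrixP => i j; rewrite !mxE !tp !tq opprB.
Qed.

(** A linear parametrization of u(n) by real matrices: entries above the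
    diagonal give the real skew part, the others the imaginary symmetric part. *)
Definition su_gen p q : 'M[C]_n :=
  if (p < q)%N then E p q - E q p
  else if p == q then I *: E p q else I *: E p q + I *: E q p.

Definition su_map (M : 'M[R]_n) : 'M[R]_N := \sum_p \sum_q M p q *: rho 0 (su_gen p q).

Lemma su_map_lin : linear su_map.
Proof.
move=> k M M'; rewrite /su_map scaler_sumr -big_split; apply: eq_bigr => p _.
rewrite scaler_sumr -big_split; apply: eq_bigr => q _.
by rewrite !mxE scalerDl scalerA.
Qed.
HB.instance Definition _ := GRing.isLinear.Build R _ _ _ su_map su_map_lin.

Lemma su_genE r s p q : let b1 : R := ((p == r) && (q == s))%:R in
  let b2 : R := ((p == s) && (q == r))%:R in
  su_gen r s p q = ((if (r < s)%N then b1 - b2 else 0) +i*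
    (if (r < s)%N then 0 else if r == s then b1 else b1 + b2))%C.
Proof.
move=> b1 b2; have bC (b : bool) : (b%:R : C) = rc b%:R by case: b.
have EE i j i' j' : E i j i' j' = rc ((i' == i) && (j' == j))%:R by rewrite mxE bC.
have ReN (w : C) : complex.Re (- w) = - complex.Re w by case: w.
have ImN (w : C) : complex.Im (- w) = - complex.Im w by case: w.
have MD (M M' : 'M[C]_n) : (M + M') p q = M p q + M' p q by rewrite mxE.
have MN (M : 'M[C]_n) : (- M) p q = - M p q by rewrite mxE.
have MZ (k : C) (M : 'M[C]_n) : (k *: M) p q = k * M p q by rewrite mxE.
rewrite /su_gen; case: ifP => _; last case: eqP => _;
  rewrite ?MD ?MN ?MZ !EE -/b1 -/b2; apply: eqC;
  by rewrite ?ReD ?ImD ?ReN ?ImN ?ReM ?ImM /= ?ReM ?ImM /=; rewrite /b1 /b2; ring.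
Qed.

(** Every entry of M reappears as an entry of su_map M, so su_map is injective. *)
Lemma su_gen_coord r s p q :
  rho 0 (su_gen r s) (ix p (q <= p)%N) (ix q false) = ((r == p) && (s == q))%:R :> R.
Proof.
rewrite rho_ix su_genE /cblock [r == p]eq_sym [s == q]eq_sym; case: (leqP q p) => qp /=.
  case: (ltnP r s) => rs.
    case: eqP => //= pr; case: eqP => //= qs; by move: qp rs; rewrite pr qs; lia.
  case: (eqVneq r s) => [->//|rs']; rewrite [X in _ + X](_ : _ = 0) ?addr0 //.
  case: eqP => //= ps; case: eqP => //= qr.
  by move: rs'; rewrite -val_eqE /=; move: qp rs; rewrite ps qr; lia.
case: (ltnP r s) => rs.
  rewrite [X in _ - X](_ : _ = 0) ?subr0 //.
  by case: eqP => //= ps; case: eqP => //= qr; move: qp rs; rewrite ps qr; lia.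
by case: eqP => //= pr; case: eqP => //= qs; move: qp rs; rewrite pr qs; lia.
Qed.

Lemma su_map_coord M p q : su_map M (ix p (q <= p)%N) (ix q false) = M p q.
Proof.
transitivity (\sum_r \sum_s M r s * ((r == p) && (s == q))%:R).
  rewrite /su_map summxE; apply: eq_bigr => r _; rewrite summxE; apply: eq_bigr => s _.
  by rewrite mxE su_gen_coord.
rewrite (bigD1 p) //= [X in _ + X]big1 ?addr0 => [|r rp]; last first.
  by rewrite big1 // => s _; rewrite (negbTE rp) mulr0.
rewrite (bigD1 q) //= !eqxx mulr1 big1 ?addr0 // => s sq.
by rewrite (negbTE sq) mulr0.
Qed.

Lemma su_map_inj M : su_map M = 0 -> M = 0.
Proof.
by move=> e; apply/matrixP => p q; rewrite -su_map_coord e !mxE.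
Qed.

Lemma rho0B U V : rho 0 (U - V) = rho 0 U - rho 0 V :> 'M[R]_N.
Proof.
have MB (M M' : 'M[R]_N) i j : (M - M') i j = M i j - M' i j by rewrite !mxE.
apply/esym/rhoP => [p b q c|p b|p b|]; rewrite MB !rhoE ?subr0 //.
have -> : (U - V) p q = U p q - V p q by rewrite !mxE.
by rewrite /cblock; case: (b == c); last case: b; rewrite raddfB // opprB opprK addrC.
Qed.

Hypothesis n_gt0 : (0 < n)%N.
Let p0 : 'I_n := Ordinal n_gt0.

(** The diagonal generators i E_pp are corrected by i E_00, which leaves the sum
    unchanged when the trace of M vanishes. *)
Lemma su_map_lie M : \tr M = 0 -> lie_algebra (@SU R n) (su_map M).
Proof.
move=> trM; have [U UE] := lie_algebra_vspace (@SU_orthogonal R n).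
apply/UE.
have -> : su_map M = \sum_p \sum_q M p q *:
    (rho 0 (su_gen p q) - (p == q)%:R *: rho 0 (I *: E p0 p0)).
  have -> : \sum_p \sum_q M p q *: (rho 0 (su_gen p q) - (p == q)%:R *: rho 0 (I *: E p0 p0)) =
      su_map M - \tr M *: rho 0 (I *: E p0 p0).
    rewrite /su_map /mxtrace scaler_suml -sumrB; apply: eq_bigr => p _.
    rewrite [X in _ = _ - X](_ : _ = \sum_q M p q *: ((p == q)%:R *: rho 0 (I *: E p0 p0))).
      by rewrite -sumrB; apply: eq_bigr => q _; rewrite scalerBr.
    rewrite (bigD1 p) //= eqxx scale1r big1 ?addr0 // => q qp.
    by rewrite eq_sym (negbTE qp) scale0r scaler0.
  by rewrite trM scale0r subr0.
apply: memv_suml => p _; apply: memv_suml => q _; apply: memvZ; apply/UE.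
rewrite /su_gen; case: (eqVneq p q) => [->|pq].
  by rewrite ltnn scale1r -rho0B; exact: lie_diag.
rewrite scale0r subr0; case: ifP => _.
  have := @lie_offdiag p q 1 pq; rewrite conjC1 mulr1 !scale1r; exact.
have := @lie_offdiag p q I pq; rewrite conjI scaleNr opprK; apply.
by rewrite mulrN; apply: eqC; rewrite ?raddfN /= ?ReM ?ImM /=; ring.
Qed.

End Generators.

(** * The dimension squeeze *)

Section Tensors.
Variables (R : realType) (N : nat).
Implicit Types eta : glT R N.

Lemma TS2T_vspace : exists U : {vspace glT R N}, forall eta, eta \in U <-> TS2T eta.
Proof.
apply: (linear_set_vspace (V := @TS2T R N)) => [i j k|a x y hx hy i j k].
  by rewrite !ffunE !mxE.
by rewrite !ffunE !mxE hx hy.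
Qed.

(** Going around the six orders of three indices changes the sign three times. *)
Lemma skew_sym_eq0 eta : (forall k, (eta k)^T = - eta k) -> TS2T eta -> eta = 0.
Proof.
move=> sk sy; have skE k i j : eta k i j = - eta k j i.
  by have := congr1 (fun M : 'M[R]_N => M j i) (sk k); rewrite !mxE.
apply/ffunP => k; apply/matrixP => i j; rewrite !ffunE mxE.
have e1 := skE k i j; have e2 : eta k j i = eta i j k by rewrite sy.
have e3 := skE i j k; have e4 : eta i k j = eta j k i by rewrite sy.
have e5 := skE j k i; have e6 : eta j i k = eta k i j by rewrite sy.
by lra.
Qed.

Definition ltpair := {x : 'I_N * ('I_N * 'I_N) | (x.2.1 < x.2.2)%N}.

(** T (x) S^2 T as the kernel of a map into a space of known dimension. *)
Definition alternate eta : {ffun ltpair -> R^o} :=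
  [ffun x => eta (val x).2.2 (val x).1 (val x).2.1 - eta (val x).2.1 (val x).1 (val x).2.2].
Lemma alternate_lin : linear alternate.
Proof.
move=> a x y; apply/ffunP => p; rewrite !ffunE !mxE -[_ *: _ : R^o]/(_ * _).
by ring.
Qed.
HB.instance Definition _ := GRing.isLinear.Build R _ _ _ alternate alternate_lin.

Lemma alternate0 eta : alternate eta = 0 -> TS2T eta.
Proof.
move=> e; have lt (i j k : 'I_N) : (j < k)%N -> eta k i j = eta j i k.
  move=> jk; have /ffunP/(_ (Sub (i, (j, k)) jk : ltpair)) := e.
  by rewrite !ffunE /= => /eqP; rewrite subr_eq0 => /eqP.
by move=> i j k; case: (ltngtP j k) => [/lt ->|/lt ->|/val_inj ->].
Qed.

Lemma card_ltpair : (#|{: ltpair}| * 2 + N * N = N * (N * N))%N.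
Proof.
rewrite card_sig -sum1_card.
rewrite (eq_bigl (fun x : 'I_N * ('I_N * 'I_N) => xpredT x.1 && (x.2.1 < x.2.2)%N)) => [|x]; last by rewrite inE.
rewrite -(pair_big xpredT (fun y : 'I_N * 'I_N => (y.1 < y.2)%N) (fun _ _ => 1%N)) /=.
rewrite sum_nat_const card_ord.
rewrite (_ : \sum_(y : 'I_N * 'I_N | _) 1 = \sum_(k < N) k)%N; last first.
  rewrite big_mkcond /= -(pair_bigA _ (fun j k : 'I_N => if (j < k)%N then 1%N else 0%N)) /=.
  rewrite exchange_big /=; apply: eq_bigr => k _; rewrite -[RHS](sum_lt (ltnW (ltn_ord k))).
  by apply: eq_bigr => j _; case: ifP.
by have := sum_id N; nia.
Qed.

Lemma dim_TS2T (U : {vspace glT R N}) : (forall eta, eta \in U <-> TS2T eta) ->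
  (N * (N * N) <= \dim U + #|{: ltpair}|)%N.
Proof.
move=> UE; have := limg_ker_dim (linfun alternate) fullv.
rewrite dimvf dim_ffun card_ord dim_matrix => <-.
apply: leq_add; last by rewrite (leq_trans (dimvS (subvf _))) // dimvf dim_ffun muln1.
apply/dimvS/subvP => eta; rewrite memv_cap memv_ker lfunE /= => /andP[_ /eqP e].
exact/UE/alternate0.
Qed.

End Tensors.

Section StructureTensors.
Variables (R : realType) (n : nat).
Hypothesis n_gt1 : (1 < n)%N.
Local Notation N := n.*2.+1.
Local Notation SUn := (@SU R n).

Lemma gT_vspace : exists U : {vspace glT R N}, forall eta, eta \in U <-> gT SUn eta.
Proof.
apply: (linear_set_vspace (V := gT SUn)) => [k|a x y hx hy k]; rewrite !ffunE.
  exact/lie_algebra0/SU_orthogonal.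
by apply: lie_algebra_lin; [exact: SU_orthogonal|exact: hx|exact: hy].
Qed.

Definition su_tensor (M : {ffun 'I_N -> 'M[R]_n}) : glT R N := [ffun k => su_map (M k)].
Lemma su_tensor_lin : linear su_tensor.
Proof. by move=> a x y; apply/ffunP => k; rewrite !ffunE linearP. Qed.
HB.instance Definition _ := GRing.isLinear.Build R _ _ _ su_tensor su_tensor_lin.

Definition traces (M : {ffun 'I_N -> 'M[R]_n}) : {ffun 'I_N -> R^o} := [ffun k => \tr (M k)].
Lemma traces_lin : linear traces.
Proof. by move=> a x y; apply/ffunP => k; rewrite !ffunE linearP. Qed.
HB.instance Definition _ := GRing.isLinear.Build R _ _ _ traces traces_lin.

Lemma dim_gT (U : {vspace glT R N}) : (forall eta, eta \in U <-> gT SUn eta) ->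
  (N * (n * n) <= \dim U + N)%N.
Proof.
move=> UE; have := limg_ker_dim (linfun traces) fullv.
rewrite dimvf dim_ffun card_ord dim_matrix => <-.
apply: leq_add; last by rewrite (leq_trans (dimvS (subvf _))) // dimvf dim_ffun card_ord muln1.
rewrite -(@limg_dim_eq _ _ _ (linfun su_tensor)).
  apply/dimvS/subvP => _ /memv_imgP[M + ->].
  rewrite memv_cap memv_ker !lfunE /= => /andP[_ /eqP/ffunP trM].
  by apply/UE => k; rewrite ffunE; apply: su_map_lie; [lia|have := trM k; rewrite !ffunE].
apply/eqP; rewrite -subv0; apply/subvP => M; rewrite memv_cap memv_ker lfunE /= memv0.
move=> /andP[_ /eqP/ffunP e]; apply/eqP/ffunP => k; have := e k; rewrite !ffunE.
exact: su_map_inj.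
Qed.

Lemma gT_TS2T_eq0 eta : gT SUn eta -> TS2T eta -> eta = 0.
Proof.
move=> g s; apply: skew_sym_eq0 s => k.
by apply: (lie_algebra_skew (@SU_orthogonal R n)); exact: g.
Qed.

(** D_z annihilates invariants for z in g; for eta symmetric in its last two indices
    the terms of d_eta b alternate. *)
Lemma gT_TS2T_Z0 A eta : A `<=` invariants SUn ->
  [set x + y | x in gT SUn & y in @TS2T R N] eta -> Z0 A eta.
Proof.
move=> AI [x xg [y ys <-]] b /AI bI.
rewrite -[x]scale1r der1_lin scale1r !der1E.
have -> : \sum_(k < N) wedge (ext_vec (theta k.+1)) (der0 (x k)^T b) = 0.
  rewrite big1 // => k _; rewrite (lie_algebra_skew (@SU_orthogonal R n) (xg k)).
  by rewrite der0N (lie_algebra_invariants (xg k) bI) oppr0 linear0.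
have -> : \sum_(k < N) wedge (ext_vec (theta k.+1)) (der0 (y k)^T b) =
    \sum_(i < N) \sum_(k < N) \sum_(j < N) y k i j *:
      wedge (ext_vec (theta k.+1)) (wedge (ext_vec (theta j.+1)) (contr i b)).
  rewrite exchange_big; apply: eq_bigr => k _; rewrite der0E linear_sum.
  apply: eq_bigr => i _; rewrite linear_sum; apply: eq_bigr => j _.
  by rewrite mxE linearZ.
rewrite oppr0 add0r big1 ?oppr0 // => i _; apply: sum_alternating => [k|k j].
  by rewrite wedge_vec_sqr scaler0.
by rewrite wedge_vecC scalerN ys.
Qed.

Definition entries (P : {set 'I_N * 'I_N}) (z : 'M[R]_N) : {ffun {x | x \in P} -> R^o} :=
  [ffun x => z (val x).1 (val x).2].
Lemma entries_lin P : linear (entries P).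
Proof. by move=> a x y; apply/ffunP => i; rewrite !ffunE !mxE. Qed.
HB.instance Definition _ P := GRing.isLinear.Build R _ _ _ (entries P) (entries_lin P).

Lemma dim_polar_annihilator (A : set (ext R N)) k :
  A (alpha_form R n) -> A (F_form R n) -> A (ReOmega_form R n) -> A (ImOmega_form R n) ->
  (k < N)%N ->
  (dim_set (polar_annihilator A (stage n_gt1 k)) + #|pivot_set n k| <= N * N)%N.
Proof.
move=> Aa AF AR AI kN; have [U UE] := polar_annihilator_vspace A (stage n_gt1 k).
rewrite (dim_setE UE) -[X in (_ <= X)%N](_ : #|~: pivot_set n k| + #|pivot_set n k| = _)%N; last first.
  by rewrite addnC cardsC card_prod !card_ord.
rewrite leq_add2r; have -> : #|~: pivot_set n k| = dim {ffun {x | x \in ~: pivot_set n k} -> R^o}.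
  by rewrite dim_ffun muln1 card_sig; apply: eq_card => x; rewrite !inE.
apply: (dim_inj_le (f := entries (~: pivot_set n k))) => z /UE zk /ffunP e.
apply: (@pivot_zero R n n_gt1 A Aa AF AR AI k z _ zk) => // i j ij.
have ijP : (i, j) \in (~: pivot_set n k)%SET by rewrite !inE.
by have := e (Sub (i, j) ijP); rewrite !ffunE.
Qed.

Definition generators : set (ext R N) :=
  [set b | [\/ b = alpha_form R n, b = F_form R n, b = ReOmega_form R n
            | b = ImOmega_form R n]].

Lemma generators_invariant : generators `<=` invariants SUn.
Proof.
by move=> b [] ->; [exact: invariants_alpha|exact: invariants_F|exact: invariants_Re|exact: invariants_Im].
Qed.

(** The squeeze is carried out for any set of invariants that contains the four
    forms: it applies both to all invariants, for strong admissibility, and to the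
    four forms alone, for the statement on intrinsic torsion. *)
Section Squeeze.
Variable A : set (ext R N).
Hypotheses (gA : generators `<=` A) (AI : A `<=` invariants SUn).

Lemma sum_dim_polar_annihilator :
  (\sum_(k < N) dim_set (polar_annihilator A (stage n_gt1 k)) + N * (n * n + n + 1)
     <= N * (N * N))%N.
Proof.
rewrite -(sum_card_pivot n_gt1) -big_split /=.
have -> : (N * (N * N) = \sum_(k < N) N * N)%N by rewrite sum_nat_const card_ord.
apply: leq_sum => k _; apply: dim_polar_annihilator => //; apply: gA;
  by [constructor 1|constructor 2|constructor 3|constructor 4].
Qed.

Lemma Z0_upper : (dim_set (Z0 A) <=
  \sum_(k < N) dim_set (polar_annihilator A (stage n_gt1 k)))%N.
Proof. exact: (cartan_inequality A (rk_inj (n_gt1 := n_gt1))). Qed.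

Lemma sum_gT_TS2T : exists2 U : {vspace glT R N},
  (forall eta, eta \in U <-> [set x + y | x in gT SUn & y in @TS2T R N] eta)
  & (N * (N * N) <= \dim U + N * (n * n + n + 1))%N.
Proof.
have [U UE] := gT_vspace; have [V VE] := TS2T_vspace R N; exists (U + V)%VS.
  move=> eta; split=> [/memv_addP[x /UE xU [y /VE yV ->]]|[x /UE xU [y /VE yV <-]]].
    by exists x => //; exists y.
  exact: memv_add.
rewrite dimv_disjoint_sum; last first.
  apply/eqP; rewrite -subv0; apply/subvP => x; rewrite memv_cap memv0 => /andP[/UE xg /VE xs].
  by apply/eqP/gT_TS2T_eq0.
by have := dim_gT UE; have := dim_TS2T VE; have := card_ltpair N; nia.
Qed.

(** gT + TS2T lies in Z0 A by gT_TS2T_Z0, while the dimension of Z0 A is bounded above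
    by Z0_upper and sum_dim_polar_annihilator, that of gT + TS2T below by sum_gT_TS2T,
    with the same bound. *)
Lemma Z0_squeeze : Z0 A = [set x + y | x in gT SUn & y in @TS2T R N] /\
  (dim_set (Z0 A) + N * (n * n + n + 1) = N * (N * N))%N.
Proof.
have [U UE dU] := sum_gT_TS2T; have [Z ZE] := Z0_vspace A.
have UZ : (U <= Z)%VS by apply/subvP => eta /UE h; apply/ZE; exact: gT_TS2T_Z0 h.
have := sum_dim_polar_annihilator; have := Z0_upper; rewrite (dim_setE ZE) => h1 h2.
have dUZ := dimvS UZ; have eUZ : U = Z by apply/eqP; rewrite eqEdim UZ; lia.
split; last by lia.
by apply/seteqP; split => eta; rewrite -eUZ in ZE; [move/ZE/UE|move/UE/ZE].
Qed.

(** The squeeze turns Cartan's inequality into an equality. *)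
Lemma ordinary_flag : ordinary A (flagE R n).
Proof.
split; first exact: flagE_complete.
have [_ dZ] := Z0_squeeze.
rewrite /codim_set dimvf dim_ffun card_ord dim_matrix.
have e : (\sum_(k < N) polar_dim A (flagE R n k) +
    \sum_(k < N) dim_set (polar_annihilator A (stage n_gt1 k)) = N * (N * N))%N.
  rewrite -big_split /= (eq_bigr (fun=> (N * N)%N)) => [|k _].
    by rewrite sum_nat_const card_ord.
  by apply: polar_dimE => v; apply: flagE_mem; exact: ltnW.
by have := Z0_upper; have := sum_dim_polar_annihilator; lia.
Qed.

End Squeeze.

Lemma ordinary_SU : ordinary (invariants SUn) (flagE R n).
Proof. by apply: ordinary_flag => //; exact: generators_invariant. Qed.

Lemma strongly_admissible_SU : strongly_admissible SUn.
Proof.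
split; [exact: SU_orthogonal|exact: SU_compact| |].
  by have [-> _] := Z0_squeeze generators_invariant (@subset_refl _ _).
apply/seteqP; split=> [eta [xg xs]|_ ->]; first exact: gT_TS2T_eq0.
by split=> [k|i j k]; rewrite !ffunE ?mxE //; exact/lie_algebra0/SU_orthogonal.
Qed.

End StructureTensors.

(** * Intrinsic torsion *)

Section Equivariance.
Variables (K : comNzRingType) (N : nat).
Implicit Types (b : ext K N) (g z : 'M[K]_N).

(** Naturality of derivations; z' = g z g^-1 when g is invertible. *)
Lemma ext_act_der0 g z z' b : g *m z = z' *m g ->
  ext_act g (der0 z b) = der0 z' (ext_act g b).
Proof.
move=> e; elim/ext_ind_vec: b => [k a b ha hb||v b hb].
- by rewrite !linearP /= ha hb.
- by rewrite der0_ext1 ext_act_ext1 linear0 der0_ext1.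
by rewrite der0_wedge linearD /= !ext_act_wedge der0_wedge hb !mulmxA e.
Qed.

End Equivariance.

Section InverseDerivative.
Variables (R : realType) (V : normedModType R).
Implicit Types (x v : V).

Lemma derivable_det m (M : V -> 'M[R]_m) x v :
  (forall i j, derivable (fun y => M y i j : R^o) x v) ->
  derivable (fun y => \det (M y) : R^o) x v.
Proof.
move=> Md; rewrite /determinant.
have prodd (p : 'S_m) (l : seq 'I_m) : derivable (fun y => \prod_(i <- l) M y i (p i) : R^o) x v.
  elim: l => [|i l IH].
    by under eq_fun do rewrite big_nil; exact: derivable_cst.
  under eq_fun do rewrite big_cons.
  by have := is_derive_mul (derivableP (Md i (p i))) (derivableP IH); case.
have := is_derive_big (index_enum 'S_m) xpredT (fun p =>
  is_derive_mulc ((-1) ^+ p) (derivableP (prodd p (index_enum 'I_m)))).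
by case.
Qed.

Lemma derivable_invmx m (M : V -> 'M[R]_m) x v :
  (\forall y \near x, M y \in unitmx) ->
  (forall i j, derivable (fun y => M y i j : R^o) x v) ->
  forall i j, derivable (fun y => invmx (M y) i j : R^o) x v.
Proof.
move=> Mu Md i j.
apply: (@near_eq_derivable _ _ _ (fun y => (\det (M y))^-1 * cofactor (M y) j i)).
  near=> y; have yu : M y \in unitmx by near: y.
  by rewrite /invmx yu !mxE.
apply: derivableM.
  apply: derivableV; last exact: derivable_det.
  by have := nbhs_singleton Mu; rewrite unitmxE unitfE.
apply: derivableM; first exact: derivable_cst.
apply: derivable_det => k l.
by under eq_fun do rewrite !mxE; exact: Md.
Unshelve. all: by end_near. Qed.

(** Differentiability comes from the adjugate formula, the value of the derivative
    from the Leibniz rule on M M^-1 = 1. *)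
Lemma mx_derive_invmx m (M : V -> 'M[R]_m) dM x v :
  (\forall y \near x, M y \in unitmx) -> mx_derive M dM x v ->
  mx_derive (fun y => invmx (M y)) (- (invmx (M x) *m dM *m invmx (M x))) x v.
Proof.
move=> Mu Md; have xu := nbhs_singleton Mu.
pose dI : 'M[R]_m := \matrix_(i, j) 'D_v (fun y => invmx (M y) i j : R^o) x.
have Id : mx_derive (fun y => invmx (M y)) dI x v.
  move=> i j; rewrite mxE; apply: derivableP; apply: derivable_invmx => // k l.
  by case: (Md k l).
have e : dM *m invmx (M x) + M x *m dI = 0.
  apply: (mx_derive_unique (mx_deriveM Md Id)) => i j.
  apply: (@near_eq_is_derive _ _ _ (fun=> (1%:M : 'M[R]_m) i j)).
    by near=> y; rewrite mulmxV //; near: y.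
  exact: mx_derive_cst.
suff -> : - (invmx (M x) *m dM *m invmx (M x)) = dI by [].
apply/eqP; rewrite eq_sym -subr_eq0 opprK addrC; apply/eqP.
have := congr1 (mulmx (invmx (M x))) e.
by rewrite mulmxDr mulmx0 mulKmx // mulmxA.
Unshelve. all: by end_near. Qed.

End InverseDerivative.

Lemma ext_derive_ext_act (R : realType) (N : nat) (V : normedModType R) (h : 'M[R]_N)
    (w : V -> ext R N) dw x v :
  ext_derive w dw x v -> ext_derive (fun y => ext_act h (w y)) (ext_act h dw) x v.
Proof.
move=> wd S; rewrite /ext_act /ext_lift sum_ffunE.
under eq_fun do rewrite sum_ffunE.
apply: is_derive_big => A; rewrite ffunE.
under eq_fun do rewrite ffunE.
rewrite -![_ *: _]/(_ * _) mulrC; under eq_fun do rewrite -![_ *: _]/(_ * _) mulrC.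
exact: is_derive_mulc.
Qed.

Section Torsion.
Variables (R : realType) (N : nat) (G : set 'M[R]_N).
Hypothesis GG : orthogonal_subgroup G.

Lemma coframe_invariant v w b : v \in unitmx -> invariants G b ->
  (exists2 g, G g & w = v *m g) ->
  ext_act (invmx w)^T b = ext_act (invmx v)^T b.
Proof.
case: GG => _ _ _ GT vu Gb [g Gg wE].
have -> : invmx w = g^T *m invmx v.
  apply: invmx_uniq; rewrite wE mulmxA -[g^T *m _ *m v]mulmxA mulVmx // mulmx1.
  exact/mulmx1C/GT.
by rewrite trmx_mul trmxK ext_actM Gb.
Qed.

Variables (M : manifold R N) (P : gstructure G M) (nabla : connection P).
Variables (a : chart M) (x : M) (u : 'M[R]_N).
Hypotheses (ax : cdom a x) (Pu : frames P a x u).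

(** The Christoffel symbols in the frame u, with the index of the direction of
    differentiation also referred to u. *)
Definition frame_connection : glT R N :=
  [ffun l => \sum_k u k l *: (invmx u *m christoffel nabla a (cmap a x) k *m u)].

Local Notation y0 := (cmap a x).
Local Notation Gamma := (christoffel nabla a y0).

(** The covariant derivative of the form associated with an invariant b vanishes,
    which is what the formula says in coordinates. Along a local section s the form
    is the image of b under the transposed inverse of s, so its derivative is given by
    s^-1 ds; this differs from - s^-1 Gamma s by the connection form, which takes
    values in g and hence annihilates b. *)
Lemma partial_assoc_form b k S : invariants G b ->
  partial (V := R^o) k (fun z => assoc_form P b a z S) y0 =
  der0 (Gamma k)^T (ext_act (invmx u)^T b) S.
Proof.
move=> Gb; have [U [s [oU Uy0 UI sm sP]]] := frames_section P ax.
have cy y : U y -> cdom a (cinv a y) by move=> /UI[x' ax' <-]; rewrite cmapK.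
have su y : U y -> s y \in unitmx by move=> Uy; apply: frames_unit (cy y Uy) (sP y Uy).
have nU : \forall y \near y0, U y by apply: open_nbhs_nbhs.
have assocE y : U y -> assoc_form P b a y = ext_act (invmx (s y))^T b.
  move=> Uy; rewrite /assoc_form; case: xgetP => [w _ Pw|/(_ (s y))]; last by have := sP y Uy.
  apply: coframe_invariant => //; first exact: su.
  by have [h _] := frames_orbit w (cy y Uy) (sP y Uy); exact: h.
have s0 := su _ Uy0; have uu := frames_unit ax Pu.
set ds := partial_mx k s y0; have sd : mx_derive s ds y0 (theta k.+1).
  move=> i j; rewrite mxE /partial; apply: derivableP; apply: diff_derivable.
  exact: (sm i j [::] y0 Uy0).
have lP : local_section P a U s by [].
have lw := christoffel_lie nabla k lP Uy0; rewrite -/ds in lw.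
pose Q := invmx (s y0) *m Gamma k *m s y0.
(* Near y0 the form is the image of [ext_act (m y) b] under the coframe at y0, and
   m y0 = 1, so that ext_derive_act applies. *)
pose m y := (s y0)^T *m (invmx (s y))^T.
have md : mx_derive m (Q^T + (invmx (s y0) *m (ds + Gamma k *m s y0))) y0 (theta k.+1).
  have nsu : \forall y \near y0, s y \in unitmx by near=> y; apply: su; near: y.
  have := mx_deriveM (mx_derive_cst (s y0)^T y0 (theta k.+1))
    (mx_derive_trmx (mx_derive_invmx nsu sd)).
  rewrite mul0mx add0r -trmx_mul mulNmx mulmxKV //.
  rewrite -[X in _ + X]opprK -(lie_algebra_skew GG lw) mulmxDr linearD /=.
  by rewrite mulmxA opprD addrCA subrr addr0 linearN.
have m1 : m y0 = 1%:M by rewrite /m -trmx_mul mulVmx // trmx1.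
have := ext_derive_ext_act (invmx (s y0))^T (ext_derive_act b md m1).
have -> : ext_act (invmx (s y0))^T
    (der0 (Q^T + (invmx (s y0) *m (ds + Gamma k *m s y0))) b) =
  der0 (Gamma k)^T (ext_act (invmx u)^T b).
  rewrite -[der0 _ b]/(der0_at b _) linearD /= /der0_at (lie_algebra_invariants lw Gb) addr0.
  rewrite (@ext_act_der0 _ _ _ _ (Gamma k)^T).
    congr der0; apply/esym/coframe_invariant => //.
    by have [h _] := frames_orbit u (cy y0 Uy0) (sP y0 Uy0); apply: h; rewrite cmapK.
  by rewrite -!trmx_mul /Q mulmxK.
move=> /(_ S) [_ <-]; rewrite /partial; apply: near_eq_derive.
near=> y; have Uy : U y by near: y.
by rewrite assocE // -ext_actM /m mulmxA -trmx_mul mulmxV // trmx1 mul1mx.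
Unshelve. all: by end_near. Qed.

(** The exterior derivative is the alternation of the partial derivatives, which by
    partial_assoc_form are the terms of der1E once they are referred to the frame u. *)
Lemma diff_valueE b : invariants G b ->
  diff_value P b a x u = - der1 frame_connection b.
Proof.
move=> Gb; have uu := frames_unit ax Pu.
pose W k := invmx u *m Gamma k *m u.
have -> : diff_value P b a x u =
    \sum_(k < N) wedge (ext_vec (u^T *m theta k.+1)) (der0 (W k)^T b).
  rewrite /diff_value /ext_diff linear_sum /=; apply: eq_bigr => k _.
  rewrite ext_act_wedge; congr (wedge _ _).
  rewrite (_ : [ffun S => _] = der0 (Gamma k)^T (ext_act (invmx u)^T b)); last first.
    by apply/ffunP => S; rewrite ffunE partial_assoc_form.
  rewrite (@ext_act_der0 _ _ _ _ (W k)^T); last first.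
    by rewrite -!trmx_mul /W !mulmxA mulmxV // mul1mx.
  by rewrite -ext_actM -trmx_mul mulVmx // trmx1 ext_act1.
rewrite der1E opprK.
transitivity (\sum_(k < N) \sum_(l < N) u k l *: wedge (ext_vec (theta l.+1)) (der0 (W k)^T b)).
  apply: eq_bigr => k _.
  have -> : u^T *m theta k.+1 = \sum_(l < N) u k l *: theta l.+1.
    apply/matrixP => i j; rewrite ord1 mulmx_theta summxE (bigD1 i) //= !mxE eqxx mulr1.
    by rewrite big1 ?addr0 // => l li; rewrite !mxE eqSS (inj_eq val_inj) eq_sym (negbTE li) mulr0.
  rewrite [ext_vec (\sum_l _)]linear_sum -[LHS]/(wedger _ _) linear_sum /=.
  by apply: eq_bigr => l _; rewrite [ext_vec (_ *: _)]linearZ /= [wedger _ _]linearZ.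
rewrite exchange_big; apply: eq_bigr => l _.
have -> : (frame_connection l)^T = \sum_(k < N) u k l *: (W k)^T.
  by rewrite ffunE linear_sum; apply: eq_bigr => k _; rewrite linearZ.
rewrite -[der0 _ b]/(der0_at b _) [der0_at b _]linear_sum /= [RHS]linear_sum.
by apply: eq_bigr => k _; rewrite [der0_at b _]linearZ /= linearZ.
Qed.

Lemma torsionE : torsion nabla a x u = - skew frame_connection.
Proof.
have cE k i j : frame_connection k i j =
    \sum_r \sum_p \sum_q invmx u i r * Gamma p r q * u q j * u p k.
  rewrite ffunE summxE exchange_big; apply: eq_bigr => p _.
  rewrite [LHS]mxE [(_ *m u) i j]mxE mulr_sumr exchange_big; apply: eq_bigr => q _.
  rewrite mxE mulr_suml mulr_sumr; apply: eq_bigr => r _; ring.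
apply/ffunP => k; apply/matrixP => i j; rewrite [torsion _ _ _ _ _]ffunE [LHS]mxE.
transitivity (- skew frame_connection k i j); last by rewrite [in RHS]ffunE [RHS]mxE.
rewrite [skew _ _]ffunE [X in - X]mxE opprB !cE.
rewrite -sumrB; apply: eq_bigr => r _.
rewrite [X in _ = _ - X]exchange_big -sumrB; apply: eq_bigr => p _.
rewrite -sumrB; apply: eq_bigr => q _; ring.
Qed.

End Torsion.

Section Determined.
Variables (R : realType) (n : nat).
Hypothesis n_gt1 : (1 < n)%N.
Local Notation N := n.*2.+1.
Local Notation SUn := (@SU R n).

(** By diff_valueE the difference of the two connections, read in the frames, is
    annihilated by the four forms; so it lies in (g (x) T) + (T (x) S^2 T) by
    Z0_squeeze. The second summand does not change the torsion, and the first moves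
    it within its class. *)
Lemma intrinsic_torsion_sub (M M' : manifold R N)
    (P : gstructure SUn M) (P' : gstructure SUn M')
    (nabla : connection P) (nabla' : connection P')
    (a : chart M) (x : M) (u : 'M[R]_N) (a' : chart M') (x' : M') (u' : 'M[R]_N) :
  cdom a x -> frames P a x u -> cdom a' x' -> frames P' a' x' u' ->
  (forall b, @generators R n b -> diff_value P b a x u = diff_value P' b a' x' u') ->
  intrinsic_torsion nabla a x u `<=` intrinsic_torsion nabla' a' x' u'.
Proof.
move=> ax Pu ax' Pu' dE; set c := frame_connection nabla a x u.
set c' := frame_connection nabla' a' x' u'.
have SO := @SU_orthogonal R n.
have : Z0 (@generators R n) (c - c').
  move=> b gb; have bI := generators_invariant gb; have := dE b gb.
  rewrite (diff_valueE SO nabla ax Pu bI) (diff_valueE SO nabla' ax' Pu' bI) => /oppr_inj e.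
  by rewrite -[c - c']addrC -scaleN1r der1_lin -/c e scaleN1r addNr.
have [-> _] := Z0_squeeze n_gt1 (@subset_refl _ _) (@generators_invariant R n).
move=> [X Xg [Y Ys XY]]; have [U UE] := gT_vspace R n.
move=> _ [e eg <-]; exists (e - X); first by apply/UE/memvB; apply/UE.
rewrite !torsionE -/c -/c'.
have cE : c = c' + (X + Y) by rewrite XY addrC subrK.
apply/ffunP => k; apply/matrixP => i j.
by rewrite cE !ffunE !mxE !ffunE !mxE (Ys i j k); ring.
Qed.

End Determined.

Theorem proposition17 (R : realType) (n : nat) (hn : (2 <= n)%N) :
  [/\ ordinary (invariants (@SU R n)) (@flagE R n),
      strongly_admissible (@SU R n)
    & forall (M M' : manifold R n.*2.+1)
        (P : gstructure (@SU R n) M) (P' : gstructure (@SU R n) M')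
        (nabla : connection P) (nabla' : connection P')
        (a : chart M) (x : M) (u : 'M[R]_n.*2.+1)
        (a' : chart M') (x' : M') (u' : 'M[R]_n.*2.+1),
      cdom a x -> frames P a x u -> cdom a' x' -> frames P' a' x' u' ->
      diff_value P (@alpha_form R n) a x u = diff_value P' (@alpha_form R n) a' x' u' ->
      diff_value P (@F_form R n) a x u = diff_value P' (@F_form R n) a' x' u' ->
      diff_value P (@ReOmega_form R n) a x u = diff_value P' (@ReOmega_form R n) a' x' u' ->
      diff_value P (@ImOmega_form R n) a x u = diff_value P' (@ImOmega_form R n) a' x' u' ->
      intrinsic_torsion nabla a x u = intrinsic_torsion nabla' a' x' u'].
Proof.
split=> [||M M' P P' nabla nabla' a x u a' x' u' ax Pu ax' Pu' da dF dRe dIm].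
- exact: ordinary_SU.
- exact: strongly_admissible_SU.
have dE b : @generators R n b -> diff_value P b a x u = diff_value P' b a' x' u'.
  by case=> ->.
apply/seteqP; split; first exact: (intrinsic_torsion_sub hn nabla' ax Pu ax' Pu' dE).
apply: (intrinsic_torsion_sub hn nabla ax' Pu' ax Pu) => b gb.
exact/esym/dE.
Qed.
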